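(* Let $K\subseteq\mathbb{C}^d$ be a compact convex set. Suppose that $S$ is a $d$-tuple of compact operators on a Hilbert space $H_1$ and $T$ is a $d$-tuple of compact operators on a Hilbert space $H_2$, that $S$ and $T$ are both fully compressed, and that $\mathcal{W}(S)=\mathcal{W}(T)=\mathcal{W}^{\min}(K)$. Then $S$ and $T$ are unitarily equivalent.
   Context: Let $\mathcal{M}^d=\bigcup_{n\ge1}M_n^d$, where $M_n^d$ is the set of $d$-tuples of complex $n\times n$ matrices. UCP means unital completely positive. For $T\in\mathcal{B}(H)^d$, the matrix range is $\mathcal{W}(T)=\bigcup_n\mathcal{W}_n(T)$, where $\mathcal{W}_n(T)=\{(\psi(T_1),\ldots,\psi(T_d)):\psi:\mathcal{B}(H)\to M_n\text{ UCP}\}$. A tuple of operators is normal if its members are normal and commute with each other; $\sigma(N)$ denotes the joint spectrum of a normal tuple. $Y\in\mathcal{B}(L)^d$ is a dilation of $X\in\mathcal{B}(H)^d$ (equivalently, $X$ is a compression of $Y$) if there is an isometry $V:H\to L$ with $X_i=V^*Y_iV$ for all $i$. For a compact convex set $K\subseteq\mathbb{C}^d$, $\mathcal{W}^{\min}(K)$ is the set of $X\in\mathcal{M}^d$ having a normal dilation $N$ with $\sigma(N)\subseteq K$. A tuple $T\in\mathcal{B}(H)^d$ is fully compressed if the compression of $T$ to any proper (closed) subspace of $H$ has strictly smaller matrix range. Tuples are unitarily equivalent if a single unitary $U:H_1\to H_2$ satisfies $S_i=U^*T_iU$ for all $i$. *)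

(* Defs.v *)
From HB Require Import structures.
From mathcomp Require Import all_boot all_order all_algebra.
From mathcomp Require Import all_classical all_reals all_analysis.
From mathcomp Require Import complex.

Set Implicit Arguments.
Unset Strict Implicit.
Unset Printing Implicit Defensive.

Import Order.TTheory GRing.Theory Num.Theory.
Import numFieldNormedType.Exports.

Local Open Scope classical_set_scope.
Local Open Scope ring_scope.

(* Packing R[i] as a [numClosedFieldType] lets it inherit the topology and the
   norm that MathComp-Analysis attaches to every [numFieldType]. In the partial
   order of this field, [0 <= z] means that z is real and nonnegative. *)
Definition Cplx (R : realType) : numClosedFieldType := complex R.

(* Inner products are linear in the first variable. *)
HB.mixin Record NormedModule_hasInner (R : realType) H
    & NormedModule (Cplx R) H := {
  inner : H -> H -> Cplx R ;
  inner_linear : forall z : H, scalar (fun x => inner x z) ;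
  inner_conj : forall x y : H, inner y x = (inner x y)^* ;
  inner_norm : forall x : H, inner x x = `|x| ^+ 2
}.

#[short(type="hilbertType")]
HB.structure Definition Hilbert (R : realType) :=
  {H of CompleteNormedModule (Cplx R) H & NormedModule_hasInner R H}.

Section BoundedOperators.
Variables (R : realType) (H L : hilbertType R).

Definition bop_pred : {pred H -> L} :=
  [pred f | `[< linear f /\ continuous (f : H -> L) >]].

Record bop := Bop { bop_fun :> H -> L ; bop_funP : bop_fun \in bop_pred }.

HB.instance Definition _ := [isSub for bop_fun].
HB.instance Definition _ := [Choice of bop by <:].

Lemma bop_submod_closed : submod_closed bop_pred.
Proof.
split.
  apply/asboolP; split; last exact: cst_continuous.
  by move=> a x y /=; rewrite scaler0 addr0.
move=> a f g /asboolP[fl fc] /asboolP[gl gc]; apply/asboolP; split.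
  move=> b x y /=.
  have -> z : (a *: f + g) z = a *: f z + g z by [].
  by rewrite !(fl, gl) !scalerDr !scalerA mulrC addrACA.
move=> x; apply: cvgD; last exact: gc.
by apply: cvgZr; exact: fc.
Qed.

HB.instance Definition _ :=
  GRing.isSubmodClosed.Build _ _ bop_pred bop_submod_closed.
HB.instance Definition _ := [SubChoice_isSubLmodule of bop by <:].

End BoundedOperators.
Arguments bop {R} H L.

Lemma bop_id_subproof (R : realType) (H : hilbertType R) :
  idfun \in bop_pred (H := H) (L := H).
Proof. by apply/asboolP; split=> // x; exact: cvg_id. Qed.

Definition bop_id (R : realType) (H : hilbertType R) : bop H H :=
  Bop (bop_id_subproof H).

Section ClosedSubspaces.
Variables (R : realType) (H : hilbertType R).

Record csubspace := CSubspace {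
  cscarrier :> set H ;
  cs_zero : cscarrier 0 ;
  cs_linear : forall (a : Cplx R) (x y : H),
    cscarrier x -> cscarrier y -> cscarrier (a *: x + y) ;
  cs_closed : closed cscarrier
}.

Variable G : csubspace.

Definition cspred : {pred H} := [pred x | x \in (G : set H)].

Record cspoint := CSPoint { csval :> H ; csvalP : csval \in cspred }.

HB.instance Definition _ := [isSub for csval].
HB.instance Definition _ := [Choice of cspoint by <:].

Lemma cspred_submod_closed : submod_closed cspred.
Proof.
split; first by rewrite !inE; exact: cs_zero.
by move=> a x y; rewrite !inE; exact: cs_linear.
Qed.

HB.instance Definition _ :=
  GRing.isSubmodClosed.Build _ _ cspred cspred_submod_closed.
HB.instance Definition _ := [SubChoice_isSubLmodule of cspoint by <:].

Let csnorm (x : cspoint) : Cplx R := `|csval x|.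

Let csnormD x y : csnorm (x + y) <= csnorm x + csnorm y.
Proof. exact: ler_normD. Qed.

Let csnormZ (a : Cplx R) x : csnorm (a *: x) = `|a| * csnorm x.
Proof. exact: normrZ. Qed.

Let csnorm0 x : csnorm x = 0 -> x = 0.
Proof. by move=> /normr0_eq0 x0; apply: val_inj. Qed.

HB.instance Definition _ :=
  Lmodule_isNormed.Build (Cplx R) cspoint csnormD csnormZ csnorm0.

Lemma cs_complete (F : set_system cspoint) :
  ProperFilter F -> cauchy F -> cvg F.
Proof.
move=> FF Fc.
have F'c : cauchy (csval @ F).
  apply/cauchy_ballP => e e0.
  have /cauchy_ballP/(_ e e0) := Fc.
  rewrite /near /= => -[[A B] /= [FA FB] AB].
  exists (csval @` A, csval @` B) => /=.
    by split; rewrite /nbhs /=; [apply: filterS FA|apply: filterS FB] => z Az;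
       exists z.
  move=> [_ _] [/= [x Ax <-] [y By <-]].
  have := AB (x, y) (conj Ax By).
  by rewrite -!ball_normE.
have /cvg_ex[l Fl] : cvg (csval @ F) by exact: cauchy_cvg.
have Gl : l \in cspred.
  rewrite !inE; apply: (closed_cvg _ (@cs_closed G) _ _ Fl).
  by apply: nearW => x; have := csvalP x; rewrite !inE.
apply/cvg_ex; exists (CSPoint Gl).
apply/cvg_ballP => e e0.
have /cvg_ballP/(_ e e0) := Fl.
rewrite !near_simpl; apply: filterS => x.
by rewrite -!ball_normE.
Qed.

HB.instance Definition _ := Uniform_isComplete.Build cspoint cs_complete.

Let csinner (x y : cspoint) : Cplx R := inner (csval x) (csval y).

Let csinner_linear z : scalar (fun x => csinner x z).
Proof. by move=> a x y; exact: inner_linear. Qed.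

Let csinner_conj x y : csinner y x = (csinner x y)^*.
Proof. exact: inner_conj. Qed.

Let csinner_norm x : csinner x x = `|x| ^+ 2.
Proof. exact: inner_norm. Qed.

HB.instance Definition _ := NormedModule_hasInner.Build R cspoint
  csinner_linear csinner_conj csinner_norm.

End ClosedSubspaces.
Arguments csubspace {R} H.

Section Tuples.
Variables (R : realType) (d : nat).
Local Notation C := (Cplx R).

Definition optuple (H : hilbertType R) := 'I_d -> bop H H.

(* The disjoint union of the M_n^d over n >= 1: the tag n stands for size n+1. *)
Definition mxtuple := {n : nat & 'I_d -> 'M[C]_n.+1}.

Definition cinner n (x y : 'cV[C]_n) : C := \sum_k x k 0 * (y k 0)^*.

Section MatrixRange.
Variable H : hilbertType R.

(* Positivity of the matrix of operators (A i j) acting on H^k. *)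
Definition bop_block_pos k (A : 'I_k -> 'I_k -> bop H H) :=
  forall x : 'I_k -> H, 0 <= \sum_i \sum_j inner (A i j (x j)) (x i).

Definition mx_block_pos n k (A : 'I_k -> 'I_k -> 'M[C]_n) :=
  forall x : 'I_k -> 'cV[C]_n, 0 <= \sum_i \sum_j cinner (A i j *m x j) (x i).

Definition completely_positive n (psi : bop H H -> 'M[C]_n) :=
  forall k (A : 'I_k -> 'I_k -> bop H H),
    bop_block_pos A -> mx_block_pos (fun i j => psi (A i j)).

Definition ucp n (psi : {linear bop H H -> 'M[C]_n}) :=
  psi (bop_id H) = 1%:M /\ completely_positive psi.

Definition matrix_range (T : optuple H) : set mxtuple :=
  [set X : mxtuple | exists2 psi : {linear bop H H -> 'M[C]_((tag X).+1)},
     ucp psi & forall i, tagged X i = psi (T i)].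

End MatrixRange.

Definition adjoint (H L : hilbertType R) (A : bop H L) (B : bop L H) :=
  forall x y, inner (A x) y = inner x (B y).

Section NormalTuples.
Variable L : hilbertType R.

Definition normal_op (A : bop L L) :=
  exists2 B : bop L L, adjoint A B & forall x, A (B x) = B (A x).

Definition normal_tuple (N : optuple L) :=
  (forall i, normal_op (N i)) /\ (forall i j x, N i (N j x) = N j (N i x)).

(* The Harte spectrum: lambda is outside when N - lambda is invertible, i.e.
   both sum_i B_i (N_i - lambda_i) = 1 and sum_i (N_i - lambda_i) B'_i = 1 can
   be solved in B(L). For d = 1 this is the usual spectrum. *)
Definition joint_spectrum (N : optuple L) : set 'rV[C]_d :=
  [set l | ~ ((exists B : optuple L,
                 forall x, \sum_i B i (N i x - l 0 i *: x) = x)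
           /\ (exists B : optuple L,
                 forall x, \sum_i (N i (B i x) - l 0 i *: B i x) = x))].

End NormalTuples.

(* X = V^* N V for an isometry V : C^n -> L with adjoint W. *)
Definition mx_dilation (X : mxtuple) (L : hilbertType R) (N : optuple L) :=
  exists (V : {linear 'cV[C]_((tag X).+1) -> L}) (W : L -> 'cV[C]_((tag X).+1)),
    [/\ forall x y, inner (V x) (V y) = cinner x y,
        forall x y, inner (V x) y = cinner x (W y)
      & forall i x, tagged X i *m x = W (N i (V x))].

Definition Wmin (K : set 'rV[C]_d) : set mxtuple :=
  [set X : mxtuple | exists (L : hilbertType R) (N : optuple L),
     [/\ normal_tuple N, joint_spectrum N `<=` K & mx_dilation X N]].

Section Compressions.
Variable H : hilbertType R.

Definition orth_proj (G : csubspace H) (x : H) (p : cspoint G) :=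
  forall y : cspoint G, inner (x - csval p) (csval y) = 0.

(* X = (P_G T_1 |_G, ..., P_G T_d |_G); such an X exists and is unique for every
   T and G, since G is complete. *)
Definition compression (T : optuple H) (G : csubspace H)
    (X : optuple (cspoint G)) :=
  forall i x, orth_proj (T i (csval x)) (X i x).

Definition fully_compressed (T : optuple H) :=
  forall (G : csubspace H) (X : optuple (cspoint G)),
    (G : set H) `<` setT -> compression T X ->
    matrix_range X `<` matrix_range T.

Definition compact_op (A : bop H H) :=
  compact (closure (A @` [set x | `|x| <= 1])).

End Compressions.

Definition unitarily_equivalent (H1 H2 : hilbertType R)
    (S : optuple H1) (T : optuple H2) :=
  exists (U : bop H1 H2) (V : bop H2 H1),
    [/\ adjoint U V, forall x, V (U x) = x, forall y, U (V y) = y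
      & forall i x, S i x = V (T i (U x))].

End Tuples.

(* Main.v *)
From HB Require Import structures.
Require Import Defs.
From mathcomp Require Import all_boot all_order all_algebra.
From mathcomp Require Import all_classical all_reals all_analysis.
From mathcomp Require Import complex ring lra.

(** Every [X] in [Wmin K] is a finite sum [X_i = sum_j z_j,i B_j] with [z_j] in
    [K], [B_j >= 0] and [sum_j B_j = 1]. If not, separation yields a matrix
    valued affine function that is positive on [K] but not at a normal tuple with
    spectrum in [K]; by Fuglede's theorem the negative part of the resulting
    selfadjoint operator contains joint approximate eigenvectors of the tuple,
    whose eigenvalue is then a point of [K] where the function is not positive.

    Reading off a 2x2 corner of this decomposition at an extreme point [lam] of
    [K] shows that a state [phi] with [phi (S_i) = lam_i] is multiplicative on
    the [S_i]. For compact [S] and [lam <> 0] this forces a reducing joint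
    eigenvector with eigenvalue [lam]; such eigenvectors are orthogonal for
    distinct [lam], so the nonzero extreme points accumulate only at [0]. One
    eigenvector for each extreme point (with [0] dropped when the others
    accumulate there) already generates [Wmin K], so these eigenvectors span the
    space of a fully compressed tuple. Hence [S] and [T] are the same diagonal
    tuple, determined by [K] alone. *)

Set Implicit Arguments.
Unset Strict Implicit.
Unset Printing Implicit Defensive.

Import Order.TTheory GRing.Theory Num.Theory.
Import numFieldNormedType.Exports.

Local Open Scope classical_set_scope.
Local Open Scope ring_scope.

(** * Real and imaginary parts *)

(** The matrix range records only what UCP maps into matrices see, so facts about [S] itself have to
    be tested through such maps. The link in both directions is states: a pair [1, b] orthonormal
    for the GNS form of a state yields a UCP map into 2x2 matrices, and states with values at every
    point of [closure (extreme K)] already rebuild all of [Wmin K]. Full compression is contradicted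
    by the latter, through a proper subspace whose compression keeps all these states.

    The point 0 is the obstacle. Compactness turns approximate eigenvectors into eigenvectors only
    for a nonzero eigenvalue. At 0 the alternative is a state vanishing on all rank-one projections;
    it does not notice the removal of a vector orthogonal to the finitely many other eigenvectors,
    so that vector could be compressed away. When nonzero extreme points accumulate at 0, an
    ultrafilter limit of their vector states supplies the value 0 instead.

    The joint spectrum is defined by solvability of inverse equations; approximate eigenvectors,
    obtained by a variational argument, take the place of a spectral measure. *)

Section ComplexParts.
Variable R : realType.
Local Notation C := (Cplx R).

Definition re (z : C) : R := complex.Re z.
Definition im (z : C) : R := complex.Im z.
Definition rc (r : R) : C := real_complex R r.

Lemma re_is_zmod : zmod_morphism re. Proof. by case=> [a b] [c d]. Qed.
HB.instance Definition _ := GRing.isZmodMorphism.Build C R re re_is_zmod.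
Lemma im_is_zmod : zmod_morphism im. Proof. by case=> [a b] [c d]. Qed.
HB.instance Definition _ := GRing.isZmodMorphism.Build C R im im_is_zmod.
Lemma rc_is_zmod : zmod_morphism rc.
Proof. by move=> a b; rewrite /rc rmorphB. Qed.
HB.instance Definition _ := GRing.isZmodMorphism.Build R C rc rc_is_zmod.
Lemma rc_is_monoid : monoid_morphism rc.
Proof. by split=> [|a b]; rewrite /rc ?rmorph1 ?rmorphM. Qed.
HB.instance Definition _ := GRing.isMonoidMorphism.Build R C rc rc_is_monoid.

Lemma re_rc r : re (rc r) = r. Proof. by []. Qed.
Lemma im_rc r : im (rc r) = 0. Proof. by []. Qed.
Lemma re1 : re 1 = 1. Proof. by []. Qed.
Lemma reM z w : re (z * w) = re z * re w - im z * im w.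
Proof. by case: z w => [a b] [c d]. Qed.
Lemma imM z w : im (z * w) = re z * im w + im z * re w.
Proof. by case: z w => [a b] [c d]. Qed.
Lemma re_rcM r z : re (rc r * z) = r * re z.
Proof. by rewrite reM im_rc mul0r subr0. Qed.
Lemma im_rcM r z : im (rc r * z) = r * im z.
Proof. by rewrite imM im_rc mul0r addr0. Qed.
Lemma re_conj z : re (z^*) = re z. Proof. by case: z. Qed.
Lemma im_conj z : im (z^*) = - im z. Proof. by case: z. Qed.
Lemma conj_rc r : (rc r)^* = rc r.
Proof. by rewrite /rc /real_complex_def /Num.conj /= oppr0. Qed.
Lemma cplxP z w : re z = re w -> im z = im w -> z = w.
Proof. by case: z w => [a b] [c d] /= -> ->. Qed.
Lemma ge0E z : (0 <= z) = (im z == 0) && (0 <= re z).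
Proof. exact: lecE. Qed.
Lemma rc_ge0 r : (0 <= rc r) = (0 <= r).
Proof. by rewrite ge0E im_rc eqxx. Qed.
Lemma rc_le r s : (rc r <= rc s) = (r <= s).
Proof. by rewrite -subr_ge0 -rmorphB rc_ge0 subr_ge0. Qed.
Lemma rc_lt r s : (rc r < rc s) = (r < s).
Proof. exact: ltcR. Qed.
Lemma ge0_rc z : 0 <= z -> z = rc (re z).
Proof. by rewrite ge0E => /andP[/eqP i0 _]; exact: cplxP. Qed.
Lemma le_re z w : z <= w -> re z <= re w.
Proof. by rewrite lecE => /andP[]. Qed.
Lemma lt_re z w : z < w -> re z < re w.
Proof. by rewrite ltcE => /andP[]. Qed.
Lemma re_ge0 z : 0 <= z -> 0 <= re z.
Proof. by rewrite ge0E => /andP[]. Qed.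
Lemma re_norm (z : C) : rc (re `|z|) = `|z|.
Proof. by rewrite -ge0_rc. Qed.
Lemma sqr_norm (z : C) : `|z| ^+ 2 = rc (re z ^+ 2 + im z ^+ 2).
Proof.
rewrite normCK; apply: cplxP.
  by rewrite reM re_conj im_conj re_rc !expr2; ring.
by rewrite imM re_conj im_conj im_rc; ring.
Qed.
Lemma mul_conj (z : C) : z * z^* = rc (re z ^+ 2 + im z ^+ 2).
Proof. by rewrite -normCK sqr_norm. Qed.
Lemma norm_re (z : C) : `|re z| <= re `|z|.
Proof.
rewrite -rc_le re_norm -ler_sqr ?nnegrE ?normr_ge0 ?rc_ge0 //.
rewrite sqr_norm -rmorphXn real_normK ?num_real ?rc_le ?lerDl ?sqr_ge0 //.
Qed.
Lemma norm_im (z : C) : `|im z| <= re `|z|.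
Proof.
rewrite -rc_le re_norm -ler_sqr ?nnegrE ?normr_ge0 ?rc_ge0 //.
by rewrite sqr_norm -rmorphXn real_normK ?num_real // rc_le lerDr sqr_ge0.
Qed.
Lemma norm_rc r : `|rc r| = rc `|r|.
Proof.
apply: (@pexpIrn _ 2) => //; rewrite ?nnegrE ?normr_ge0 ?rc_ge0 //.
rewrite sqr_norm -rmorphXn; congr rc.
by rewrite im_rc re_rc expr0n addr0 real_normK ?num_real.
Qed.

Lemma reN z : re (- z) = - re z. Proof. exact: raddfN. Qed.
Lemma imN z : im (- z) = - im z. Proof. exact: raddfN. Qed.
Lemma reD z w : re (z + w) = re z + re w. Proof. exact: raddfD. Qed.
Lemma imD z w : im (z + w) = im z + im w. Proof. exact: raddfD. Qed.
Lemma reB z w : re (z - w) = re z - re w. Proof. exact: raddfB. Qed.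
Lemma imB z w : im (z - w) = im z - im w. Proof. exact: raddfB. Qed.
Lemma rcD r s : rc (r + s) = rc r + rc s. Proof. exact: rmorphD. Qed.
Lemma rcM r s : rc (r * s) = rc r * rc s. Proof. exact: rmorphM. Qed.
Lemma rcX r n : rc (r ^+ n) = rc r ^+ n. Proof. exact: rmorphXn. Qed.
Lemma rc0 : rc 0 = 0. Proof. by []. Qed.
Lemma rc1 : rc 1 = 1. Proof. by []. Qed.
Lemma re0 : re 0 = 0. Proof. by []. Qed.
Lemma rc_nat n : rc n%:R = n%:R. Proof. exact: rmorph_nat. Qed.
Definition ci : C := Complex 0 1.
Lemma re_ci : re ci = 0. Proof. by []. Qed.
Lemma im_ci : im ci = 1. Proof. by []. Qed.
Lemma conj_ci : ci^* = - ci.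
Proof. by apply: cplxP; rewrite (re_conj, im_conj) (reN, imN) (re_ci, im_ci) ?oppr0. Qed.
Lemma im1 : im 1 = 0. Proof. by []. Qed.
Lemma sqr_ci : ci * ci = -1.
Proof.
by apply: cplxP; rewrite (reM, imM) re_ci im_ci (reN, imN) (re1, im1); ring.
Qed.
Lemma cplxE (z : C) : z = rc (re z) + ci * rc (im z).
Proof. by apply: cplxP; rewrite (reD, imD) (reM, imM) re_ci im_ci (re_rc, im_rc) ?re_rc ?im_rc; ring. Qed.
End ComplexParts.
Arguments re {R} z : simpl never.
Arguments im {R} z : simpl never.
Arguments rc {R} r : simpl never.
Arguments ci {R}.

(** * Positive semidefinite sesquilinear forms *)

Record psd_form (R : realType) (E : lmodType (Cplx R)) (q : E -> E -> Cplx R) :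
    Prop := PsdForm {
  form_linear : forall z, scalar (q^~ z) ;
  form_conj : forall x y, q y x = (q x y)^* ;
  form_ge0 : forall x, 0 <= q x x }.

Section PsdForms.
Variables (R : realType) (E : lmodType (Cplx R)) (q : E -> E -> Cplx R).
Local Notation C := (Cplx R).
Hypothesis Q : psd_form q.
Implicit Types (x y z : E) (c : C) (t : R).

Definition nq x : R := re (q x x).

Lemma form0l z : q 0 z = 0.
Proof.
by have := form_linear Q z (-1) 0 0; rewrite scaler0 addr0 mulN1r addNr.
Qed.
Lemma formDl x y z : q (x + y) z = q x z + q y z.
Proof. by have := form_linear Q z 1 x y; rewrite scale1r mul1r. Qed.
Lemma formZl c x z : q (c *: x) z = c * q x z.
Proof. by have := form_linear Q z c x 0; rewrite form0l !addr0. Qed.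
Lemma formNl x z : q (- x) z = - q x z.
Proof. by rewrite -scaleN1r formZl mulN1r. Qed.
Lemma formBl x y z : q (x - y) z = q x z - q y z.
Proof. by rewrite formDl formNl. Qed.
Lemma form0r z : q z 0 = 0.
Proof. by rewrite (form_conj Q 0) form0l rmorph0. Qed.
Lemma formDr x y z : q x (y + z) = q x y + q x z.
Proof.
by rewrite (form_conj Q (y + z)) formDl rmorphD /= -(form_conj Q y) -(form_conj Q z).
Qed.
Lemma formZr c x z : q x (c *: z) = c^* * q x z.
Proof. by rewrite (form_conj Q (c *: z)) formZl rmorphM /= -(form_conj Q z). Qed.
Lemma formNr x z : q x (- z) = - q x z.
Proof. by rewrite -scaleN1r formZr rmorphN rmorph1 mulN1r. Qed.
Lemma formBr x y z : q x (y - z) = q x y - q x z.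
Proof. by rewrite formDr formNr. Qed.
Lemma form_suml I (r : seq I) (P : pred I) (F : I -> E) z :
  q (\sum_(i <- r | P i) F i) z = \sum_(i <- r | P i) q (F i) z.
Proof. by apply: (big_morph (q^~ z)) => [x y|]; rewrite ?formDl ?form0l. Qed.
Lemma form_sumr I (r : seq I) (P : pred I) (F : I -> E) z :
  q z (\sum_(i <- r | P i) F i) = \sum_(i <- r | P i) q z (F i).
Proof. by apply: (big_morph (q z)) => [x y|]; rewrite ?formDr ?form0r. Qed.

Lemma nq_ge0 x : 0 <= nq x. Proof. exact/re_ge0/form_ge0. Qed.
Lemma form_nq x : q x x = rc (nq x). Proof. exact/ge0_rc/form_ge0. Qed.
Lemma re_formC x y : re (q y x) = re (q x y).
Proof. by rewrite (form_conj Q x) re_conj. Qed.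
Lemma nqD x y : nq (x + y) = nq x + nq y + 2 * re (q x y).
Proof. by rewrite /nq formDl !formDr !raddfD /= (re_formC x y); ring. Qed.
Lemma nqZ c x : nq (c *: x) = (re c ^+ 2 + im c ^+ 2) * nq x.
Proof.
by rewrite /nq formZl formZr mulrA mul_conj re_rcM.
Qed.
Lemma nqZr t x : nq (rc t *: x) = t ^+ 2 * nq x.
Proof. by rewrite nqZ re_rc im_rc expr0n addr0. Qed.
Lemma nqN x : nq (- x) = nq x.
Proof. by rewrite /nq formNl formNr opprK. Qed.
Lemma nqB x y : nq (x - y) = nq x + nq y - 2 * re (q x y).
Proof. by rewrite nqD nqN formNr raddfN /=; ring. Qed.
Lemma nq_parallel x y : nq (x + y) + nq (x - y) = 2 * nq x + 2 * nq y.
Proof. by rewrite nqD nqB; ring. Qed.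
Lemma nqD_le x y : nq (x + y) <= 2 * nq x + 2 * nq y.
Proof. by have := nq_parallel x y; have := nq_ge0 (x - y); lra. Qed.

Lemma form_cauchy x y : re (q x y) ^+ 2 + im (q x y) ^+ 2 <= nq x * nq y.
Proof.
set s := _ + _.
have s0 : 0 <= s by rewrite addr_ge0 ?sqr_ge0.
have key t : 0 <= nq x - 2 * t * s + t ^+ 2 * s * nq y.
  have := nq_ge0 (x - (rc t * q x y) *: y); rewrite nqB nqZ re_rcM im_rcM formZr.
  rewrite rmorphM /= conj_rc -mulrA [(q x y)^* * _]mulrC mul_conj re_rcM re_rc -/s.
  suff -> : (t * re (q x y)) ^+ 2 + (t * im (q x y)) ^+ 2 = t ^+ 2 * s by lra.
  by rewrite /s; ring.
have [y0|y0] := eqVneq (nq y) 0.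
  rewrite y0 mulr0 in key *; rewrite leNgt; apply/negP => sp.
  (* If [nq y = 0], [key] is affine in [t] and this [t] makes its right side -1. Otherwise the
     minimizing [t = 1 / nq y] gives the inequality. *)
  have := key ((nq x + 1) / (2 * s)).
  rewrite mulr0 addr0.
  have -> : 2 * ((nq x + 1) / (2 * s)) * s = nq x + 1.
    by field; rewrite gt_eqF.
  lra.
have yp : 0 < nq y by rewrite lt_def y0 nq_ge0.
have := key (nq y)^-1.
have -> : nq x - 2 * (nq y)^-1 * s + (nq y)^-1 ^+ 2 * s * nq y =
  (nq x * nq y - s) / nq y by field.
by rewrite pmulr_lge0 ?invr_gt0 // subr_ge0.
Qed.

Lemma form_eq0 x y : nq x = 0 -> q x y = 0.
Proof.
move=> x0; have := form_cauchy x y; rewrite x0 mul0r => s0.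
have /eqP : re (q x y) ^+ 2 + im (q x y) ^+ 2 = 0.
  by apply/eqP; rewrite eq_le s0 addr_ge0 ?sqr_ge0.
rewrite paddr_eq0 ?sqr_ge0 // !sqrf_eq0 => /andP[/eqP r0 /eqP i0].
exact: cplxP.
Qed.
End PsdForms.

(** Hermitian symmetry by polarization: the values at [x + y] and [i x + y] are real. *)
Lemma psd_formP (R : realType) (E : lmodType (Cplx R)) (q : E -> E -> Cplx R) :
  (forall z, scalar (q^~ z)) ->
  (forall c x y z, q z (c *: x + y) = c^* * q z x + q z y) ->
  (forall x, 0 <= q x x) -> psd_form q.
Proof.
move=> lin alin pos.
have Z z : q 0 z = 0.
  by have := lin z (-1) 0 0; rewrite scaler0 addr0 mulN1r addNr.
have Z' z : q z 0 = 0.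
  have := alin (-1) 0 0 z; rewrite scaler0 addr0 rmorphN rmorph1 mulN1r.
  by rewrite addNr.
split=> // x y.
have P1 := pos (x + y).
have P2 := pos (ci *: x + y).
have e1 : q (x + y) (x + y) = q x x + q x y + q y x + q y y.
  have := lin (x + y) 1 x y; rewrite scale1r mul1r => ->.
  have := alin 1 x y; rewrite scale1r rmorph1 => A.
  by rewrite !A !mul1r !addrA.
have e2 : q (ci *: x + y) (ci *: x + y) =
    q x x + ci * q x y - ci * q y x + q y y.
  rewrite lin !alin conj_ci mulrDr !mulrA mulrN sqr_ci opprK mul1r.
  by rewrite mulNr !addrA.
have ix z : im (q z z) = 0.
  by have := pos z; rewrite ge0E => /andP[/eqP].
move: P1; rewrite e1 ge0E => /andP[/eqP + _]; rewrite !raddfD /= !ix => E1.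
move: P2; rewrite e2 ge0E => /andP[/eqP + _]; rewrite !raddfD raddfN /= !ix.
rewrite !imM re_ci im_ci => E2.
apply: cplxP; rewrite ?re_conj ?im_conj; lra.
Qed.

(** * Joint approximate eigenvectors *)

Section Schur.
Variables (R : realType).
Local Notation C := (Cplx R).

(** Schur product theorem by eliminating one vector at a time: projecting out a non-null [eta]
    splits the Gram matrix of [xi] into a rank-one matrix, covered by the hypothesis on [g], and a
    Gram matrix with fewer nonzero vectors. The cone [D] is abstract because it serves both for
    [0 <= z] and, with a non-Hermitian [g], for [0 <= re z]. *)
Lemma schur_product (D : C -> Prop) n (g : 'I_n -> 'I_n -> C)
    (E : lmodType C) (q : E -> E -> C) (xi : 'I_n -> E) :
  D 0 -> (forall a b, D a -> D b -> D (a + b)) ->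
  (forall x : 'I_n -> C, D (\sum_k \sum_l g k l * (x k * (x l)^*))) ->
  psd_form q -> D (\sum_k \sum_l g k l * q (xi k) (xi l)).
Proof.
move=> D0 DD gD Q.
have [m] := ubnP #|[pred k | xi k != 0]|.
elim: m => // m IH in xi *; rewrite ltnS => xim.
have [k0 xk0|xi0] := pickP [pred k | xi k != 0]; last first.
  rewrite big1 // => k _; rewrite big1 // => l _.
  by have /eqP -> := negbFE (xi0 k); rewrite (form0l Q) mulr0.
set eta := xi k0; rewrite /= -/eta in xk0.
have decr (xi' : 'I_n -> E) : xi' k0 = 0%R -> (forall k, xi k = 0%R -> xi' k = 0%R) ->
    (#|[pred k | xi' k != 0%R]| < m)%N.
  move=> z0 zz; apply: leq_trans xim; apply/proper_card/properP; split.
    by apply/fintype.subsetP => k; rewrite !inE; apply: contraNN => /eqP/zz ->.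
  by exists k0; rewrite !inE ?z0 ?eqxx.
(* A null vector pairs to 0 with everything, so it may be replaced by 0. *)
have [s0|s0] := eqVneq (nq q eta) 0.
  pose xi' k := if k == k0 then 0 else xi k.
  have := IH xi' (decr xi' _ _).
  rewrite /xi' eqxx; set S := \sum_k _ => H.
  have -> : \sum_k \sum_l g k l * q (xi k) (xi l) = S.
    apply: eq_bigr => k _; apply: eq_bigr => l _; congr (_ * _).
    have [->|_] := eqVneq k k0; first by rewrite (form0l Q) (form_eq0 Q).
    have [->|_ //] := eqVneq l k0.
    by rewrite (form0r Q) (form_conj Q eta) (form_eq0 Q) // rmorph0.
  by apply: H => // k ->; case: ifP.
pose s := nq q eta; have sp : 0 < s by rewrite lt_def s0 (nq_ge0 Q).
have rs0 : rc s != 0 by rewrite gt_eqF // -(rmorph0 rc) rc_lt.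
pose c k := q (xi k) eta / rc s.
have cE k : c k = q (xi k) eta / rc s by [].
clearbody c.
pose xi' k := xi k - c k *: eta.
have xi'E k : xi' k = xi k - c k *: eta by [].
clearbody xi'.
have qeta : q eta eta = rc s by rewrite (form_nq Q).
have xi'eta k : q (xi' k) eta = 0.
  by rewrite xi'E (formBl Q) (formZl Q) qeta cE divfK // subrr.
have e k l : q (xi k) (xi l) = (c k * rc (Num.sqrt s)) * (c l * rc (Num.sqrt s))^*
    + q (xi' k) (xi' l).
  have {1}-> : xi k = xi' k + c k *: eta by rewrite xi'E subrK.
  have {1}-> : xi l = xi' l + c l *: eta by rewrite xi'E subrK.
  rewrite !(formDl Q) !(formDr Q) !(formZl Q) !(formZr Q). rewrite !xi'eta.
  rewrite (form_conj Q (xi' l) eta) xi'eta rmorph0 !mulr0 addr0 add0r addrC.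
  congr (_ + _); rewrite qeta rmorphM /= conj_rc.
  have -> : rc s = rc (Num.sqrt s) * rc (Num.sqrt s).
    by rewrite -rmorphM -expr2 sqr_sqrtr // ltW.
  ring.
under eq_bigr do (under eq_bigr do rewrite e mulrDr; rewrite big_split /=).
rewrite big_split /=; apply: DD.
  exact: (gD (fun k => c k * rc (Num.sqrt s))).
apply: IH; apply: decr.
  by rewrite xi'E cE qeta divff // scale1r subrr.
by move=> k k0'; rewrite xi'E cE k0' (form0l Q) mul0r scale0r subrr.
Qed.
End Schur.

Section JointApprox.
Variables (R : realType) (E : lmodType (Cplx R)) (q : E -> E -> Cplx R).
Local Notation C := (Cplx R).
Hypothesis Q : psd_form q.
Local Notation nq := (nq q).
Implicit Types (T H : E -> E) (x : E).

Definition bdd T := exists2 c : R, 0 <= c & forall x, nq (T x) <= c * nq x.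
Definition sadj T := forall x y, q (T x) y = q x (T y).

Section Step.
Variables (k : nat) (T : nat -> E -> E) (H : E -> E).
Hypothesis Tlin : forall i, linear (T i).
Hypothesis Hlin : linear H.
Hypothesis Hbdd : bdd H.
Hypothesis Hsadj : sadj H.
Hypothesis TH : forall i x, T i (H x) = H (T i x).
Let p x : R := \sum_(i < k) nq (T i x).
Hypothesis approx : forall e : R, 0 < e -> exists2 x, nq x = 1 & p x < e.

(** Its supremum is the lower limit of [<H x, x>] over unit vectors as the defect [p x] tends to
    0. *)
Let B : set R := [set v | exists2 e : R, 0 < e &
  forall x, nq x = 1 -> p x < e -> v <= re (q (H x) x)].

(** Let [mu] be the bottom of [<H x, x>] on approximate null vectors of the [T i]. There
    [K = H - mu] is almost positive, and an almost minimizing [x] has [K x] small: otherwise the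
    descent step [x - t K x], still an approximate null vector since [H] commutes with the [T i],
    would go below the bottom. The first clause is what later keeps a negative value negative. *)
Lemma approx_step : exists mu : R,
  (forall v : R, (forall e : R, 0 < e -> exists x,
     [/\ nq x = 1, p x < e & re (q (H x) x) <= v]) -> mu <= v) /\
  forall e : R, 0 < e -> exists2 x, nq x = 1 & p x + nq (H x - rc mu *: x) < e.
Proof.
have [c c0 Hc] := Hbdd.
have numb x : nq x = 1 -> `|re (q (H x) x)| <= c + 1.
  move=> x1.
  have cs := form_cauchy Q (H x) x.
  have hh := Hc x; rewrite x1 mulr1 in cs hh.
  rewrite -(ler_pXn2r (n := 2)) ?nnegrE ?addr_ge0 // real_normK ?num_real //.
  by have := sqr_ge0 (im (q (H x) x)); nra.
have Bub v : B v -> v <= c + 1.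
  move=> [e e0 /(_ _ _ _) ev]; have [x x1 xe] := approx e0.
  by apply: le_trans (ev _ x1 xe) _; apply: le_trans (ler_norm _) (numb _ x1).
have B0 : B (- (c + 1)).
  exists 1 => // x x1 _.
  by have := numb x x1; rewrite ler_norml => /andP[].
have Bsup : has_sup B by split; [exists (- (c + 1)) | exists (c + 1)].
pose mu := sup B; exists mu.
have up v : (forall e : R, 0 < e -> exists x,
     [/\ nq x = 1, p x < e & re (q (H x) x) <= v]) -> mu <= v.
  move=> vP; apply: ge_sup; first by exists (- (c + 1)).
  move=> w [e e0 we]; have [x [x1 xe xv]] := vP _ e0.
  exact: le_trans (we _ x1 xe) xv.
split=> // e e0.
have lo d : 0 < d -> exists2 e : R, 0 < e &
    forall x, nq x = 1 -> p x < e -> mu - d <= re (q (H x) x).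
  move=> d0; have [v [e1 e10 ve] dv] := sup_adherent d0 Bsup.
  by exists e1 => // x x1 xe; apply: le_trans (ltW dv) (ve _ x1 xe).
have hi d e1 : 0 < d -> 0 < e1 -> exists x,
    [/\ nq x = 1, p x < e1 & re (q (H x) x) < mu + d].
  move=> d0 e10; apply: contrapT => nx.
  have : B (mu + d).
    exists e1 => // x x1 xe; rewrite leNgt; apply/negP => xd.
    by apply: nx; exists x.
  by move=> /(ub_le_sup Bsup.2); rewrite -/mu; lra.
pose K x := H x - rc mu *: x.
have Klin : linear K.
  move=> a x y; rewrite /K Hlin scalerDr scalerBr !scalerA [rc mu * a]mulrC.
  by rewrite opprD addrACA.
have KT i x : T i (K x) = K (T i x).
  have Tl := Tlin i.
  by rewrite /K addrC -scaleNr Tl TH addrC scaleNr.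
have Ksadj : sadj K.
  by move=> x y; rewrite /K (formBl Q) (formBr Q) Hsadj (formZl Q) (formZr Q) conj_rc.
(* The summand 1 gives [b <= b ^ 2], so that [b * nq w] bounds [<K w, w>] as well as [nq (K w)]. *)
pose b := 2 * c + 2 * mu ^+ 2 + 1.
have b1 : 1 <= b by have := sqr_ge0 mu; rewrite /b; lra.
have Kb x : nq (K x) <= b * nq x.
  apply: le_trans (nqD_le Q _ _) _; rewrite (nqN Q) (nqZr Q).
  have := Hc x; have := nq_ge0 Q x; have := sqr_ge0 mu; rewrite /b; nra.
have KE x : K x = H x - rc mu *: x by [].
clearbody K.
(* With this [t] the second order term of the descent step is at most [t / 2 * nq w], a quarter of
   the first order gain [2 * t * nq w]. *)
pose t := (2 * b)^-1.
have bp : 0 < b by lra.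
have t0 : 0 < t by rewrite invr_gt0; lra.
have tb : t * b = 2^-1 by rewrite /t; field; rewrite gt_eqF.
have t12 : t <= 2^-1 by rewrite -tb ler_peMr // ltW.
(* The margin [d] returns as [t * nq w <= 7 / 3 * d], hence [nq w <= 7 * e / 60], which together
   with [p x < e / 4] stays below [e]. *)
pose d := Num.min (t * e / 20) 1.
have d0 : 0 < d by rewrite lt_min divr_gt0 ?mulr_gt0 //=.
have [e0' e0'0 lo'] := lo _ d0.
(* The bound [e0' / 40] leaves room for the normalized [y]: its defect grows at most by the factor
   [5 / 2], and [nq y >= 1 / 4]. *)
have [x [x1 xe xd]] := hi d (Num.min (e / 4) (e0' / 40)) d0 ltac:(by rewrite lt_min !divr_gt0).
exists x => //.
have xe4 : p x < e / 4 by move: xe; rewrite lt_min => /andP[].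
have xe0 : p x < e0' / 40 by move: xe; rewrite lt_min => /andP[].
have px0 : 0 <= p x by apply: sumr_ge0 => i _; exact: nq_ge0.
pose w := K x; have wE : w = K x by []; clearbody w.
pose y := x - rc t *: w; have yE : y = x - rc t *: w by []; clearbody y.
have wb : nq w <= b by rewrite -[b]mulr1 -x1 wE Kb.
have t2b : t ^+ 2 * b = t / 2 by rewrite expr2 -mulrA tb.
have t2w : t ^+ 2 * nq w <= t / 2 by rewrite -t2b ler_wpM2l // sqr_ge0.
have pw : t ^+ 2 * p w <= t / 2 * p x.
  rewrite -t2b -(mulrA (t ^+ 2)); apply: ler_wpM2l; first exact: sqr_ge0.
  rewrite /p mulr_sumr; apply: ler_sum => i _.
  by rewrite wE KT; exact: Kb.
have py : p y <= 2 * p x + 2 * (t ^+ 2 * p w).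
  rewrite /p !mulr_sumr -big_split; apply: ler_sum => i _ /=.
  have -> : T i y = T i x - rc t *: T i w.
    by rewrite yE addrC -scaleNr (Tlin i) addrC scaleNr.
  by apply: le_trans (nqD_le Q _ _) _; rewrite (nqN Q) (nqZr Q).
have ny1 : 1 / 4 <= nq y.
  have : nq x <= 2 * nq y + 2 * (t ^+ 2 * nq w).
    have {1}-> : x = y + rc t *: w by rewrite yE subrK.
    by apply: le_trans (nqD_le Q _ _) _; rewrite (nqZr Q).
  by rewrite x1; lra.
have ny2 : nq y <= 5 / 2.
  rewrite yE; apply: le_trans (nqD_le Q _ _) _; rewrite (nqN Q) (nqZr Q) x1; lra.
have ny0 : 0 < nq y by lra.
pose z := rc (Num.sqrt (nq y))^-1 *: y.
have s2 : (Num.sqrt (nq y))^-1 ^+ 2 = (nq y)^-1 by rewrite exprVn sqr_sqrtr // ltW.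
have z1 : nq z = 1 by rewrite (nqZr Q) s2 mulVf // gt_eqF.
have pz : p z = p y / nq y.
  rewrite /p mulrC mulr_sumr; apply: eq_bigr => i _.
  have -> : T i z = rc (Num.sqrt (nq y))^-1 *: T i y.
    have T0 : T i 0 = 0.
      by have := Tlin i (-1) 0 0; rewrite scaler0 addr0 scaleN1r addNr.
    by have := Tlin i (rc (Num.sqrt (nq y))^-1) y 0; rewrite T0 !addr0.
  by rewrite (nqZr Q) s2.
have Hz : re (q (H z) z) = re (q (H y) y) / nq y.
  have H0 : H 0 = 0.
    by have := Hlin (-1) 0 0; rewrite scaler0 addr0 scaleN1r addNr.
  have -> : H z = rc (Num.sqrt (nq y))^-1 *: H y.
    by have := Hlin (rc (Num.sqrt (nq y))^-1) y 0; rewrite H0 !addr0.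
  by rewrite (formZl Q) (formZr Q) conj_rc !re_rcM mulrA -expr2 s2 mulrC.
have := lo' z z1; rewrite pz Hz ltr_pdivrMr // ler_pdivlMr // => /(_ _)H1; have {H1}: (mu - d) * nq y <= re (q (H y) y).
  apply: H1.
  have : e0' / 4 <= e0' * nq y by rewrite ler_pM2l //; lra.
  nra.
move=> lowy.
have Kyy : re (q (K y) y) = re (q (H y) y) - mu * nq y.
  by rewrite KE (formBl Q) (formZl Q) (form_nq Q) reB re_rcM re_rc.
have Kxx : re (q (K x) x) < d.
  by rewrite KE (formBl Q) (formZl Q) (form_nq Q) reB re_rcM re_rc x1; lra.
have Ky : K y = w - rc t *: K w.
  by rewrite yE addrC -scaleNr Klin addrC scaleNr -wE.
have exp : re (q (K y) y) = re (q w x) - 2 * t * nq w + t ^+ 2 * re (q (K w) w).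
  rewrite Ky yE !(formBl Q) !(formBr Q) !(formZl Q) !(formZr Q) conj_rc.
  rewrite !reB !re_rcM (Ksadj w x) -wE -/(nq w); ring.
have Kww : re (q (K w) w) <= b * nq w.
  have cs := form_cauchy Q (K w) w.
  have kk := Kb w; have w0 := nq_ge0 Q w; have := sqr_ge0 (im (q (K w) w)).
  move: cs; set u := re _; set v := im _ => cs v0.
  rewrite leNgt; apply/negP => lt.
  have : (b * nq w) ^+ 2 < u ^+ 2 by rewrite ltr_pXn2r ?nnegrE ?mulr_ge0 // ?ltW // (le_lt_trans _ lt) // mulr_ge0 // ltW.
  have : nq (K w) * nq w <= b * nq w * nq w by rewrite ler_wpM2r.
  have : b * nq w * nq w <= b * (b * nq w * nq w).
    by rewrite ler_peMl // !mulr_ge0 // ltW.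
  rewrite exprMn !expr2; nra.
have t2K : t ^+ 2 * re (q (K w) w) <= t / 2 * nq w.
  by rewrite -t2b -(mulrA (t ^+ 2)); apply: ler_wpM2l => //; exact: sqr_ge0.
have tw : t * nq w <= 7 / 3 * d.
  have : d * nq y <= d * (5 / 2) by rewrite ler_wpM2l // ltW.
  rewrite -wE in Kxx; lra.
have : t * nq w <= t * (7 * e / 60).
  apply: le_trans tw _; have : d <= t * e / 20 by rewrite ge_min lexx.
  lra.
rewrite ler_pM2l // -KE -wE; lra.
Qed.

End Step.

(** One operator is added at a time, [approx_step] being applied to the defect of the previous
    ones. *)
Lemma joint_approx_eigenvector (h : nat -> E -> E) (x0 : E) (k : nat) :
  (forall i, linear (h i)) -> (forall i, bdd (h i)) -> (forall i, sadj (h i)) ->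
  (forall i j x, h i (h j x) = h j (h i x)) -> nq x0 = 1 ->
  exists mu : nat -> R, mu 0 <= re (q (h 0%N x0) x0) /\
    forall e : R, 0 < e -> exists2 x, nq x = 1 &
      \sum_(i < k) nq (h i x - rc (mu i) *: x) < e.
Proof.
move=> hl hb hs hc x01; elim: k => [|k [mu [mu0 IH]]].
  exists (fun=> re (q (h 0%N x0) x0)); split=> // e e0; exists x0 => //.
  by rewrite big_ord0.
pose T i x := h i x - rc (mu i) *: x.
have Tl i : linear (T i).
  move=> a x y; rewrite /T hl scalerDr scalerBr !scalerA [rc _ * a]mulrC.
  by rewrite opprD addrACA.
have Th i x : T i (h k x) = h k (T i x).
  have -> : h k (T i x) = h k (h i x) - rc (mu i) *: h k x.
    by rewrite /T addrC -scaleNr hl addrC scaleNr.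
  by rewrite /T hc.
have [m [mle mP]] := approx_step Tl (hl k) (hb k) (hs k) Th IH.
exists (fun i => if i == k then m else mu i); split.
  (* For [k = 0] the defect is an empty sum, so [x0] itself competes at every tolerance. *)
  case: eqP => // k0; apply: mle => e e0; exists x0.
  by rewrite -k0 big_ord0; split.
move=> e /mP[x x1 xe]; exists x => //.
rewrite big_ord_recr /= eqxx.
by under eq_bigr => i _ do rewrite (ltn_eqF (ltn_ord i)).
Qed.
End JointApprox.

(** * Hilbert spaces and bounded operators *)

Section HilbertBasics.
Variables (R : realType) (H : hilbertType R).
Local Notation C := (Cplx R).
Implicit Types x y : H.

Lemma inner_psd : psd_form (@inner R H).
Proof.
split; [exact: inner_linear | exact: inner_conj | move=> x].
by rewrite inner_norm exprn_ge0.
Qed.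

(** The norm of the space is complex valued; its real square spares the coercion and square roots,
    at the price of factors 2 in triangle inequalities. *)
Definition n2 x : R := nq (@inner R H) x.

Lemma n2E x : inner x x = rc (n2 x). Proof. exact: form_nq inner_psd x. Qed.
Lemma n2_norm x : rc (n2 x) = `|x| ^+ 2. Proof. by rewrite -n2E inner_norm. Qed.
Lemma n2_ge0 x : 0 <= n2 x. Proof. exact: nq_ge0 inner_psd x. Qed.
Lemma n2_eq0 x : n2 x = 0 -> x = 0.
Proof.
move=> x0; have := n2_norm x; rewrite x0 rmorph0 => /esym/eqP.
by rewrite sqrf_eq0 normr_eq0 => /eqP.
Qed.
Lemma n2_0 : n2 0 = 0. Proof. by rewrite /n2 /nq (form0l inner_psd) raddf0. Qed.
Lemma n2N x : n2 (- x) = n2 x. Proof. exact: nqN inner_psd x. Qed.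
Lemma n2BC x y : n2 (x - y) = n2 (y - x). Proof. by rewrite -n2N opprB. Qed.
Lemma n2Zr t x : n2 (rc t *: x) = t ^+ 2 * n2 x. Proof. exact: nqZr inner_psd t x. Qed.
Lemma n2Z c x : n2 (c *: x) = (re c ^+ 2 + im c ^+ 2) * n2 x.
Proof. exact: nqZ inner_psd c x. Qed.
Lemma n2D_le x y : n2 (x + y) <= 2 * n2 x + 2 * n2 y.
Proof. exact: nqD_le inner_psd x y. Qed.
Lemma n2_triangle x y z : n2 (x - z) <= 2 * n2 (x - y) + 2 * n2 (y - z).
Proof. by have := n2D_le (x - y) (y - z); rewrite addrA subrK. Qed.

Lemma norm_n2 x (r : R) : 0 <= r -> (`|x| < rc r) = (n2 x < r ^+ 2).
Proof.
move=> r0; rewrite -rc_lt n2_norm rmorphXn /= ltr_pXn2r ?nnegrE ?normr_ge0 //.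
by rewrite rc_ge0.
Qed.

Lemma nbhs_n2 x (A : set H) :
  nbhs x A <-> exists2 r : R, 0 < r & forall y, n2 (x - y) < r -> A y.
Proof.
split=> [/nbhs_ballP[e /= e0 eA]|[r r0 rA]].
  have ee : e = rc (re e) by apply/ge0_rc/ltW.
  have rep : 0 < re e by have := lt_re e0; rewrite raddf0.
  exists (re e ^+ 2); first by rewrite exprn_gt0.
  by move=> y xy; apply: eA; rewrite -ball_normE /ball_ /= ee norm_n2 // ltW.
apply/nbhs_ballP; exists (rc (Num.sqrt r)) => /=.
  by rewrite -(rmorph0 rc) rc_lt sqrtr_gt0.
move=> y; rewrite -ball_normE /ball_ /= norm_n2 ?sqrtr_ge0 // sqr_sqrtr ?ltW //.
exact: rA.
Qed.

(** Completeness for nested sets of shrinking diameter, the shape in which minimizing vectors and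
    approximating pairs arise without choosing a sequence. *)
Lemma complete_n2 (Z : R -> set H) :
  (forall e, 0 < e -> Z e !=set0) ->
  (forall e e', 0 < e -> e <= e' -> Z e `<=` Z e') ->
  (forall d, 0 < d -> exists2 e, 0 < e & forall x y, Z e x -> Z e y -> n2 (x - y) < d) ->
  exists l, forall d e, 0 < d -> 0 < e -> exists2 x, Z e x & n2 (x - l) < d.
Proof.
move=> Z0 Zmono Zd.
pose F : set_system H := [set A | exists2 e, 0 < e & Z e `<=` A].
have FF : ProperFilter F.
  split; first by move=> [e e0 /(_ _) Ze]; have [x /Ze] := Z0 _ e0.
  split; first by exists 1.
    move=> A B [e e0 eA] [e' e'0 e'B]; exists (Num.min e e').
      by rewrite lt_min e0.
    move=> x Zx; split; [apply: eA|apply: e'B]; apply: Zmono Zx => //;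
      by rewrite ?lt_min ?e0 // ge_min lexx ?orbT.
  by move=> A B AB [e e0 eA]; exists e => //; exact: subset_trans AB.
have Fc : cauchy F.
  apply/cauchy_exP => e e0.
  have ee : e = rc (re e) by apply/ge0_rc/ltW.
  have rep : 0 < re e by have := lt_re e0; rewrite raddf0.
  have [|e1 e10 eZ] := Zd (re e ^+ 2); first by rewrite exprn_gt0.
  have [x Zx] := Z0 _ e10.
  exists x; exists e1 => // y Zy.
  by rewrite -ball_normE /ball_ /= ee norm_n2 ?(ltW rep) //; exact: eZ.
have /cvg_ex[l Fl] : cvg F by exact: cauchy_cvg.
exists l => d e d0 e0.
have : F [set y | n2 (l - y) < d] by apply: Fl; apply/nbhs_n2; exists d.
move=> [e1 e10 Ze1].
have [|x Zx] := Z0 (Num.min e e1); first by rewrite lt_min e0.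
exists x; first by apply: Zmono Zx; rewrite ?lt_min ?e0 // ge_min lexx.
rewrite n2BC; apply: Ze1; apply: Zmono Zx; rewrite ?lt_min ?e0 //.
by rewrite ge_min lexx orbT.
Qed.

(** The vector [c] is a cluster point of the images along the filter that the nested family
    generates. *)
Lemma compact_op_n2 (A : bop H H) (Z : R -> set H) : compact_op A ->
  (forall e, 0 < e -> Z e !=set0) ->
  (forall e e', 0 < e -> e <= e' -> Z e `<=` Z e') ->
  (forall e x, 0 < e -> Z e x -> n2 x <= 1) ->
  exists c, forall d e, 0 < d -> 0 < e -> exists2 x, Z e x & n2 (A x - c) < d.
Proof.
move=> cA Z0 Zmono Z1.
pose F : set_system H := [set B | exists2 e, 0 < e & (A @` Z e) `<=` B].
have FF : ProperFilter F.
  split; first by move=> [e e0 Ze]; have [x xZ] := Z0 _ e0; apply: (Ze (A x)); exists x.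
  split; first by exists 1.
    move=> B B' [e e0 eA] [e' e'0 e'B]; exists (Num.min e e').
      by rewrite lt_min e0.
    move=> _ [x Zx <-]; split; [apply: eA|apply: e'B]; exists x => //; apply: Zmono Zx => //;
      by rewrite ?lt_min ?e0 // ge_min lexx ?orbT.
  by move=> B B' AB [e e0 eA]; exists e => //; exact: subset_trans AB.
have [|c [_ cF]] := cA F FF.
  exists 1 => // _ [x Zx <-]; apply: subset_closure; exists x => //=.
  have := Z1 _ _ ltr01 Zx; rewrite -rc_le n2_norm rmorph1 => h.
  by rewrite -(ler_pXn2r (n := 2)) ?nnegrE ?normr_ge0 // expr1n.
exists c => d e d0 e0.
have [] := cF (A @` Z e) [set y | n2 (c - y) < d].
- by exists e.
- by apply/nbhs_n2; exists d.
move=> _ [[x Zx <-] /= xd]; exists x => //.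
by rewrite n2BC.
Qed.
End HilbertBasics.

Section BoundedOps.
Variables (R : realType) (H L : hilbertType R).
Local Notation C := (Cplx R).

Lemma bop_linear (A : bop H L) : linear A.
Proof. by have /asboolP[] := bop_funP A. Qed.
Lemma bop0 (A : bop H L) : A 0 = 0.
Proof. by have := bop_linear A (-1) 0 0; rewrite scaler0 addr0 scaleN1r addNr. Qed.
Lemma bopD (A : bop H L) x y : A (x + y) = A x + A y.
Proof. by have := bop_linear A 1 x y; rewrite !scale1r. Qed.
Lemma bopZ (A : bop H L) c x : A (c *: x) = c *: A x.
Proof. by have := bop_linear A c x 0; rewrite bop0 !addr0. Qed.
Lemma bopB (A : bop H L) x y : A (x - y) = A x - A y.
Proof. by rewrite bopD -scaleN1r bopZ scaleN1r. Qed.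
Lemma bopN (A : bop H L) x : A (- x) = - A x.
Proof. by rewrite -scaleN1r bopZ scaleN1r. Qed.
Lemma bop_sum (A : bop H L) I (r : seq I) (P : pred I) (F : I -> H) :
  A (\sum_(i <- r | P i) F i) = \sum_(i <- r | P i) A (F i).
Proof. exact: (big_morph A (bopD A) (bop0 A)). Qed.
Lemma bopE (A B : bop H L) : A =1 B -> A = B.
Proof. by move=> AB; apply: val_inj; apply: funext. Qed.
Lemma add_bopE (A B : bop H L) x : (A + B) x = A x + B x. Proof. by []. Qed.
Lemma scale_bopE c (A : bop H L) x : (c *: A) x = c *: A x. Proof. by []. Qed.
Lemma opp_bopE (A : bop H L) x : (- A) x = - A x. Proof. by []. Qed.
Lemma zero_bopE x : (0 : bop H L) x = 0. Proof. by []. Qed.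
Lemma sum_bopE I (r : seq I) (P : pred I) (F : I -> bop H L) x :
  (\sum_(i <- r | P i) F i) x = \sum_(i <- r | P i) F i x.
Proof. by apply: (big_morph (fun A : bop H L => A x)). Qed.

Lemma bop_bounded (A : bop H L) :
  exists2 c : R, 0 <= c & forall x, n2 (A x) <= c * n2 x.
Proof.
have /asboolP[_ /(_ 0) cA] := bop_funP A.
have /cA : nbhs (bop_fun A 0) [set y | n2 y < 1].
  by apply/nbhs_n2; exists 1 => // y; rewrite bop0 n2BC subr0.
move=> /nbhs_n2[r r0 rA].
exists (2 / r); first by rewrite divr_ge0 // ltW.
move=> x; have [->|x0] := eqVneq x 0; first by rewrite bop0 !n2_0 mulr0.
have xp : 0 < n2 x.
  rewrite lt_def n2_ge0 andbT; apply/eqP => /n2_eq0 xx; by rewrite xx eqxx in x0.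
(* Rescales [x] to squared norm [r / 2], inside the neighbourhood of 0 that [A] maps into the unit
   ball. *)
pose t := Num.sqrt (r / (2 * n2 x)).
have t2 : t ^+ 2 = r / (2 * n2 x) by rewrite sqr_sqrtr // divr_ge0 ?mulr_ge0 ?ltW.
have := rA (rc t *: x); rewrite sub0r n2N n2Zr t2 /= bopZ n2Zr t2.
have -> : r / (2 * n2 x) * n2 x = r / 2 by field; rewrite gt_eqF.
move=> /(_ _) h; have {h}: r / (2 * n2 x) * n2 (A x) < 1 by apply: h; lra.
rewrite mulrAC ltr_pdivrMr ?mulr_gt0 // mul1r => h.
by rewrite mulrAC ler_pdivlMr // ltW // mulrC.
Qed.

Lemma linear_bounded_bop (f : H -> L) (c : R) : linear f ->
  (forall x, n2 (f x) <= c * n2 x) -> {A : bop H L | A =1 f}.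
Proof.
move=> lf bf.
have fA : f \in bop_pred (H := H) (L := L).
  apply/asboolP; split=> // x B /nbhs_n2[r r0 rB]; apply/nbhs_n2.
  have c1 : 0 < `|c| + 1 by rewrite ltr_wpDl.
  exists (r / (`|c| + 1)); first by rewrite divr_gt0.
  move=> y; rewrite ltr_pdivlMr // => xy; apply: rB.
  have -> : f x - f y = f (x - y).
    by rewrite [x - y]addrC -[- y]scaleN1r lf scaleN1r addrC.
  apply: le_lt_trans (bf _) _; apply: le_lt_trans xy; rewrite mulrC.
  by rewrite ler_wpM2l ?n2_ge0 // (le_trans (ler_norm c)) // lerDl.
by exists (Bop fA).
Qed.
End BoundedOps.

(** * Fuglede's theorem *)

(** Repeated square roots of -1 give an element whose order divides [2 ^ k.+1] but not [2 ^ k].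
    These roots carry the discrete Cauchy formula below. *)
Lemma primitive_root_exp2 (R : realType) (k : nat) :
  exists w : Cplx R, (2 ^ k.+1).-primitive_root w.
Proof.
have [w wk] : exists w : Cplx R, w ^+ (2 ^ k) = -1.
  elim: k => [|k [w wk]]; first by exists (-1); rewrite expn0 expr1.
  by exists (sqrtC w); rewrite expnS exprM sqrtCK.
exists w.
have w1 : w ^+ (2 ^ k.+1) = 1 by rewrite expnSr exprM wk sqrrN expr1n.
have [m mw md] := prim_order_exists (expn_gt0 2 k.+1) w1.
have /(dvdn_pfactor _ _ (isT : prime 2))[a ak ma] := md.
move: ak; rewrite leq_eqVlt => /orP[/eqP ak|]; first by rewrite -ak -ma.
rewrite ltnS => ak.
have : w ^+ (2 ^ k) = 1.
  by apply/eqP; rewrite -(prim_order_dvd mw) ma dvdn_exp2l.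
rewrite wk => /eqP; rewrite eq_sym -subr_eq0 opprK -[1 + 1]/(2%:R) pnatr_eq0 //.
Qed.

Lemma prim_root_sum (F : fieldType) (w : F) p i : p.-primitive_root w ->
  \sum_(j < p) w ^+ (j * i) = if (p %| i)%N then p%:R else 0.
Proof.
move=> pw; have wi : (w ^+ i == 1) = (p %| i)%N by rewrite -(prim_order_dvd pw).
under eq_bigr do rewrite mulnC exprM.
rewrite -wi; have [->|wi1] := eqVneq (w ^+ i) 1.
  by under eq_bigr do rewrite expr1n; rewrite sumr_const card_ord.
have := subrX1 (w ^+ i) p.
rewrite exprAC (prim_expr_order pw) expr1n subrr => /esym/eqP.
by rewrite mulf_eq0 subr_eq0 (negbTE wi1) => /eqP.
Qed.

Section RealNorm.
Variables (R : realType) (L : hilbertType R).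
Definition nm (x : L) : R := re `|x|.
Lemma rc_nm x : rc (nm x) = `|x|. Proof. exact/esym/ge0_rc. Qed.
Lemma nm_ge0 x : 0 <= nm x. Proof. exact: re_ge0. Qed.
Lemma nmD x y : nm (x + y) <= nm x + nm y.
Proof. by rewrite -rc_le rcD !rc_nm ler_normD. Qed.
Lemma nmZ c x : nm (c *: x) = re `|c| * nm x.
Proof. by rewrite /nm normrZ -(re_norm c) re_rcM. Qed.
Lemma nmN x : nm (- x) = nm x. Proof. by rewrite /nm normrN. Qed.
Lemma nmB x y : nm (x - y) <= nm x + nm y.
Proof. by rewrite -(nmN y) nmD. Qed.
Lemma nm_sqr x : nm x ^+ 2 = n2 x.
Proof.
by rewrite -[LHS]re_rc -[RHS]re_rc rcX rc_nm n2_norm.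
Qed.
Lemma nm_sum I (r : seq I) (P : pred I) (F : I -> L) :
  nm (\sum_(i <- r | P i) F i) <= \sum_(i <- r | P i) nm (F i).
Proof.
elim/big_rec2: _ => [|i y z _ IH]; first by rewrite /nm normr0.
by apply: le_trans (nmD _ _) _; rewrite lerD2l.
Qed.
Lemma nm0_eq0 x : nm x <= 0 -> x = 0.
Proof.
move=> x0; apply/eqP; rewrite -normr_eq0 -rc_nm -rc0.
by apply/eqP; congr rc; apply/eqP; rewrite eq_le x0 nm_ge0.
Qed.
End RealNorm.

Section VectorPolynomials.
Variables (R : realType) (L : hilbertType R).
Local Notation C := (Cplx R).
Implicit Types (F : C -> L) (f : nat -> L) (A B : bop L L).

(** Vanishing of the coefficients from [d] on makes [f 1] meaningful for every [d]. *)
Definition polyvec F d f :=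
  (forall k, (d <= k)%N -> f k = 0) /\ forall c, F c = \sum_(k < d) c ^+ k *: f k.

Lemma polyvec_bop F d f A : polyvec F d f ->
  polyvec (fun c => A (F c)) d (fun k => A (f k)).
Proof.
move=> [f0 Ff]; split=> [k dk|c]; first by rewrite f0 // bop0.
by rewrite Ff bop_sum; apply: eq_bigr => k _; rewrite bopZ.
Qed.

Lemma polyvec_mul F d f B : polyvec F d f ->
  polyvec (fun c => F c + c *: B (F c)) d.+1
    (fun k => f k + (if k is k'.+1 then B (f k') else 0)).
Proof.
move=> [f0 Ff]; split=> [k dk|c].
  rewrite f0 ?(ltnW dk) // add0r; case: k dk => // k.
  by rewrite ltnS => dk; rewrite f0 // bop0.
under eq_bigr do rewrite scalerDr; rewrite big_split /=; congr (_ + _).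
  by rewrite big_ord_recr /= f0 // scaler0 addr0 Ff.
rewrite big_ord_recl /= scaler0 add0r Ff bop_sum scaler_sumr.
by apply: eq_bigr => k _; rewrite bopZ scalerA exprS.
Qed.

Lemma polyvec_iter F d f B m : polyvec F d f ->
  exists g, [/\ polyvec (fun c => iter m (fun y => y + c *: B y) (F c)) (d + m) g,
    g 0%N = f 0%N & g 1%N = f 1%N + m%:R *: B (f 0%N)].
Proof.
move=> Ff; elim: m => [|m [g [Gg g0 g1]]].
  by exists f; rewrite addn0 scale0r addr0; split.
exists (fun k => g k + (if k is k'.+1 then B (g k') else 0)); split.
- by rewrite addnS; exact: polyvec_mul.
- by rewrite addr0.
- by rewrite g1 g0 -addrA -natr1 scalerDl scale1r.
Qed.

(** Cauchy estimate for the linear coefficient, with the contour integral replaced by an average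
    over [p]-th roots of unity; the average is exact since [p] exceeds the degree. *)
Lemma polyvec_cauchy F d f (s b : R) : polyvec F d f -> 0 <= s ->
  (forall c, re `|c| = s -> nm (F c) <= b) -> s * nm (f 1%N) <= b.
Proof.
move=> [f0 Ff] s0 Fb.
have [p [dp p1 [w pw]]] : exists p, [/\ (d < p)%N, (1 < p)%N &
    exists w : C, p.-primitive_root w].
  exists (2 ^ d.+1)%N; split; last exact: primitive_root_exp2.
    by rewrite (leq_trans (ltn_expl d (ltnSn 1))) // leq_exp2l.
  by rewrite (leq_ltn_trans _ (ltn_expl d.+1 (ltnSn 1))).
have w1 : `|w| = 1.
  apply: (@pexpIrn _ p); rewrite ?nnegrE ?(ltnW p1) //.
  by rewrite -normrX (prim_expr_order pw) normr1 expr1n.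
(* The weight is the inverse of [w ^ j], written with exponent [p.-1]; among [k < p] only [k = 1]
   makes [p] divide [p.-1 + k]. *)
have avg : \sum_(j < p) w ^+ (j * p.-1) *: F (rc s * w ^+ j) = (p%:R * rc s) *: f 1%N.
  under eq_bigr => j _ do rewrite Ff scaler_sumr.
  rewrite exchange_big /=.
  under eq_bigr => k _.
    under eq_bigr => j _.
      rewrite scalerA exprMn mulrCA -exprM -exprD -mulnDr -scalerA.
      over.
    rewrite -scaler_sumr -scaler_suml (prim_root_sum _ pw).
    over.
  rewrite /=.
  have e (k : 'I_d) : (p %| p.-1 + k)%N = (k == 1 :> nat).
    have kp : (k < p)%N := ltn_trans (ltn_ord k) dp.
    have pp : p.-1.+1 = p by rewrite prednK // ltnW.
    case: k kp => -[|[|k]] kd /= kp.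
    - by rewrite addn0 gtnNdvd ?pp // -ltnS pp.
    - by rewrite addn1 pp dvdnn.
    - by rewrite addnS -addSn pp dvdn_addr // gtnNdvd // ltnW.
  under eq_bigr => k _ do rewrite e.
  have [d1|d1] := ltnP 1 d.
    rewrite (bigD1 (Ordinal d1)) //= big1 ?addr0 => [|k k1].
      by rewrite expr1 scalerA mulrC.
    by rewrite -val_eqE /= in k1; rewrite (negbTE k1) scale0r scaler0.
  rewrite f0 // scaler0 big1 // => k _.
  by rewrite (ltn_eqF (leq_trans (ltn_ord k) d1)) scale0r scaler0.
have : nm (\sum_(j < p) w ^+ (j * p.-1) *: F (rc s * w ^+ j)) <= \sum_(j < p) b.
  apply: le_trans (nm_sum _ _ _) _; apply: ler_sum => j _.
  rewrite nmZ normrX w1 expr1n re1 mul1r; apply: Fb.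
  by rewrite normrM normrX w1 expr1n mulr1 norm_rc re_rc ger0_norm.
rewrite avg sumr_const card_ord nmZ normrM normr_nat norm_rc ger0_norm //.
rewrite -rc_nat -rcM re_rc -mulrA -[b *+ p]mulr_natl ler_pM2l //.
by rewrite ltr0n ltnW.
Qed.
End VectorPolynomials.

(** For small [n a] this bounds [(1 + a) ^ n] by [1 / (1 - n a)]; it controls products of factors
    that deviate from 1 at second order. *)
Lemma expr1D_mul_le1 (R : realType) (a : R) n : 0 <= a ->
  (1 + a) ^+ n * (1 - n%:R * a) <= 1.
Proof.
move=> a0; elim: n => [|n IH]; first by rewrite mul1r mul0r subr0.
apply: le_trans IH; rewrite exprSr -mulrA ler_wpM2l ?exprn_ge0 ?addr_ge0 //.
rewrite -natr1; have := mulr_ge0 (ler0n R n) (sqr_ge0 a); have := sqr_ge0 a.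
rewrite !expr2; nra.
Qed.

Section Fuglede.
Variables (R : realType) (L : hilbertType R) (N N' A : bop L L).
Local Notation C := (Cplx R).
Hypothesis adjN : adjoint N N'.
Hypothesis NN' : forall x, N (N' x) = N' (N x).
Hypothesis AN : forall x, A (N x) = N (A x).

Let adjN' : adjoint N' N.
Proof. by move=> x y; rewrite inner_conj -adjN -inner_conj. Qed.

Let n2N' x : n2 (N' x) = n2 (N x).
Proof. by rewrite /n2 /nq adjN' NN' -adjN'; congr re; rewrite adjN' -adjN. Qed.

Variables (b al : R).
Hypothesis b0 : 0 <= b.
Hypothesis Nb : forall x, nm (N x) <= b * nm x.
Hypothesis al0 : 0 <= al.
Hypothesis Ab : forall x, nm (A x) <= al * nm x.

Let N'b x : nm (N' x) <= b * nm x.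
Proof.
by rewrite -(ler_pXn2r (n := 2)) ?nnegrE ?mulr_ge0 ?nm_ge0 // nm_sqr n2N' -nm_sqr
  ler_pXn2r ?nnegrE ?mulr_ge0 ?nm_ge0.
Qed.

(** First order factor of [exp (c B)]. The section discretizes Rosenblum's proof:
    [exp (c N') A exp (- c N')] is bounded in [c], because [A] commutes with [N] and
    [exp (c N' - c^* N)] is unitary. Products of [m] factors [P] keep everything polynomial in
    [c]. *)
Let P (c : C) (B : bop L L) y := y + c *: B y.

Let PC c1 c2 (B1 B2 : bop L L) : (forall x, B1 (B2 x) = B2 (B1 x)) ->
  forall y, P c1 B1 (P c2 B2 y) = P c2 B2 (P c1 B1 y).
Proof.
move=> B12 y; rewrite /P !bopD !bopZ B12 !scalerDr !scalerA [c2 * c1]mulrC.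
by rewrite !addrA; congr (_ + _); rewrite addrAC.
Qed.

Let iterC (f g : L -> L) m : (forall y, f (g y) = g (f y)) ->
  forall y, iter m f (g y) = g (iter m f y).
Proof. by move=> fg y; elim: m => //= m ->; rewrite fg. Qed.

Let iterM (f g : L -> L) m : (forall y, f (g y) = g (f y)) ->
  forall y, iter m f (iter m g y) = iter m (fun z => f (g z)) y.
Proof.
move=> fg y; elim: m => //= m <-; congr f.
by apply: iterC => z; rewrite fg.
Qed.

Let iter_le (f : L -> L) (k : R) m : 0 <= k ->
  (forall y, nm (f y) <= k * nm y) -> forall y, nm (iter m f y) <= k ^+ m * nm y.
Proof.
move=> k0 fk y; elim: m => [|m IH]; first by rewrite mul1r.
by rewrite exprS -mulrA; apply: le_trans (fk _) _; rewrite ler_wpM2l.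
Qed.

Let P_le (c : C) (B : bop L L) t : (forall y, nm (B y) <= b * nm y) ->
  t = re `|c| * b -> forall y, nm (P c B y) <= (1 + t) * nm y.
Proof.
move=> Bb -> y; apply: le_trans (nmD _ _) _; rewrite mulrDl mul1r lerD2l nmZ.
by rewrite -mulrA ler_wpM2l // re_ge0.
Qed.

(* With D = cN' - conj(c)N skew-adjoint, the product is 1 + D - |c|^2 N'N, so
   its norm exceeds 1 only at second order in |c|. *)
Let U_le (c : C) t : t = re `|c| * b -> forall y,
  nm (P c N' (P (- c^*) N y)) <= (1 + 3 * t ^+ 2) * nm y.
Proof.
move=> tE y; set s := re `|c| in tE; have s0 : 0 <= s by exact: re_ge0.
have t0 : 0 <= t by rewrite tE mulr_ge0.
pose D := c *: N' y - c^* *: N y.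
have -> : P c N' (P (- c^*) N y) = (y + D) - (c * c^*) *: N' (N y).
  rewrite /P /D bopD bopZ scalerDr scalerA mulrN !scaleNr !addrA.
  congr (_ - _); rewrite -!addrA; congr (_ + _); exact: addrC.
have Dy : re (inner y D) = 0.
  rewrite (formBr (inner_psd L)) !(formZr (inner_psd L)) conjCK reB -adjN.
  rewrite (inner_conj (N y) y); move: (inner (N y) y) => w.
  by rewrite -(re_conj (c^* * w)) rmorphM /= conjCK subrr.
have Dt : nm D <= 2 * t * nm y.
  apply: le_trans (nmB _ _) _; rewrite !nmZ norm_conjC -/s tE.
  have := N'b y; have := Nb y => h1 h2.
  have : s * nm (N y) <= s * (b * nm y) by rewrite ler_wpM2l.
  have : s * nm (N' y) <= s * (b * nm y) by rewrite ler_wpM2l.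
  lra.
have yD : nm (y + D) <= (1 + 2 * t ^+ 2) * nm y.
  rewrite -(ler_pXn2r (n := 2)) ?nnegrE ?mulr_ge0 ?nm_ge0 ?addr_ge0 ?mulr_ge0 ?sqr_ge0 //.
  rewrite nm_sqr /n2 (nqD (inner_psd L)) Dy mulr0 addr0 -!/(n2 _) -!nm_sqr.
  have : nm D ^+ 2 <= (2 * t * nm y) ^+ 2.
    by rewrite ler_pXn2r ?nnegrE ?mulr_ge0 ?nm_ge0.
  have := sqr_ge0 (t ^+ 2 * nm y); nra.
apply: le_trans (nmB _ _) _.
have : nm ((c * c^*) *: N' (N y)) <= t ^+ 2 * nm y.
  rewrite nmZ normrM norm_conjC -(re_norm c) -rcM re_rc -/s tE.
  have : nm (N' (N y)) <= b * (b * nm y).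
    by apply: le_trans (N'b _) _; rewrite ler_wpM2l.
  have ss : 0 <= s * s by rewrite mulr_ge0.
  move=> h; have : s * s * nm (N' (N y)) <= s * s * (b * (b * nm y)).
    by rewrite ler_wpM2l.
  rewrite expr2; lra.
lra.
Qed.

(** For exponentials the inserted factors [exp (- c^* N)] and [exp (c^* N)] would cancel. Here each
    pair leaves a second order error, accumulated over [m] steps. *)
Let W_le (c : C) t m : t = re `|c| * b -> forall y,
  nm (y - iter m (fun z => P (- c^*) N (P c^* N z)) y) <=
    ((1 + t ^+ 2) ^+ m - 1) * nm y.
Proof.
move=> tE y; set s := re `|c| in tE; have s0 : 0 <= s by exact: re_ge0.
set W := fun z => _.
have t0 : 0 <= t by rewrite tE mulr_ge0.
have WE z : W z = z - (c^* * c^*) *: N (N z).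
  by rewrite /W /P bopD bopZ scalerDr scalerA mulNr !scaleNr addrA addrK.
have NN z : nm ((c^* * c^*) *: N (N z)) <= t ^+ 2 * nm z.
  rewrite nmZ normrM norm_conjC -(re_norm c) -rcM re_rc -/s tE.
  have : nm (N (N z)) <= b * (b * nm z).
    by apply: le_trans (Nb _) _; rewrite ler_wpM2l.
  have ss : 0 <= s * s by rewrite mulr_ge0.
  move=> h; have : s * s * nm (N (N z)) <= s * s * (b * (b * nm z)).
    by rewrite ler_wpM2l.
  rewrite expr2; lra.
have Wb z : nm (W z) <= (1 + t ^+ 2) * nm z.
  by rewrite WE; apply: le_trans (nmB _ _) _; have := NN z; lra.
elim: m => [|m IH]; first by rewrite /= subrr expr0 subrr mul0r /nm normr0.
rewrite iterS WE opprB addrA.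
have h0 : 0 <= 1 + t ^+ 2 by rewrite addr_ge0 ?sqr_ge0.
have := iter_le m h0 Wb y; set z := iter m W y => zb.
have : t ^+ 2 * nm z <= t ^+ 2 * ((1 + t ^+ 2) ^+ m * nm y) by rewrite ler_wpM2l ?sqr_ge0.
have := NN z; rewrite -/z in IH.
have -> : y + (c^* * c^*) *: N (N z) - z = (y - z) + (c^* * c^*) *: N (N z).
  by rewrite addrAC.
have := nmD (y - z) ((c^* * c^*) *: N (N z)).
rewrite (exprS (1 + t ^+ 2)); lra.
Qed.

(** Discrete version of [exp (m c N') A exp (- m c N')]; its linear coefficient in [c] is [m] times
    the commutator [D]. *)
Let F m (x : L) (c : C) := iter m (P c N') (A (iter m (P c (- N')) x)).

(** The first summand bounds the near-unitary products on both sides of [A], formed by moving the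
    factors [P c^* N] through [A]. The second is the price of the insertion, the outer products
    being bounded crudely by [(1 + t) ^ m]. *)
Let F_le m x c t : t = re `|c| * b -> nm (F m x c) <=
  ((1 + 3 * t ^+ 2) ^+ m * (al * ((1 + 3 * t ^+ 2) ^+ m)) +
   (1 + t) ^+ m * (((1 + t ^+ 2) ^+ m - 1) * (al * (1 + t) ^+ m))) * nm x.
Proof.
move=> tE; have t0 : 0 <= t by rewrite tE mulr_ge0 ?re_ge0.
have NN : forall y, N (N y) = N (N y) by [].
have oN y : N' (N y) = N (N' y) by rewrite NN'.
have oNN y : (- N') (N y) = N ((- N') y) by rewrite !opp_bopE bopN oN.
have PA c1 y : P c1 N (A y) = A (P c1 N y) by rewrite /P bopD bopZ AN.
have oPE y : P c (- N') y = P (- c) N' y.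
  by rewrite /P opp_bopE scalerN scaleNr.
set y := A (iter m (P c (- N')) x).
pose W := fun z => P (- c^*) N (P c^* N z).
have split : F m x c = iter m (P c N') (iter m W y) + iter m (P c N') (y - iter m W y).
  have itB u v : iter m (P c N') (u - v) = iter m (P c N') u - iter m (P c N') v.
    elim: (m) => //= k ->; rewrite /P bopB scalerBr !opprD !addrA.
    by congr (_ + _); rewrite addrAC.
  by rewrite itB addrC subrK.
have h : iter m (P c N') (iter m W y) =
    iter m (fun z => P c N' (P (- c^*) N z))
      (A (iter m (fun z => P c^* N (P c (- N') z)) x)).
  rewrite -(iterM (f := P c N') (g := P (- c^*) N)); last by move=> z; apply: PC.
  rewrite /W -(iterM (f := P (- c^*) N) (g := P c^* N)); last by move=> z; apply: PC.
  rewrite -(iterM (f := P c^* N) (g := P c (- N'))); last by move=> z; apply: PC.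
  congr (iter _ _ (iter _ _ _)); rewrite /y.
  by move: (iter m (P c (- N')) x) => v; elim: (m) => //= k ->; rewrite PA.
rewrite split mulrDl; apply: le_trans (nmD _ _) _; apply: lerD.
  rewrite h -!mulrA.
  have b3 : 0 <= 1 + 3 * t ^+ 2 by rewrite addr_ge0 ?mulr_ge0 ?sqr_ge0.
  apply: le_trans (iter_le _ b3 (U_le tE) _) _.
  rewrite ler_wpM2l ?exprn_ge0 //; apply: le_trans (Ab _) _.
  rewrite ler_wpM2l //; apply: iter_le => // z.
  have -> : P c^* N (P c (- N') z) = P (- c) N' (P (- (- c)^*) N z).
    by rewrite -oPE rmorphN opprK PC.
  by apply: U_le; rewrite normrN.
have b1 : 0 <= 1 + t by rewrite addr_ge0.
rewrite -!mulrA.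
apply: le_trans (iter_le _ b1 (P_le N'b tE) _) _.
rewrite ler_wpM2l ?exprn_ge0 //; apply: le_trans (W_le _ tE _) _.
rewrite ler_wpM2l ?subr_ge0 ?exprn_ege1 ?lerDl ?sqr_ge0 //.
apply: le_trans (Ab _) _; rewrite ler_wpM2l //.
apply: iter_le => // z; rewrite oPE; apply: P_le => //.
by rewrite normrN.
Qed.

Let D x := N' (A x) - A (N' x).

(** Liouville's argument: the right side does not depend on [r]. The Cauchy estimate is applied on
    the circle of radius [r / m], the linear coefficient being [m D x]. *)
Let D_le r x : 0 < r -> r * nm (D x) <= 3 * al * nm x.
Proof.
move=> r0; pose rho := r * b.
have rho0 : 0 <= rho by rewrite mulr_ge0 // ltW.
pose E := expR (2 * rho).
have E0 : 0 < E by exact: expR_gt0.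
(* [m > X] makes [m t ^ 2 = rho ^ 2 / m] at most [1 / 12], which bounds the near-unitary products by
   2, and at most [1 / (2 E)], which absorbs the crude growth [(1 + t) ^ (2 m) <= E]. *)
pose X := 12 * rho ^+ 2 + 2 * rho ^+ 2 * E.
have X0 : 0 <= X by rewrite addr_ge0 ?mulr_ge0 ?sqr_ge0 // ltW.
pose m := (Num.truncn X).+1.
have mX : X < m%:R by rewrite /m truncnS_gt.
have m0 : 0 < m%:R :> R by exact: le_lt_trans mX.
pose s := r / m%:R; pose t := s * b.
have s0 : 0 < s by rewrite divr_gt0.
have t0 : 0 <= t by rewrite mulr_ge0 // ltW.
have mt : m%:R * t = rho by rewrite /t /s /rho; field; rewrite gt_eqF.
have mt2 : m%:R * (m%:R * t ^+ 2) = rho ^+ 2 by rewrite -mt; ring.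
have mt2' : m%:R * t ^+ 2 <= 12^-1.
  rewrite -(ler_pM2l m0) mt2; have := mulr_ge0 (sqr_ge0 rho) (ltW E0).
  rewrite /X in mX; lra.
have mtE : 2 * E * (m%:R * t ^+ 2) <= 1.
  rewrite -(ler_pM2l m0) mulrCA mt2; rewrite /X in mX; have := sqr_ge0 rho; lra.
have t20 : 0 <= t ^+ 2 by exact: sqr_ge0.
have b1 : (1 + 3 * t ^+ 2) ^+ m * (1 + 3 * t ^+ 2) ^+ m <= 2.
  rewrite -exprD.
  have := @expr1D_mul_le1 R (3 * t ^+ 2) (m + m) ltac:(by rewrite mulr_ge0).
  rewrite natrD; set G := _ ^+ _.
  have G0 : 0 <= G by rewrite exprn_ge0 // addr_ge0 // mulr_ge0.
  set u := m%:R * t ^+ 2 in mt2' *.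
  have -> : (m%:R + m%:R) * (3 * t ^+ 2) = 6 * u by rewrite /u; ring.
  nra.
have b2 : (1 + t ^+ 2) ^+ m - 1 <= 2 * (m%:R * t ^+ 2).
  have := @expr1D_mul_le1 R (t ^+ 2) m t20; set G := _ ^+ _.
  have G0 : 0 <= G by rewrite exprn_ge0 // addr_ge0.
  have u0 : 0 <= m%:R * t ^+ 2 by rewrite mulr_ge0.
  set u := m%:R * t ^+ 2 in mt2' u0 *; nra.
have b3 : (1 + t) ^+ m * (1 + t) ^+ m <= E.
  rewrite -exprD; apply: le_trans (_ : expR t ^+ (m + m) <= _).
    by rewrite lerXn2r ?nnegrE ?addr_ge0 ?expR_ge0 // expR_ge1Dx.
  by rewrite -expRM_natl natrD mulrDl mt /E -mulr2n mulr_natl.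
have [f [Ff f0 f1]] : exists g, [/\ polyvec (F m x) (1 + m + m) g,
    g 0%N = A x & g 1%N = m%:R *: D x].
  have p0 : polyvec (fun=> x) 1 (fun k => if k is 0%N then x else 0).
    split=> [[]//|c]; by rewrite big_ord1 scale1r.
  have [g [/(polyvec_bop A) Gg g0 g1]] := polyvec_iter (- N') m p0.
  have [h [Hh h0 h1]] := polyvec_iter N' m Gg.
  exists h; split=> //; first by rewrite h0 g0.
  by rewrite h1 g1 g0 add0r bopZ opp_bopE bopN scalerN addrC /D scalerBr.
have := @polyvec_cauchy R L (F m x) (1 + m + m) f s (3 * al * nm x) Ff (ltW s0).
rewrite f1 nmZ normr_nat -rc_nat re_rc mulrA /s divfK ?gt_eqF //; apply=> c cs.
apply: le_trans (F_le m x (t := t) _) _; first by rewrite cs.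
rewrite ler_wpM2r ?nm_ge0 //.
have G1 : 0 <= (1 + t ^+ 2) ^+ m - 1 by rewrite subr_ge0 exprn_ege1 // lerDl.
have s1 : 0 <= (1 + t) ^+ m by rewrite exprn_ge0 // addr_ge0.
move: G1 s1 b1 b2 b3; set G := _ - 1; set u := (1 + t) ^+ m.
set v := (1 + 3 * t ^+ 2) ^+ m => G1 s1 b1 b2 b3.
have uG : u * u * G <= 1.
  apply: le_trans mtE; rewrite [2 * E]mulrC -[E * 2 * _]mulrA.
  by apply: (ler_pM _ G1 b3 b2); exact: mulr_ge0.
have -> : v * (al * v) + u * (G * (al * u)) = al * (v * v) + al * (u * u * G) by ring.
have : al * (v * v) <= al * 2 by rewrite ler_wpM2l.
have : al * (u * u * G) <= al * 1 by rewrite ler_wpM2l.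
lra.
Qed.

Lemma fuglede_bounded x : A (N' x) = N' (A x).
Proof.
apply/esym/eqP; rewrite -subr_eq0; apply/eqP/nm0_eq0.
rewrite leNgt; apply/negP => d0; rewrite -/(D x) in d0.
have y0 : 0 <= 3 * al * nm x by rewrite !mulr_ge0 ?nm_ge0.
have r0 : 0 < (3 * al * nm x + 1) / nm (D x) by rewrite divr_gt0 //; lra.
by have := D_le x r0; rewrite divfK ?gt_eqF //; lra.
Qed.
End Fuglede.

Lemma fuglede (R : realType) (L : hilbertType R) (N N' A : bop L L) :
  adjoint N N' -> (forall x, N (N' x) = N' (N x)) ->
  (forall x, A (N x) = N (A x)) -> forall x, A (N' x) = N' (A x).
Proof.
move=> adj NN AN.
have bd (B : bop L L) : exists2 c : R, 0 <= c & forall x, nm (B x) <= c * nm x.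
  have [c c0 Bc] := bop_bounded B; exists (Num.sqrt c); first exact: sqrtr_ge0.
  move=> x; rewrite -(ler_pXn2r (n := 2)) ?nnegrE ?mulr_ge0 ?nm_ge0 ?sqrtr_ge0 //.
  by rewrite exprMn sqr_sqrtr // !nm_sqr.
have [b b0 Nb] := bd N; have [a a0 Aa] := bd A.
exact: fuglede_bounded Nb a0 Aa.
Qed.

(** * Convex hulls of compact sets *)

Section ConvexHull.
Variable R : realType.

Lemma entry_continuous (T : topologicalType) m n (i : 'I_m) (j : 'I_n) :
  continuous (fun M : 'M[T]_(m, n) => M i j).
Proof.
move=> M A MA; exists (fun i' j' => [set x | i' = i -> j' = j -> A x]).
  move=> i' j'; have [->|ii] := eqVneq i' i; last first.
    by apply: filterS filterT => x _ /eqP; rewrite (negbTE ii).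
  have [->|jj] := eqVneq j' j; first by apply: filterS MA => x Ax _ _.
  by apply: filterS filterT => x _ _ /eqP; rewrite (negbTE jj).
by move=> N /(_ i j); exact.
Qed.

Lemma sum_continuous (T : topologicalType) (I : finType) (F : I -> T -> R) :
  (forall i, continuous (F i)) -> continuous (fun x => \sum_i F i x).
Proof.
move=> cF; elim: (index_enum I) => [|i r IH].
  have -> : (fun x => \sum_(i <- [::]) F i x) = fun=> 0.
    by apply: funext => x; rewrite big_nil.
  exact: cst_continuous.
have -> : (fun x => \sum_(j <- i :: r) F j x) = fun x => F i x + \sum_(j <- r) F j x.
  by apply: funext => x; rewrite big_cons.
by move=> x; apply: cvgD; [exact: cF | exact: IH].
Qed.

(** Affine dependence of [N + 2] points in dimension [N] lets the weights move until one
    vanishes. *)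
Lemma caratheodory_step N (z : 'I_N.+2 -> 'I_N -> R) (t : 'I_N.+2 -> R) :
  (forall i, 0 <= t i) -> exists t' : 'I_N.+2 -> R, exists i0,
  [/\ forall i, 0 <= t' i, t' i0 = 0, \sum_i t' i = \sum_i t i &
      forall j, \sum_i t' i * z i j = \sum_i t i * z i j].
Proof.
move=> t0.
(* The last column of ones forces the coefficients of a dependence to sum to 0. *)
pose A : 'M[R]_(N.+2, N.+1) := \matrix_(i, j) oapp (z i) 1 (unlift ord_max j).
have kA : kermx A != 0.
  rewrite kermx_eq0 /row_free; apply/eqP => rA.
  by have := rank_leq_col A; rewrite rA ltnn.
have /rowV0Pn[c /sub_kermxP cA c0] := kA.
have csum j : \sum_i c 0 i * A i j = 0.
  by have /rowP/(_ j) := cA; rewrite !mxE.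
have c1 : \sum_i c 0 i = 0.
  rewrite -[RHS](csum ord_max); apply: eq_bigr => i _.
  by rewrite mxE unlift_none /= mulr1.
have cz j : \sum_i c 0 i * z i j = 0.
  rewrite -[RHS](csum (lift ord_max j)); apply: eq_bigr => i _.
  by rewrite mxE liftK.
have [i1 ci1] : exists i1, 0 < c 0 i1.
  apply: contrapT => nc; move/eqP: c0; apply; apply/rowP => i; rewrite mxE.
  have cle k : 0 <= - c 0 k.
    by rewrite oppr_ge0 leNgt; apply/negP => ck; apply: nc; exists k.
  have /eqP := c1; rewrite -oppr_eq0 -sumrN psumr_eq0 // => /allP/(_ i).
  by rewrite mem_index_enum oppr_eq0 => /(_ isT)/eqP.
(* The smallest ratio is the largest multiple of [c] whose subtraction keeps all weights
   nonnegative; it brings the weight at [i0] to 0. *)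
have [i0 ci0 i0min] := @Order.TotalTheory.arg_minP _ _ _ i1 (fun i => 0 < c 0 i) (fun i => t i / c 0 i) ci1.
pose r := t i0 / c 0 i0.
have r0 : 0 <= r by rewrite divr_ge0 // ltW.
exists (fun i => t i - r * c 0 i), i0; split.
- move=> i; rewrite subr_ge0; have [ci|ci] := ltP 0 (c 0 i).
    by rewrite -ler_pdivlMr //; exact: i0min.
  by apply: le_trans (t0 i); rewrite mulr_ge0_le0.
- by rewrite /r divfK ?subrr // gt_eqF.
- by rewrite sumrB -mulr_sumr c1 mulr0 subr0.
- move=> j; under eq_bigr do rewrite mulrBl -mulrA.
  by rewrite sumrB -mulr_sumr cz mulr0 subr0.
Qed.

Variables (T : ptopologicalType) (Y : set T) (N : nat).
Variable phi : T -> 'I_N -> R.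
Hypothesis cY : compact Y.
Hypothesis cphi : forall j, continuous (phi^~ j).

(** The hypothesis says that no linear functional separates [p] from the image of [Y]. Combinations
    of [N + 1] points form a compact set, so one of them, [q v], is closest to [p]. If it is not
    [p], the functional [p - q v] yields a point [y] to move towards, and [caratheodory_step] brings
    the resulting [N + 2] points back to [N + 1]. *)
Lemma in_convex_hull (p : 'I_N -> R) :
  (forall (a : 'I_N -> R) (e : R), 0 < e ->
     exists2 y, Y y & \sum_j a j * (p j - phi y j) < e) ->
  exists (m : nat) (t : 'I_m -> R) (y : 'I_m -> T),
    [/\ forall i, 0 <= t i, \sum_i t i = 1, forall i, Y (y i) &
        forall j, p j = \sum_i t i * phi (y i) j].
Proof.
move=> pP; have [y0 Yy0 _] := pP (fun=> 0) 1 ltr01.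
pose V := ('rV[T]_N.+1 * 'rV[R]_N.+1)%type.
pose D : set V := [set v : 'rV[T]_N.+1 | forall i, Y (v ord0 i)] `*`
  [set v : 'rV[R]_N.+1 | forall i, `[0, 1]%classic (v ord0 i)].
pose S (v : V) : R := \sum_i (v.2 ord0 i).
pose q (v : V) j : R := \sum_i v.2 ord0 i * phi (v.1 ord0 i) j.
have c2 i : continuous (fun v : V => v.2 ord0 i).
  move=> v; have := @continuous_comp _ _ _ snd (fun v : 'rV[R]_N.+1 => v ord0 i) v.
  by apply; [exact: cvg_snd | exact: entry_continuous].
have c1 i j : continuous (fun v : V => phi (v.1 ord0 i) j).
  move=> v; have := @continuous_comp _ _ _ fst (fun v : 'rV[T]_N.+1 => phi (v ord0 i) j) v.
  apply; first exact: cvg_fst.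
  have := @continuous_comp _ _ _ (fun v : 'rV[T]_N.+1 => v ord0 i) (phi^~ j) v.1.
  by apply; [exact: entry_continuous | exact: cphi].
have cS : continuous S by apply: sum_continuous.
have cq j : continuous (q^~ j).
  by apply: sum_continuous => i v; exact: (cvgM (c2 i v) (c1 i j v)).
pose f v : R := \sum_j (p j - q v j) ^+ 2.
have cf : continuous f.
  have -> : f = fun v => \sum_j (p j - q v j) * (p j - q v j) by [].
  apply: sum_continuous => j v.
  have h : (p j - q w j) @[w --> v] --> p j - q v j.
    exact: (@cvgB R R^o _ _ _ (cst (p j)) (q^~ j) _ _ (cvg_cst _) (cq j v)).
  exact: (@cvgM R _ _ _ (fun w => p j - q w j) (fun w => p j - q w j) _ _ h h).
have cD : compact (D `&` [set v | S v = 1]).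
  apply: compact_closedI.
    apply: compact_setX; first exact: (@rV_compact T N.+1 (fun=> Y)).
    apply: (@rV_compact R N.+1 (fun=> `[0, 1]%classic)) => i.
    exact: segment_compact.
  apply: (@preimage_closed _ R S [set r | r = 1]); last exact: closed_eq.
  by move=> v _; exact: cS.
have D0 : (D `&` [set v | S v = 1]) !=set0.
  exists (\row_i y0, \row_i (i == ord0)%:R); split.
    split=> i; rewrite mxE //= in_itv /=.
    by case: (i == ord0); rewrite ?lexx ?ler01.
  rewrite /S /=; under eq_bigr do rewrite mxE /=.
  by rewrite (bigD1 ord0) //= big1 ?addr0 // => i /negbTE ->.
have [v] := compact_EVT_min D0 cD (continuous_subspaceT cf).
rewrite inE => -[[Yv Dv] Sv] vmin.
have tv i : 0 <= v.2 ord0 i by have /= := Dv i; rewrite in_itv /= => /andP[].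
have [f0|f0] := eqVneq (f v) 0.
  exists N.+1, (fun i => (v.2 ord0 i)), (fun i => (v.1 ord0 i)); split=> // j.
  apply/eqP; rewrite -subr_eq0 -sqrf_eq0; move/eqP: f0.
  rewrite /f psumr_eq0 => [|k _]; last exact: sqr_ge0.
  by move=> /allP/(_ j); rewrite mem_index_enum => /(_ isT).
have fp : 0 < f v by rewrite lt_def f0 sumr_ge0 // => j _; exact: sqr_ge0.
have [y Yy ya] := pP (fun j => p j - q v j) (f v / 2) ltac:(by rewrite divr_gt0).
pose c : R := \sum_j (phi y j - q v j) ^+ 2.
have c0 : 0 <= c by apply: sumr_ge0 => j _; exact: sqr_ge0.
(* Moving by [s] changes [f] by less than [- s * f v + s ^ 2 * c], which is negative once
   [s * c < f v]. *)
pose s := Num.min 1 (f v / (2 * (c + 1))).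
have s0 : 0 < s by rewrite lt_min ltr01 divr_gt0 ?mulr_gt0 //; lra.
have s1 : s <= 1 by rewrite ge_min lexx.
have sc : s * c < f v.
  have : s * (2 * (c + 1)) <= f v.
    by rewrite -ler_pdivlMr ?ge_min ?lexx ?orbT //; lra.
  nra.
pose z (i : 'I_N.+2) : T := oapp (fun i => (v.1 ord0 i)) y (unlift ord0 i).
pose t (i : 'I_N.+2) : R := oapp (fun i => (1 - s) * (v.2 ord0 i)) s (unlift ord0 i).
have t0 i : 0 <= t i.
  rewrite /t; case: unliftP => [j|] _ /=; last exact: ltW.
  by rewrite mulr_ge0 // subr_ge0.
have tsum : \sum_i t i = 1.
  rewrite big_ord_recl /t unlift_none /=; under eq_bigr do rewrite liftK /=.
  by rewrite -mulr_sumr -/(S v) Sv; ring.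
have tz j : \sum_i t i * phi (z i) j = s * phi y j + (1 - s) * q v j.
  rewrite big_ord_recl /t /z unlift_none /=; congr (_ + _).
  under eq_bigr do rewrite liftK /= -mulrA.
  by rewrite -mulr_sumr.
have [t' [i0 [t'0 t'i0 t'sum t'z]]] := caratheodory_step (fun i => phi (z i)) t0.
rewrite tsum in t'sum.
have Yz i : Y (z i) by rewrite /z; case: unlift.
have drop (g : 'I_N.+2 -> R) : \sum_i t' i * g i = \sum_i t' (lift i0 i) * g (lift i0 i).
  rewrite (bigD1_ord i0) //= t'i0 mul0r add0r //.
pose w : V := (\row_i z (lift i0 i), \row_i t' (lift i0 i)).
have t'1 i : t' i <= 1.
  by rewrite -t'sum (bigD1 i) //= lerDl sumr_ge0.
have Sw : S w = 1.
  rewrite /S -t'sum; under eq_bigr do rewrite mxE /= -[t' _]mulr1.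
  by rewrite -(drop (fun=> 1)); under eq_bigr do rewrite mulr1.
have qw j : q w j = s * phi y j + (1 - s) * q v j.
  by rewrite -tz -t'z drop /q; under eq_bigr do rewrite !mxE /=.
have : f v <= f w.
  apply: vmin; rewrite inE; split=> //; split=> i; rewrite mxE //=.
  by rewrite in_itv /= t'0 t'1.
have -> : f w = f v - 2 * s * \sum_j (p j - q v j) * (phi y j - q v j) + s ^+ 2 * c.
  rewrite /f /c !mulr_sumr -sumrB -big_split; apply: eq_bigr => j _ /=.
  rewrite qw; ring.
have -> : \sum_j (p j - q v j) * (phi y j - q v j) =
    f v - \sum_j (p j - q v j) * (p j - phi y j).
  rewrite /f -sumrB; apply: eq_bigr => j _; ring.
rewrite expr2; set A := \sum_j _ in ya *; nra.
Qed.
End ConvexHull.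

(** * Positivity for normal tuples *)

Section FormBounds.
Variables (R : realType) (E : lmodType (Cplx R)) (q : E -> E -> Cplx R).
Hypothesis Q : psd_form q.

(** Each use of [nqD_le] doubles the constant; only its finiteness matters. *)
Lemma nq_sum (I : Type) (r : seq I) (F : I -> E) :
  nq q (\sum_(i <- r) F i) <= 2 ^+ size r * \sum_(i <- r) nq q (F i).
Proof.
elim: r => [|i r IH]; first by rewrite !big_nil /nq (form0l Q) re0 mulr0.
rewrite !big_cons exprS; apply: le_trans (nqD_le Q _ _) _.
have x0 := nq_ge0 Q (F i).
have x1 : 1 <= 2 ^+ size r :> R by rewrite exprn_ege1 // ler1n.
have : nq q (F i) <= 2 ^+ size r * nq q (F i) by rewrite ler_peMl.
lra.
Qed.

Lemma nq_sum_ord d (F : 'I_d -> E) :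
  nq q (\sum_i F i) <= 2 ^+ d * \sum_i nq q (F i).
Proof.
apply: le_trans (nq_sum _ _) _; suff -> : size (index_enum 'I_d) = d by [].
by rewrite /index_enum; case: index_enum_key; rewrite /= -enumT size_enum_ord.
Qed.

Lemma bdd_sum (I : Type) (r : seq I) (T : I -> E -> E) :
  (forall i, bdd q (T i)) -> bdd q (fun x => \sum_(i <- r) T i x).
Proof.
move=> bT; elim: r => [|i r [c c0 IH]].
  by exists 0 => // x; rewrite big_nil /nq (form0l Q) re0 mul0r.
have [d d0 Td] := bT i.
exists (2 * d + 2 * c) => [|x]; first by rewrite addr_ge0 ?mulr_ge0.
rewrite big_cons; apply: le_trans (nqD_le Q _ _) _.
by have := Td x; have := IH x; lra.
Qed.
End FormBounds.

Section DirectSum.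
Variables (R : realType) (L : hilbertType R) (n : nat).
Local Notation C := (Cplx R).
Let E := {ffun 'I_n -> L} : lmodType C.
Implicit Types (x y : {ffun 'I_n -> L}).

Definition sinner x y : C := \sum_k inner (x k) (y k).

Lemma sinner_psd : @psd_form R E sinner.
Proof.
split=> [z c x y|x y|x].
- rewrite /sinner mulr_sumr -big_split; apply: eq_bigr => k _.
  by rewrite /= !ffunE (formDl (inner_psd L)) (formZl (inner_psd L)).
- by rewrite /sinner rmorph_sum; apply: eq_bigr => k _; exact: inner_conj.
- by apply: sumr_ge0 => k _; rewrite n2E rc_ge0 n2_ge0.
Qed.

Lemma sinner_nq x : nq sinner x = \sum_k n2 (x k).
Proof. by rewrite /nq /sinner raddf_sum. Qed.

Definition diag_op (a : L -> L) x : {ffun 'I_n -> L} := [ffun k => a (x k)].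
(** [m k l] sends component [k] to component [l], the transpose of the usual order, to match sums of
    [inner (m k l (x k)) (x l)]. *)
Definition mx_op (m : 'I_n -> 'I_n -> L -> L) x : {ffun 'I_n -> L} :=
  [ffun l => \sum_k m k l (x k)].

Lemma diag_op_linear (a : bop L L) : linear (diag_op a : E -> E).
Proof. by move=> c x y; apply/ffunP => k; rewrite !ffunE bopD bopZ. Qed.

Lemma diag_op_bdd (a : bop L L) : @bdd R E sinner (diag_op a).
Proof.
have [c c0 ac] := bop_bounded a; exists c => // x.
by rewrite !sinner_nq mulr_sumr; apply: ler_sum => k _; rewrite ffunE.
Qed.

Lemma mx_op_linear (m : 'I_n -> 'I_n -> bop L L) : linear (mx_op m : E -> E).
Proof.
move=> c x y; apply/ffunP => l; rewrite !ffunE scaler_sumr -big_split.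
by apply: eq_bigr => k _; rewrite /= !ffunE bopD bopZ.
Qed.

Lemma mx_op_bdd (m : 'I_n -> 'I_n -> bop L L) : @bdd R E sinner (mx_op m).
Proof.
pose T (kl : 'I_n * 'I_n) (x : E) : E :=
  [ffun l => if l == kl.2 then m kl.1 kl.2 (x kl.1) else 0].
have bT kl : @bdd R E sinner (T kl).
  have [c c0 mc] := bop_bounded (m kl.1 kl.2); exists c => // x.
  rewrite !sinner_nq (bigD1 kl.2) //= big1 => [|l /negbTE l2]; last first.
    by rewrite ffunE l2 n2_0.
  rewrite ffunE eqxx addr0; apply: le_trans (mc _) _; rewrite ler_wpM2l //.
  by rewrite (bigD1 kl.1) //= lerDl sumr_ge0 // => k _; exact: n2_ge0.
have [c c0 Tc] := bdd_sum sinner_psd (index_enum _) bT.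
exists c => // x.
suff -> : mx_op m x = \sum_kl T kl x by exact: Tc.
apply/ffunP => l; rewrite ffunE sum_ffunE.
rewrite -(pair_bigA _ (fun k l' => T (k, l') x l)) /=; apply: eq_bigr => k _.
rewrite (bigD1 l) //= big1 => [|l' /negbTE l'l]; first by rewrite ffunE eqxx addr0.
by rewrite ffunE /= eq_sym l'l.
Qed.

Lemma mx_op_adj (m m' : 'I_n -> 'I_n -> bop L L) :
  (forall k l, adjoint (m k l) (m' l k)) ->
  forall x y, sinner (mx_op m x) y = sinner x (mx_op m' y).
Proof.
move=> mm x y; rewrite /sinner.
under eq_bigr do rewrite ffunE (form_suml (inner_psd L)).
rewrite exchange_big; apply: eq_bigr => k _ /=.
by rewrite ffunE (form_sumr (inner_psd L)); apply: eq_bigr => l _; exact: mm.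
Qed.

Lemma mx_diag_comm (m : 'I_n -> 'I_n -> bop L L) (a : bop L L) :
  (forall k l (y : L), m k l (a y) = a (m k l y)) ->
  forall x, mx_op m (diag_op a x) = diag_op a (mx_op m x).
Proof.
move=> ma x; apply/ffunP => l; rewrite !ffunE bop_sum; apply: eq_bigr => k _.
by rewrite ffunE ma.
Qed.
End DirectSum.

Section OperatorPositivity.
Variables (R : realType) (d n : nat) (L : hilbertType R) (N : optuple d L).
Local Notation C := (Cplx R).
Variables (K : set 'rV[C]_d).
Hypothesis Nn : normal_tuple N.
Hypothesis NK : joint_spectrum N `<=` K.
Variables (al0 : 'I_n -> 'I_n -> C) (al : 'I_d -> 'I_n -> 'I_n -> C).
Hypothesis alK : forall z, K z -> forall x : 'I_n -> C,
  0 <= re (\sum_k \sum_l (al0 k l + \sum_i al i k l * z 0 i) * (x k * (x l)^*)).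

Let E := {ffun 'I_n -> L} : lmodType C.

(** The selfadjoint part of the operator on [L ^ n] joins the real and imaginary parts of the [N i]
    in one commuting family. On a joint approximate eigenvector each [N i] may be replaced by a
    scalar, and the resulting form with scalar entries is nonnegative by [schur_product]. *)
Lemma normal_mx_ge0 (x0 : 'I_n -> L) :
  0 <= re (\sum_k \sum_l inner (al0 k l *: x0 k + \sum_i al i k l *: N i (x0 k)) (x0 l)).
Proof.
have [Nnorm Ncomm] := Nn.
have /choice[N' N'P] : forall i, exists B : bop L L,
    adjoint (N i) B /\ forall x, N i (B x) = B (N i x).
  by move=> i; have [B AB BB] := Nnorm i; exists B.
have adj i : adjoint (N i) (N' i) := (N'P i).1.
have adj' i : adjoint (N' i) (N i).
  by move=> x y; rewrite inner_conj -adj -inner_conj.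
have NN' i j x : N j (N' i x) = N' i (N j x).
  by apply: (fuglede (adj i) (N'P i).2) => y; exact: Ncomm.
have N'N' i j x : N' j (N' i x) = N' i (N' j x).
  apply/eqP; rewrite -subr_eq0; apply/eqP/n2_eq0.
  rewrite /n2 /nq; set w := (X in inner _ X).
  by rewrite (formBl (inner_psd L)) !adj' Ncomm subrr.
(* Operators commuting with every [N i] and its adjoint. Fuglede puts the [N i] there; closure under
   sums and scalars gives every commutation used below. *)
pose cc (a : bop L L) := forall i, (forall x, a (N i x) = N i (a x)) /\
  (forall x, a (N' i x) = N' i (a x)).
have ccN i : cc (N i) by move=> j; split=> x; [exact: Ncomm | exact: NN'].
have ccN' i : cc (N' i) by move=> j; split=> x; [rewrite NN' | exact: N'N'].
have ccD a b : cc a -> cc b -> cc (a + b).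
  move=> ca cb i; split=> x; rewrite !add_bopE bopD.
    by rewrite (ca i).1 (cb i).1.
  by rewrite (ca i).2 (cb i).2.
have ccZ c a : cc a -> cc (c *: a).
  by move=> ca i; split=> x; rewrite !scale_bopE bopZ ?(ca i).1 ?(ca i).2.
have cc0 : cc 0 by move=> i; split=> x; rewrite !zero_bopE bop0.
have cc1 : cc (bop_id L) by [].
have ccS I (r : seq I) (F : I -> bop L L) : (forall i, cc (F i)) -> cc (\sum_(i <- r) F i).
  by move=> cF; apply: big_ind.
pose half : C := rc 2^-1.
pose A i : bop L L := half *: (N i + N' i).
pose B i : bop L L := (- (half * ci)) *: (N i - N' i).
have AB i x : N i x = A i x + ci *: B i x.
  rewrite /A /B !scale_bopE !add_bopE opp_bopE scalerA mulrN mulrCA sqr_ci mulrN1 opprK.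
  rewrite -scalerDr addrACA subrr addr0 scalerDr -scalerDl.
  have -> : half + half = 1 by rewrite /half -rcD -rc1; congr rc; field.
  by rewrite scale1r.
(* Even indices carry the real parts [A], odd ones the imaginary parts [B]. In [h] they are shifted
   by one, index 0 being the matrix operator. *)
pose hh k : bop L L := if insub k./2 is Some i then (if odd k then B i else A i) else 0.
have hodd (i : 'I_d) : hh i.*2.+1 = B i.
  by rewrite /hh /= uphalf_double valK /= odd_double.
have heven (i : 'I_d) : hh i.*2 = A i by rewrite /hh doubleK valK odd_double.
have hhcase (P : bop L L -> Prop) : P 0 -> (forall i, P (A i)) -> (forall i, P (B i)) ->
    forall k, P (hh k).
  by move=> P0 PA PB k; rewrite /hh; case: insub => // i; case: odd.
have adjD (a a' b b' : bop L L) : adjoint a a' -> adjoint b b' -> adjoint (a + b) (a' + b').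
  move=> aa bb x y; rewrite !add_bopE (formDl (inner_psd L)) (formDr (inner_psd L)).
  by rewrite aa bb.
have adjZ c (a a' : bop L L) : adjoint a a' -> adjoint (c *: a) (c^* *: a').
  move=> aa x y; rewrite !scale_bopE (formZl (inner_psd L)) (formZr (inner_psd L)).
  by rewrite conjCK aa.
have adj0 : adjoint (0 : bop L L) 0.
  by move=> x y; rewrite !zero_bopE (form0l (inner_psd L)) (form0r (inner_psd L)).
have adjS I (r : seq I) (F F' : I -> bop L L) : (forall i, adjoint (F i) (F' i)) ->
    adjoint (\sum_(i <- r) F i) (\sum_(i <- r) F' i).
  move=> FF; elim: r => [|i r IH]; first by rewrite !big_nil.
  by rewrite !big_cons; exact: adjD.
have hhadj : forall k, adjoint (hh k) (hh k).
  apply: (hhcase (fun a => adjoint a a)) => // i.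
    have := adjZ half _ _ (adjD _ _ _ _ (adj i) (adj' i)).
    by rewrite conj_rc [N' i + N i]addrC.
  have := adjZ (- (half * ci)) _ _ (adjD _ _ _ _ (adj i) (adjZ (-1) _ _ (adj' i))).
  rewrite !rmorphN rmorph1 rmorphM /= conj_rc conj_ci mulrN opprK !scaleN1r.
  by rewrite -/(B i) -[N' i - N i]opprB scalerN -scaleNr.
have hhcc : forall k, cc (hh k).
  by apply: (hhcase cc) => // i; apply/ccZ; apply/ccD => //; rewrite -scaleN1r; apply/ccZ.
pose g k l : bop L L := al0 k l *: bop_id L + \sum_i al i k l *: N i.
pose g' k l : bop L L := (al0 l k)^* *: bop_id L + \sum_i (al i l k)^* *: N' i.
have gg' k l : adjoint (g k l) (g' l k).
  by apply/adjD; [apply/adjZ => x y | apply/adjS => i; exact: adjZ].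
have ccg k l : cc (g k l) by apply/ccD; [exact: ccZ | apply/ccS => i; exact: ccZ].
have ccg' k l : cc (g' k l) by apply/ccD; [exact: ccZ | apply/ccS => i; exact: ccZ].
pose m k l : bop L L := half *: (g k l + g' k l).
have g'g k l : adjoint (g' k l) (g l k).
  by move=> x y; rewrite inner_conj -gg' -inner_conj.
have madj k l : adjoint (m k l) (m l k).
  have := adjZ half _ _ (adjD _ _ _ _ (gg' k l) (g'g k l)).
  by rewrite conj_rc [g' l k + g l k]addrC.
have ccm k l : cc (m k l) by apply/ccZ; apply/ccD.
have chh k a : cc a -> forall x, a (hh k x) = hh k (a x).
  move=> ca; apply: (hhcase (fun b => forall x, a (b x) = b (a x))) => [x|i x|i x].
  - by rewrite !zero_bopE bop0.
  - by rewrite /A !scale_bopE !add_bopE bopZ bopD (ca i).1 (ca i).2.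
  - by rewrite /B !scale_bopE !add_bopE !opp_bopE bopZ bopD bopN (ca i).1 (ca i).2.
pose h k : E -> E := if k is k'.+1 then diag_op (hh k') else mx_op m.
have hl k : linear (h k).
  by case: k => [|k]; [exact: mx_op_linear | exact: diag_op_linear].
have hb k : bdd (@sinner R L n) (h k).
  by case: k => [|k]; [exact: mx_op_bdd | exact: diag_op_bdd].
have hs k : sadj (@sinner R L n) (h k).
  case: k => [|k] x y; first exact: mx_op_adj.
  by apply: eq_bigr => j _; rewrite !ffunE; exact: hhadj.
have hc i j x : h i (h j x) = h j (h i x).
  case: i j => [|i] [|j] //=.
  - by apply: (mx_diag_comm (m := m)) => k l y; exact: chh.
  - by apply/esym/(mx_diag_comm (m := m)) => k l y; exact: chh.
  - by apply/ffunP => k; rewrite !ffunE; exact: chh.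
have qMG (x : E) : re (sinner (mx_op m x) x) = re (sinner (mx_op g x) x).
  have mE : mx_op m x = half *: (mx_op g x + mx_op g' x) :> E.
    apply/ffunP => l; rewrite !ffunE -big_split scaler_sumr.
    by apply: eq_bigr => k _.
  rewrite mE (formZl (sinner_psd L n)) (formDl (sinner_psd L n)) re_rcM reD.
  rewrite (mx_op_adj g'g) (re_formC (sinner_psd L n)); lra.
have qg (x : E) : sinner (mx_op g x) x =
    \sum_k \sum_l inner (al0 k l *: x k + \sum_i al i k l *: N i (x k)) (x l).
  rewrite /sinner; under eq_bigr do rewrite ffunE (form_suml (inner_psd L)).
  rewrite exchange_big; apply: eq_bigr => k _; apply: eq_bigr => l _.
  by rewrite /g add_bopE sum_bopE scale_bopE.
pose X0 : E := finfun x0.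
have <- : \sum_k \sum_l inner (al0 k l *: X0 k + \sum_i al i k l *: N i (X0 k)) (X0 l)
  = \sum_k \sum_l inner (al0 k l *: x0 k + \sum_i al i k l *: N i (x0 k)) (x0 l).
  by apply: eq_bigr => k _; apply: eq_bigr => l _; rewrite !ffunE.
rewrite -qg -qMG leNgt; apply/negP => neg.
have SP := sinner_psd L n.
pose nqE := nq (@sinner R L n).
have X0p : 0 < nqE X0.
  rewrite lt_def (nq_ge0 SP) andbT; apply/eqP => X00; move: neg.
  by rewrite (form_conj SP X0) (form_eq0 SP _ X00) rmorph0 re0 ltxx.
pose s := (Num.sqrt (nqE X0))^-1.
have s2 : s ^+ 2 = (nqE X0)^-1 by rewrite /s exprVn sqr_sqrtr // ltW.
pose X1 : E := rc s *: X0.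
have X11 : nqE X1 = 1 by rewrite /nqE /X1 (nqZr SP) s2 mulVf // gt_eqF.
have neg1 : re (sinner (mx_op m X1) X1) < 0.
  have := hl 0%N (rc s) X0 0; rewrite addr0 /= => ->.
  have -> : mx_op m (0 : E) = 0.
    have := hl 0%N (-1) 0 0; rewrite /= scaler0 addr0 scaleN1r => ->.
    by rewrite addNr.
  rewrite addr0 (formZl SP) (formZr SP) conj_rc !re_rcM mulrA -expr2 s2.
  by rewrite pmulr_rlt0 // invr_gt0.
have [mu [mu0 muP]] := joint_approx_eigenvector SP d.*2.+1 hl hb hs hc X11.
have {}mu0 : mu 0%N < 0 by exact: le_lt_trans neg1.
pose def (x : E) := \sum_(k < d.*2.+1) nqE (h k x - rc (mu k) *: x).
have def_ge k (x : E) : (k < d.*2.+1)%N -> nqE (h k x - rc (mu k) *: x) <= def x.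
  move=> kd; rewrite /def (bigD1 (Ordinal kd)) //= lerDl sumr_ge0 // => i _.
  exact: nq_ge0.
pose lam (i : 'I_d) : C := rc (mu i.*2.+1) + ci * rc (mu i.*2.+2).
pose eta i (x : E) : E := diag_op (N i) x - lam i *: x.
have eta_le i x : nqE (eta i x) <= 4 * def x.
  have -> : eta i x = (h i.*2.+1 x - rc (mu i.*2.+1) *: x) +
      ci *: (h i.*2.+2 x - rc (mu i.*2.+2) *: x).
    apply/ffunP => k; rewrite /eta /h hodd heven !ffunE AB scalerBr scalerA /lam scalerDl.
    by rewrite opprD addrACA.
  apply: le_trans (nqD_le SP _ _) _; rewrite (nqZ SP) re_ci im_ci expr0n expr1n add0r mul1r.
  have i1 : (i.*2.+1 < d.*2.+1)%N by rewrite ltnS ltn_double.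
  have i2 : (i.*2.+2 < d.*2.+1)%N by rewrite ltnS -doubleS leq_double.
  by have := def_ge _ x i1; have := def_ge _ x i2; rewrite /nqE; lra.
(* A left inverse of [N - lam] would bound the defect of unit vectors away from 0, but it can be
   made arbitrarily small. *)
have Klam : K (\row_i lam i).
  apply: NK => -[[D DP] _].
  have /choice[c cP] : forall i, exists c : R, 0 <= c /\ forall x, n2 (D i x) <= c * n2 x.
    by move=> i; have [c c0 Dc] := bop_bounded (D i); exists c.
  pose c' : R := 2 ^+ d * \sum_i c i.
  have c'0 : 0 <= c'.
    by rewrite mulr_ge0 ?exprn_ge0 // sumr_ge0 // => i _; have [] := cP i.
  have lower x : n2 x <= c' * \sum_i n2 (N i x - lam i *: x).
    rewrite -{1}(DP x); apply: le_trans (nq_sum_ord (inner_psd L) _) _.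
    rewrite /c' -mulrA ler_wpM2l ?exprn_ge0 // mulr_suml; apply: ler_sum => i _.
    have [ci0 cle] := cP i; rewrite mxE; apply: le_trans (cle _) _.
    rewrite ler_wpM2l // (bigD1 i) //= lerDl sumr_ge0 // => j _; exact: n2_ge0.
  have lowerE (x : E) : nqE x <= c' * (d%:R * (4 * def x)).
    rewrite /nqE sinner_nq; apply: le_trans (ler_sum _ (fun k _ => lower (x k))) _.
    rewrite -mulr_sumr ler_wpM2l // exchange_big /= mulr_natl -[d in _ *+ d]card_ord -sumr_const.
    apply: ler_sum => i _; apply: le_trans (eta_le i x).
    by rewrite /nqE sinner_nq; apply: ler_sum => k _; rewrite !ffunE.
  have cd0 : 0 <= c' * (d%:R * 4) by apply: mulr_ge0 => //; apply: mulr_ge0; exact: ler0n.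
  have [|x x1 xe] := muP (c' * (d%:R * 4) + 1)^-1; first by rewrite invr_gt0; lra.
  have := lowerE x; rewrite /nqE x1 -/(def x) in xe *.
  have : (c' * (d%:R * 4)) * def x <= (c' * (d%:R * 4)) * (c' * (d%:R * 4) + 1)^-1.
    by rewrite ler_wpM2l // ltW.
  have : (c' * (d%:R * 4)) * (c' * (d%:R * 4) + 1)^-1 < 1 by rewrite ltr_pdivrMr ?mul1r; lra.
  lra.
pose gl k l : C := al0 k l + \sum_i al i k l * lam i.
pose T i : E -> E := mx_op (fun k l => al i k l *: bop_id L).
have glpos (x : E) : 0 <= re (\sum_k \sum_l gl k l * inner (x k) (x l)).
  apply: (@schur_product R (fun z => 0 <= re z)) => //; last exact: inner_psd.
    by move=> a b; rewrite reD; exact: addr_ge0.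
  move=> y; have := alK Klam y.
  suff -> : \sum_k \sum_l (al0 k l + \sum_i al i k l * (\row_i lam i) 0 i) * (y k * (y l)^*) =
    \sum_k \sum_l gl k l * (y k * (y l)^*) by [].
  apply: eq_bigr => k _; apply: eq_bigr => l _; congr ((_ + _) * _).
  by apply: eq_bigr => i _; rewrite mxE.
have gsplit (x : E) : sinner (mx_op g x) x =
    \sum_k \sum_l gl k l * inner (x k) (x l) + sinner (\sum_i T i (eta i x)) x.
  rewrite qg [X in _ + X]/sinner.
  have -> : \sum_l inner ((\sum_i T i (eta i x)) l) (x l) =
      \sum_k \sum_l inner (\sum_i al i k l *: (eta i x k)) (x l).
    rewrite exchange_big /=; apply: eq_bigr => l _; rewrite -(form_suml (inner_psd L)).
    congr inner; rewrite sum_ffunE exchange_big /=; apply: eq_bigr => i _.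
    by rewrite ffunE.
  rewrite -big_split; apply: eq_bigr => k _ /=; rewrite -big_split.
  apply: eq_bigr => l _ /=; rewrite -(formZl (inner_psd L)) -(formDl (inner_psd L)).
  congr inner; rewrite /gl scalerDl -addrA scaler_suml -big_split; congr (_ + _).
  apply: eq_bigr => i _ /=; rewrite !ffunE scalerBr scalerA.
  by rewrite addrC subrK.
have /choice[t tP] : forall i, exists t : R, 0 <= t /\ forall x : E, nqE (T i x) <= t * nqE x.
  by move=> i; have [t t0 Tt] := mx_op_bdd (fun k l => al i k l *: bop_id L); exists t.
pose cu : R := 2 * (2 ^+ d * \sum_i t i * 4) + 2.
have S0 : 0 <= \sum_i t i * 4 by apply: sumr_ge0 => i _; rewrite mulr_ge0 //; case: (tP i).
have cu0 : 0 < cu by rewrite /cu ltr_wpDl // !mulr_ge0 ?exprn_ge0.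
(* At this tolerance the residual [u] has [nq u < mu 0 ^ 2], whereas positivity of the scalar form
   forces [re <u, x> <= mu 0 < 0]; Cauchy-Schwarz excludes both at once. *)
have [|x x1 xe] := muP (mu 0%N ^+ 2 / cu).
  by rewrite divr_gt0 // exprn_even_gt0 //= lt_eqF.
rewrite -/(def x) in xe.
pose u : E := \sum_i T i (eta i x) - (mx_op m x - rc (mu 0%N) *: x).
have nu : nqE u <= cu * def x.
  apply: le_trans (nqD_le SP _ _) _; rewrite (nqN SP).
  have h1 := def_ge 0%N x isT; rewrite /= in h1.
  have h2 := nq_sum_ord SP (fun i => T i (eta i x)).
  have h3 : \sum_i nq (@sinner R L n) (T i (eta i x)) <= (\sum_i t i * 4) * def x.
    rewrite mulr_suml; apply: ler_sum => i _; have [t0 tle] := tP i.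
    by apply: le_trans (tle _) _; rewrite -mulrA ler_wpM2l.
  have h4 : 2 ^+ d * (\sum_i nq (@sinner R L n) (T i (eta i x))) <=
      2 ^+ d * ((\sum_i t i * 4) * def x).
    by rewrite ler_wpM2l // exprn_ge0.
  by rewrite /cu /nqE in h1 *; lra.
have mu_eq : mu 0%N = re (\sum_k \sum_l gl k l * inner (x k) (x l)) + re (sinner u x).
  have -> : sinner u x = sinner (\sum_i T i (eta i x)) x - (sinner (mx_op m x) x - rc (mu 0%N)).
    rewrite /u (formBl SP) (formBl SP) (formZl SP) (form_nq SP) x1.
    by rewrite rc1 mulr1.
  have qm := qMG x; rewrite gsplit reD in qm.
  by rewrite !reB re_rc qm; ring.
have ul : re (sinner u x) <= mu 0%N by have := glpos x; lra.
have := form_cauchy SP u x; rewrite x1 mulr1 => cs.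
have : def x * cu < mu 0%N ^+ 2 by rewrite -ltr_pdivlMr.
have := sqr_ge0 (im (sinner u x)); rewrite /nqE in nu; nra.
Qed.
End OperatorPositivity.

(** * The minimal matrix convex set *)

(** Pairs of a point of [K] and a unit vector will parametrize a convex hull, for which
    [in_convex_hull] asks a pointed space. *)
HB.instance Definition _ (T U : ptopologicalType) := Pointed.on (T * U)%type.

Section ComplexTopology.
Variable R : realType.
Local Notation C := (Cplx R).

Lemma nbhs_cplx (z : C) (A : set C) :
  nbhs z A <-> exists2 e : R, 0 < e & forall w, re `|z - w| < e -> A w.
Proof.
split=> [/nbhs_ballP[e /= e0 eA]|[e e0 eA]].
  have ee : e = rc (re e) by apply/ge0_rc/ltW.
  exists (re e); first by have := lt_re e0; rewrite re0.
  by move=> w zw; apply: eA; rewrite /ball /= ee -re_norm rc_lt.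
apply/nbhs_ballP; exists (rc e) => /=; first by rewrite -rc0 rc_lt.
by move=> w; rewrite /ball /= -re_norm rc_lt => /eA.
Qed.

Lemma re_continuous : continuous (@re R : C -> R).
Proof.
move=> z A /nbhs_ballP[e /= e0 eA]; apply/nbhs_cplx; exists e => // w zw.
by apply: eA; rewrite /ball /= -reB; apply: le_lt_trans zw; exact: norm_re.
Qed.
Lemma im_continuous : continuous (@im R : C -> R).
Proof.
move=> z A /nbhs_ballP[e /= e0 eA]; apply/nbhs_cplx; exists e => // w zw.
by apply: eA; rewrite /ball /= -imB; apply: le_lt_trans zw; exact: norm_im.
Qed.
Lemma rc_continuous : continuous (@rc R : R -> C).
Proof.
move=> r A /nbhs_cplx[e e0 eA]; apply/nbhs_ballP; exists e => //= s.
by rewrite /ball /= => rs; apply: eA; rewrite -raddfB norm_rc.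
Qed.
Lemma conj_continuous : continuous (fun z : C => z^*).
Proof.
move=> z A /nbhs_cplx[e e0 eA]; apply/nbhs_cplx; exists e => // w zw.
by apply: eA; rewrite -rmorphB norm_conjC.
Qed.

Definition cbox (r : R) : set C := [set z | `|re z| <= r /\ `|im z| <= r].

Lemma cbox_compact r : compact (cbox r).
Proof.
have -> : cbox r = (fun ab : R * R => rc ab.1 + ci * rc ab.2 : C) @` (`[-r, r] `*` `[-r, r]).
  apply/seteqP; split=> [z [zr zi]|z [[a b] /= []]].
    by exists (re z, im z); rewrite /= -?cplxE // !in_itv /= -!ler_norml.
  rewrite !in_itv /= -!ler_norml => ar br <-.
  have e1 : re (rc a + ci * rc b) = a by rewrite reD reM re_ci im_ci !re_rc !im_rc; ring.
  have e2 : im (rc a + ci * rc b) = b by rewrite imD imM re_ci im_ci !re_rc !im_rc; ring.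
  by split; [rewrite e1 | rewrite e2].
apply: continuous_compact; last by apply: compact_setX; exact: segment_compact.
apply: continuous_subspaceT => ab.
have h1 : rc x.1 @[x --> ab] --> (rc ab.1 : C).
  by have := @continuous_comp _ _ _ (@fst R R) (@rc R : R -> C) ab; apply;
    [exact: cvg_fst | exact: rc_continuous].
have h2 : rc x.2 @[x --> ab] --> (rc ab.2 : C).
  by have := @continuous_comp _ _ _ (@snd R R) (@rc R : R -> C) ab; apply;
    [exact: cvg_snd | exact: rc_continuous].
apply: (@cvgD _ C^o _ _ _ _ _ _ _ h1).
exact: (@cvgM C _ _ _ _ _ _ _ (cvg_cst ci) h2).
Qed.
End ComplexTopology.

Lemma in_convex_hull_fin (R : realType) (T : ptopologicalType) (Y : set T)
    (J : finType) (phi : T -> J -> R) (p : J -> R) :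
  compact Y -> (forall j, continuous (phi^~ j)) ->
  (forall (a : J -> R) (e : R), 0 < e ->
     exists2 y, Y y & \sum_j a j * (p j - phi y j) < e) ->
  exists (m : nat) (t : 'I_m -> R) (y : 'I_m -> T),
    [/\ forall i, 0 <= t i, \sum_i t i = 1, forall i, Y (y i) &
        forall j, p j = \sum_i t i * phi (y i) j].
Proof.
move=> cY cphi pP.
have [a e e0|m [t [y [t0 t1 Yy py]]]] := @in_convex_hull R T Y #|J|
    (fun y i => phi y (enum_val i)) cY (fun j => cphi (enum_val j)) (fun i => p (enum_val i)).
  have [y Yy ye] := pP (fun j => a (enum_rank j)) e e0; exists y => //.
  move: ye; rewrite (reindex (fun i : 'I_#|J| => enum_val i)) /=; last first.
    exact/onW_bij/enum_val_bij.
  by under eq_bigr do rewrite enum_valK.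
exists m, t, y; split=> // j.
by have := py (enum_rank j); rewrite enum_rankK.
Qed.

Lemma cinner_delta (R : realType) n (u : 'cV[Cplx R]_n) l : cinner u (delta_mx l 0) = u l 0.
Proof.
rewrite /cinner (bigD1 l) //= !mxE !eqxx rmorph1 mulr1 big1 ?addr0 // => k /negbTE kl.
by rewrite !mxE kl rmorph0 mulr0.
Qed.

Section WminDecomposition.
Variables (R : realType) (d : nat) (K : set 'rV[Cplx R]_d).
Local Notation C := (Cplx R).

Definition psd_mx n (B : 'M[C]_n) := forall x : 'cV[C]_n, 0 <= cinner (B *m x) x.

Definition unit_sphere n : set 'rV[C]_n :=
  [set x | \sum_k (re (x 0 k) ^+ 2 + im (x 0 k) ^+ 2) = 1].

Lemma unit_sphere_compact n : compact (@unit_sphere n).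
Proof.
have -> : @unit_sphere n = [set x : 'rV[C]_n | forall k, cbox 1 (x ord0 k)] `&` @unit_sphere n.
  apply/seteqP; split=> [x x1|x []//]; split=> // k.
  have : re (x 0 k) ^+ 2 + im (x 0 k) ^+ 2 <= 1.
    rewrite -x1 (bigD1 k) //= lerDl sumr_ge0 // => l _.
    by rewrite addr_ge0 ?sqr_ge0.
  have := sqr_ge0 (re (x 0 k)); have := sqr_ge0 (im (x 0 k)) => i0 r0 ri.
  by split; rewrite -(ler_pXn2r (n := 2)) ?nnegrE // expr1n real_normK ?num_real //; lra.
apply: compact_closedI.
  by apply: (@rV_compact C n (fun=> cbox 1)) => i; exact: cbox_compact.
apply: (@preimage_closed _ R (fun x : 'rV[C]_n =>
  \sum_k (re (x 0 k) ^+ 2 + im (x 0 k) ^+ 2)) [set r | r = 1]); last exact: closed_eq.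
move=> x _; apply: sum_continuous => k y.
have cr : re (z 0 k) @[z --> y] --> (re (y 0 k) : R).
  have := @continuous_comp _ _ _ (fun z : 'rV[C]_n => z 0 k) (@re R) y.
  by apply; [exact: entry_continuous | exact: re_continuous].
have ci' : im (z 0 k) @[z --> y] --> (im (y 0 k) : R).
  have := @continuous_comp _ _ _ (fun z : 'rV[C]_n => z 0 k) (@im R) y.
  by apply; [exact: entry_continuous | exact: im_continuous].
exact: (@cvgD R R^o _ _ _ _ _ _ _ (@cvgM R _ _ _ _ _ _ _ cr cr) (@cvgM R _ _ _ _ _ _ _ ci' ci')).
Qed.

Let part (b : bool) : C -> R := if b then @im R else @re R.

(** The [None] coordinate is the constant 1, so that [\sum_j B j = 1] and the formulas for [X i] are
    instances of one identity. *)
Let coord (z : 'rV[C]_d) (o : option 'I_d) : C := if o is Some i then z 0 i else 1.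

Lemma rank_one_psd n (x : 'rV[C]_n) (r : R) : 0 <= r ->
  psd_mx (\matrix_(k, l) (rc r * (x 0 k * (x 0 l)^*))).
Proof.
move=> r0 y; rewrite /cinner.
have -> : \sum_k ((\matrix_(k, l) (rc r * (x 0 k * (x 0 l)^*))) *m y) k 0 * (y k 0)^* =
   rc r * ((\sum_l (x 0 l)^* * y l 0) * (\sum_l (x 0 l)^* * y l 0)^*).
  rewrite rmorph_sum mulr_sumr mulr_sumr; apply: eq_bigr => k _.
  rewrite mxE rmorphM /= conjCK !mulr_suml mulr_sumr; apply: eq_bigr => l _.
  rewrite mxE; ring.
by rewrite mul_conj mulr_ge0 // rc_ge0 // addr_ge0 ?sqr_ge0.
Qed.

(** Up to the factor [1 / n], the tuple [1, X_1, ..., X_d] lies in the convex hull of the tuples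
    [1, z_1, ..., z_d] multiplied by rank-one projections, with [z] in [K]. A separating functional,
    read as a matrix valued affine function, would violate [normal_mx_ge0] at the vectors
    [V e_k]. *)
Lemma Wmin_decomposition (X : mxtuple R d) : compact K -> Wmin K X ->
  exists (m : nat) (z : 'I_m -> 'rV[C]_d) (B : 'I_m -> 'M[C]_((tag X).+1)),
    [/\ forall j, K (z j), forall j, psd_mx (B j), \sum_j B j = 1%:M &
        forall i, tagged X i = \sum_j z j 0 i *: B j].
Proof.
move=> cK [L [N [Nn NK [V [W [VV VW XW]]]]]].
set n := (tag X).+1 in V W VV VW XW *.
pose P (o : option 'I_d) : 'M[C]_n := if o is Some i then tagged X i else 1%:M.
pose J : finType := (option 'I_d * ('I_n * 'I_n) * bool)%type.
pose phi (y : 'rV[C]_d * 'rV[C]_n) (j : J) : R :=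
  part j.2 (coord y.1 j.1.1 * (y.2 0 j.1.2.1 * (y.2 0 j.1.2.2)^*)).
(* The factor [1 / n] matches traces: 1 for a rank-one projection, [n] for the identity. *)
pose p (j : J) : R := part j.2 (rc n%:R^-1 * P j.1.1 j.1.2.1 j.1.2.2).
have cphi (j : J) : continuous (phi^~ j).
  have cx k : continuous (fun x : 'rV[C]_d * 'rV[C]_n => x.2 0 k).
    move=> y; have := @continuous_comp _ _ _ (@snd 'rV[C]_d 'rV[C]_n) (fun z : 'rV[C]_n => z 0 k) y.
    by apply; [exact: cvg_snd | exact: entry_continuous].
  have cx' k : continuous (fun x : 'rV[C]_d * 'rV[C]_n => (x.2 0 k)^*).
    move=> y; have := @continuous_comp _ _ _ (fun x : 'rV[C]_d * 'rV[C]_n => x.2 0 k)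
      (fun z : C => z^*) y.
    by apply; [exact: cx | exact: conj_continuous].
  have cz : continuous (fun x : 'rV[C]_d * 'rV[C]_n => coord x.1 j.1.1).
    rewrite /coord; case: j.1.1 => [i|] y; last exact: cvg_cst.
    have := @continuous_comp _ _ _ (@fst 'rV[C]_d 'rV[C]_n) (fun z : 'rV[C]_d => z 0 i) y.
    by apply; [exact: cvg_fst | exact: entry_continuous].
  move=> y.
  have cM := @cvgM C _ _ _ _ _ _ _ (cz y) (@cvgM C _ _ _ _ _ _ _ (cx j.1.2.1 y) (cx' j.1.2.2 y)).
  have := @continuous_comp _ _ _ (fun y : 'rV[C]_d * 'rV[C]_n =>
    coord y.1 j.1.1 * (y.2 0 j.1.2.1 * (y.2 0 j.1.2.2)^*)) (part j.2) y.
  apply; first exact: cM.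
  by rewrite /part; case: j.2; [exact: im_continuous | exact: re_continuous].
have n0 : n%:R != 0 :> R by rewrite pnatr_eq0.
have [a e e0|m [t [y [t0 t1 Yy py]]]] := in_convex_hull_fin (p := p)
    (compact_setX cK (unit_sphere_compact (n := n))) cphi.
  apply: contrapT => noY.
  have below (z : 'rV[C]_d) (x : 'rV[C]_n) : K z -> unit_sphere x ->
      \sum_j a j * phi (z, x) j <= \sum_j a j * p j - e.
    move=> Kz x1; rewrite leNgt; apply/negP => lt; apply: noY; exists (z, x) => //.
    under eq_bigr do rewrite mulrBr; rewrite sumrB; lra.
  (* Merges two real coefficients into a complex one: [re ((a - i a') g)] is [a re g + a' im g]. *)
  pose w o k l : C := rc (a (o, (k, l), false)) - ci * rc (a (o, (k, l), true)).
  have wP (g : option 'I_d -> 'I_n -> 'I_n -> C) :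
      \sum_(j : J) a j * part j.2 (g j.1.1 j.1.2.1 j.1.2.2) =
      re (\sum_k \sum_l \sum_o w o k l * g o k l).
    have -> : \sum_(j : J) a j * part j.2 (g j.1.1 j.1.2.1 j.1.2.2) =
        \sum_(j : J) a (j.1.1, (j.1.2.1, j.1.2.2), j.2) * part j.2 (g j.1.1 j.1.2.1 j.1.2.2).
      by apply: eq_bigr => j _; case: j => jj b; case: jj => o kl; case: kl.
    rewrite -(pair_bigA _ (fun (jj : option 'I_d * ('I_n * 'I_n)) b =>
      a (jj.1, (jj.2.1, jj.2.2), b) * part b (g jj.1 jj.2.1 jj.2.2))) /=.
    rewrite -(pair_bigA _ (fun o (kl : 'I_n * 'I_n) =>
      \sum_b a ((o, (kl.1, kl.2)), b) * part b (g o kl.1 kl.2))) /=.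
    rewrite exchange_big /=.
    rewrite -(pair_bigA _ (fun k l => \sum_o \sum_b a ((o, (k, l)), b) * part b (g o k l))) /=.
    rewrite raddf_sum; apply: eq_bigr => k _; rewrite raddf_sum; apply: eq_bigr => l _.
    rewrite raddf_sum; apply: eq_bigr => o _; rewrite big_bool /part /w /= mulrBl reB.
    rewrite re_rcM -mulrA [ci * _]mulrC -mulrA re_rcM.
    by rewrite reM re_ci im_ci mulr0 mulr1 sub0r mulrN opprK addrC.
  pose gam : R := \sum_j a j * p j - e.
  (* [gam] times the identity minus the functional, with [k] and [l] exchanged because
     [<N i xi_k, xi_l>] is the entry of [X i] in row [l] and column [k]. *)
  pose al0 k l : C := (if k == l then rc gam else 0) - w None l k.
  pose al i k l : C := - w (Some i) l k.
  have optsum (F : option 'I_d -> C) : \sum_o F o = F None + \sum_i F (Some i).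
    rewrite (bigD1 None) //=; congr (_ + _).
    rewrite (reindex_omap Some id) => [|[i|] //].
    by apply: eq_bigl => i; rewrite eqxx.
  have alsum (c : option 'I_d -> 'I_n -> 'I_n -> C) :
      \sum_k \sum_l (al0 k l * c None k l + \sum_i al i k l * c (Some i) k l) =
      rc gam * \sum_k c None k k - \sum_k \sum_l \sum_o w o k l * c o l k.
    have e1 k l : al0 k l * c None k l + \sum_i al i k l * c (Some i) k l =
        (if k == l then rc gam * c None k l else 0) - \sum_o w o l k * c o k l.
      rewrite optsum /al0 /al mulrBl opprD addrA; congr (_ + _ + _).
        by case: eqP => //; rewrite mul0r.
      by rewrite -sumrN; apply: eq_bigr => i _; rewrite mulNr.
    under eq_bigr do under eq_bigr do rewrite e1.
    under eq_bigr do rewrite sumrB; rewrite sumrB; congr (_ - _); last exact: exchange_big.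
    rewrite mulr_sumr; apply: eq_bigr => k _; rewrite (bigD1 k) //= eqxx big1 ?addr0 //.
    by move=> l /negbTE; rewrite eq_sym => ->.
  have alK (z : 'rV[C]_d) : K z -> forall x : 'I_n -> C,
      0 <= re (\sum_k \sum_l (al0 k l + \sum_i al i k l * z 0 i) * (x k * (x l)^*)).
    move=> Kz x.
    have -> : \sum_k \sum_l (al0 k l + \sum_i al i k l * z 0 i) * (x k * (x l)^*) =
      \sum_k \sum_l (al0 k l * (coord z None * (x k * (x l)^*)) +
        \sum_i al i k l * (coord z (Some i) * (x k * (x l)^*))).
      apply: eq_bigr => k _; apply: eq_bigr => l _.
      rewrite /coord mul1r mulrDl mulr_suml; congr (_ + _).
      by apply: eq_bigr => i _; rewrite -mulrA.
    rewrite (alsum (fun o k l => coord z o * (x k * (x l)^*))) /=.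
    pose s : R := \sum_k (re (x k) ^+ 2 + im (x k) ^+ 2).
    have -> : \sum_k 1 * (x k * (x k)^*) = rc s.
      by rewrite raddf_sum; apply: eq_bigr => k _; rewrite mul1r mul_conj.
    have s0 : 0 <= s by apply: sumr_ge0 => k _; rewrite addr_ge0 ?sqr_ge0.
    have [sz|sz] := eqVneq s 0.
      have xz k : x k = 0.
        move/eqP: sz; rewrite psumr_eq0 => [/allP/(_ k)|i _]; last by rewrite addr_ge0 ?sqr_ge0.
        rewrite mem_index_enum paddr_eq0 ?sqr_ge0 // !sqrf_eq0 => /(_ isT)/andP[/eqP r0 /eqP i0].
        exact: cplxP.
      rewrite sz rc0 mulr0 big1 ?subr0 ?re0 // => k _; rewrite big1 // => l _.
      by rewrite big1 // => o _; rewrite xz mul0r !mulr0.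
    have sp : 0 < s by rewrite lt_def sz.
    have s2 : (Num.sqrt s)^-1 ^+ 2 = s^-1 by rewrite exprVn sqr_sqrtr.
    (* The conjugation compensates the exchange of [k] and [l]. *)
    pose x' : 'rV[C]_n := \row_k (rc (Num.sqrt s)^-1 * (x k)^*).
    have x'1 : unit_sphere x'.
      rewrite /unit_sphere /= -[RHS](mulVf sz) mulr_sumr; apply: eq_bigr => k _.
      by rewrite mxE re_rcM im_rcM re_conj im_conj !exprMn s2 sqrrN mulrDr.
    have := below z x' Kz x'1.
    rewrite (wP (fun o k l => coord z o * (x' 0 k * (x' 0 l)^*))) -/gam.
    have -> : \sum_k \sum_l \sum_o w o k l * (coord z o * (x' 0 k * (x' 0 l)^*)) =
      rc s^-1 * \sum_k \sum_l \sum_o w o k l * (coord z o * (x l * (x k)^*)).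
      rewrite mulr_sumr; apply: eq_bigr => k _; rewrite mulr_sumr; apply: eq_bigr => l _.
      rewrite mulr_sumr; apply: eq_bigr => o _; rewrite !mxE rmorphM /= conj_rc conjCK.
      rewrite -s2 expr2 rcM; ring.
    rewrite re_rcM reB re_rcM re_rc mulrC ler_pdivrMr // subr_ge0 //.
  pose xi (k : 'I_n) : L := V (delta_mx k 0).
  have xixi k l : inner (xi k) (xi l) = P None l k.
    by rewrite VV cinner_delta !mxE eqxx andbT.
  have Nxi i k l : inner (N i (xi k)) (xi l) = P (Some i) l k.
    rewrite inner_conj VW -XW.
    have -> (u v : 'cV[C]_n) : (cinner u v)^* = cinner v u.
      rewrite /cinner rmorph_sum; apply: eq_bigr => j _.
      by rewrite rmorphM /= conjCK mulrC.
    by rewrite cinner_delta -colE mxE.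
  have := normal_mx_ge0 Nn NK alK xi.
  have -> : \sum_k \sum_l inner (al0 k l *: xi k + \sum_i al i k l *: N i (xi k)) (xi l) =
      \sum_k \sum_l (al0 k l * P None l k + \sum_i al i k l * P (Some i) l k).
    apply: eq_bigr => k _; apply: eq_bigr => l _.
    rewrite (formDl (inner_psd L)) (formZl (inner_psd L)) xixi (form_suml (inner_psd L)).
    by congr (_ + _); apply: eq_bigr => i _; rewrite (formZl (inner_psd L)) Nxi.
  rewrite (alsum (fun o k l => P o l k)) /=.
  have -> : \sum_k (1%:M : 'M[C]_n) k k = rc n%:R.
    by under eq_bigr do rewrite mxE eqxx; rewrite sumr_const card_ord rc_nat.
  rewrite reB re_rcM re_rc /gam.
  rewrite (wP (fun o k l => rc n%:R^-1 * P o k l)).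
  pose S := \sum_k \sum_l \sum_o w o k l * P o k l; rewrite -/S.
  have -> : \sum_k \sum_l \sum_o w o k l * (rc n%:R^-1 * P o k l) = rc n%:R^-1 * S.
    rewrite mulr_sumr; apply: eq_bigr => k _; rewrite mulr_sumr; apply: eq_bigr => l _.
    by rewrite mulr_sumr; apply: eq_bigr => o _; rewrite mulrCA.
  (* The terms in [S] cancel, leaving [0 <= - e * n]. *)
  rewrite re_rcM mulrBl mulrAC mulVf // mul1r => h.
  have : 0 < e * n%:R by rewrite mulr_gt0 // ltr0n.
  lra.
pose B j : 'M[C]_n := \matrix_(k, l) (rc (n%:R * t j) * ((y j).2 0 k * ((y j).2 0 l)^*)).
have PB o k l : P o k l = \sum_j coord (y j).1 o * B j k l.
  have : rc n%:R^-1 * P o k l =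
      \sum_j rc (t j) * (coord (y j).1 o * ((y j).2 0 k * ((y j).2 0 l)^*)).
    apply: cplxP.
      have := py (o, (k, l), false); rewrite /p /phi /part /= => ->.
      by rewrite raddf_sum; apply: eq_bigr => j _; rewrite /= re_rcM.
    have := py (o, (k, l), true); rewrite /p /phi /part /= => ->.
    by rewrite raddf_sum; apply: eq_bigr => j _; rewrite /= im_rcM.
  move=> /(congr1 (fun c => rc n%:R * c)).
  rewrite mulrA -rcM divff // rc1 mul1r => ->; rewrite mulr_sumr.
  by apply: eq_bigr => j _; rewrite mxE rcM; ring.
exists m, (fun j => (y j).1), B; split.
- by move=> j; have [] := Yy j.
- by move=> j; apply: rank_one_psd; rewrite mulr_ge0.
- apply/matrixP => k l; rewrite summxE; have /= -> := PB None k l.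
  by apply: eq_bigr => j _; rewrite mul1r.
- move=> i; apply/matrixP => k l; rewrite summxE; have /= -> := PB (Some i) k l.
  by apply: eq_bigr => j _; rewrite [RHS]mxE.
Qed.
End WminDecomposition.

(** * Extreme points *)

Section ExtremePoints.
Variables (R : realType) (d : nat).
Local Notation C := (Cplx R).
Local Notation Cd := 'rV[C]_d.
Implicit Types (K F : set Cd) (x y z : Cd) (t : R).

Definition mix t x y : Cd := rc (1 - t) *: x + rc t *: y.
Definition face F K := F `<=` K /\ forall x y t, K x -> K y -> 0 < t < 1 ->
  F (mix t x y) -> F x /\ F y.
Definition extreme K z := K z /\ forall x y t, K x -> K y -> 0 < t < 1 ->
  z = mix t x y -> x = z /\ y = z.

Lemma convex_mix K x y t : convex_set K -> K x -> K y -> 0 <= t <= 1 -> K (mix t x y).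
Proof.
move=> cK Kx Ky /andP[t0 t1].
have r0 : 0 <= rc (1 - t) by rewrite rc_ge0 subr_ge0.
have r1 : rc (1 - t) <= 1 by rewrite -rc1 rc_le lerBlDr lerDl.
have := cK x y (Itv01 r0 r1); rewrite !inE => /(_ Kx Ky).
have e : 1 - rc (1 - t) = rc t by rewrite -rc1 -raddfB /=; congr rc; ring.
by rewrite /mix -[rc t]e.
Qed.

Lemma convex_comb K m (t : 'I_m -> R) (y : 'I_m -> Cd) : convex_set K ->
  (forall i, 0 <= t i) -> (forall i, K (y i)) -> 0 < \sum_i t i ->
  K (rc (\sum_i t i)^-1 *: \sum_i rc (t i) *: y i).
Proof.
move=> cK; elim: m t y => [|m IH] t y t0 Ky; first by rewrite big_ord0 ltxx.
rewrite !big_ord_recr /=; set s := \sum_i _; set p := \sum_i _ => sp.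
have s0 : 0 <= s by apply: sumr_ge0.
have [sz|sz] := eqVneq s 0.
  have tz i : t (widen_ord (leqnSn m) i) = 0.
    move/eqP: sz; rewrite psumr_eq0 // => /allP/(_ i).
    by rewrite mem_index_enum => /(_ isT)/eqP.
  rewrite sz add0r in sp *; rewrite /p big1 => [|i _]; last by rewrite tz scale0r.
  by rewrite add0r scalerA -rcM mulVf ?gt_eqF // rc1 scale1r.
have {}sz : 0 < s by rewrite lt_def sz.
have := IH (fun i => t (widen_ord (leqnSn m) i)) (fun i => y (widen_ord (leqnSn m) i))
  (fun i => t0 _) (fun i => Ky _) sz.
rewrite -/s -/p => Kp.
have := @convex_mix K _ (y ord_max) (t ord_max / (s + t ord_max)) cK Kp (Ky _).
suff -> : mix (t ord_max / (s + t ord_max)) (rc s^-1 *: p) (y ord_max) =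
    rc (s + t ord_max)^-1 *: (p + rc (t ord_max) *: y ord_max).
  apply; rewrite divr_ge0 ?(ltW sp) //= ler_pdivrMr // mul1r lerDr //.
have e1 : (1 - t ord_max / (s + t ord_max)) * s^-1 = (s + t ord_max)^-1.
  by field; rewrite ?gt_eqF.
by rewrite /mix scalerDr !scalerA -(rcM _ s^-1) e1 -rcM [t ord_max / _]mulrC.
Qed.

(** All terms but the [j]-th merge into one point of [K], which reduces to the two-point
    definition. *)
Lemma extreme_comb K z m (t : 'I_m -> R) (y : 'I_m -> Cd) : convex_set K ->
  extreme K z -> (forall i, 0 <= t i) -> \sum_i t i = 1 -> (forall i, K (y i)) ->
  z = \sum_i rc (t i) *: y i -> forall j, t j != 0 -> y j = z.
Proof.
move=> cK [Kz ez] t0 t1 Ky zE j tj0.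
have tj : 0 < t j by rewrite lt_def tj0 t0.
pose t' i := if i == j then 0 else t i.
have t'0 i : 0 <= t' i by rewrite /t'; case: ifP.
have t's : \sum_i t' i = 1 - t j.
  rewrite -t1 (bigD1 j) //= [in RHS](bigD1 j) //= /t' eqxx add0r addrC addrK.
  by apply: eq_bigr => i /negbTE ->.
have zE' : z = \sum_i rc (t' i) *: y i + rc (t j) *: y j.
  rewrite zE (bigD1 j) //= [in RHS](bigD1 j) //= /t' eqxx scale0r add0r addrC.
  by congr (_ + _); apply: eq_bigr => i /negbTE ->.
have [t1'|t1'] := eqVneq (t j) 1.
  rewrite zE' t1' scale1r big1 ?add0r // => i _.
  have /eqP := t's; rewrite t1' subrr psumr_eq0 // => /allP/(_ i).
  by rewrite mem_index_enum => /(_ isT)/eqP ->; rewrite scale0r.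
have tj1 : t j < 1.
  by rewrite lt_neqAle t1' -t1 (bigD1 j) //= lerDl sumr_ge0.
have s'0 : 0 < \sum_i t' i by rewrite t's subr_gt0.
have Kp := convex_comb cK t'0 Ky s'0.
have [] // := ez _ _ (t j) Kp (Ky j); first by rewrite tj tj1.
rewrite {1}zE' /mix scalerA -rcM t's divff ?rc1 ?scale1r //.
by rewrite subr_eq0 eq_sym.
Qed.

Definition real_affine (f : Cd -> R) :=
  continuous f /\ forall t x y, f (mix t x y) = (1 - t) * f x + t * f y.

Lemma max_face K f : compact K -> K !=set0 -> real_affine f -> exists F,
  [/\ face F K, compact F, F !=set0 & forall z x, F z -> K x -> f x <= f z].
Proof.
move=> cK K0 [cf af].
have [z0] := compact_EVT_max K0 cK (continuous_subspaceT cf).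
rewrite inE => Kz0 zmax.
have fle x : K x -> f x <= f z0 by move=> Kx; apply: zmax; rewrite inE.
exists (K `&` f @^-1` [set r | r = f z0]); split.
- split=> [x []//|x y t Kx Ky /andP[t0 t1] [_ /=]]; rewrite af => e.
  have := fle _ Kx; have := fle _ Ky => yl xl.
  have s0 : 0 < 1 - t by lra.
  have h1 : t * f y <= t * f z0 by rewrite ler_pM2l.
  have h2 : (1 - t) * f x <= (1 - t) * f z0 by rewrite ler_pM2l.
  have fx : f x = f z0.
    by apply/eqP; rewrite eq_le xl -(ler_pM2l s0) andTb; lra.
  have fy : f y = f z0.
    by apply/eqP; rewrite eq_le yl -(ler_pM2l t0) andTb; lra.
  by [].
- apply: compact_closedI => //; apply: preimage_closed; first by move=> x _; exact: cf.
  exact: closed_eq.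
- by exists z0.
- by move=> z x [_ /= ->] /fle.
Qed.

(** Maximizing first [f] and then each of the [2 d] real coordinates cuts out nested faces, the last
    of which is a single point. *)
Lemma krein_milman K f : compact K -> K !=set0 -> real_affine f ->
  exists2 z, extreme K z & forall x, K x -> f x <= f z.
Proof.
move=> cK K0 af.
have [F0 [F0K cF0 F00 F0max]] := max_face cK K0 af.
pose g (ib : 'I_d * bool) (z : Cd) : R := if ib.2 then im (z 0 ib.1) else re (z 0 ib.1).
have gaff ib : real_affine (g ib).
  split.
    rewrite /g; case: ib.2 => x.
      have := @continuous_comp _ _ _ (fun z : Cd => z 0 ib.1) (@im R) x.
      by apply; [exact: entry_continuous | exact: im_continuous].
    have := @continuous_comp _ _ _ (fun z : Cd => z 0 ib.1) (@re R) x.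
    by apply; [exact: entry_continuous | exact: re_continuous].
  move=> t x y; rewrite /g /mix; case: ib.2; rewrite !mxE.
    by rewrite imD !im_rcM.
  by rewrite reD !re_rcM.
have [F [FK cF [z Fz] Fc]] : exists F, [/\ face F K, compact F, F !=set0 &
    F `<=` F0 /\ forall ib, ib \in enum {: 'I_d * bool} -> forall x y, F x -> F y -> g ib x = g ib y].
  elim: (enum _) => [|ib s [F [FK cF Fn [FF0 Fc]]]]; first by exists F0; split=> //; split=> // ib; rewrite in_nil.
  have [F' [[F'F fF'] cF' F'n F'max]] := max_face cF Fn (gaff ib).
  exists F'; split=> //.
    split=> [x /F'F /FK.1 //|x y t Kx Ky t01 F'm].
    have [Fx Fy] := FK.2 _ _ _ Kx Ky t01 (F'F _ F'm).
    exact: fF' t01 F'm.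
  split=> [x /F'F /FF0 //|ib']; rewrite inE => /orP[/eqP -> x y F'x F'y|ibs x y /F'F Fx /F'F Fy].
    by apply/eqP; rewrite eq_le !F'max //; exact: F'F.
  exact: Fc.
have Fz1 x : F x -> x = z.
  move=> Fx; apply/rowP => i; apply: cplxP.
    by have := Fc.2 (i, false); rewrite mem_enum => /(_ isT _ _ Fx Fz).
  by have := Fc.2 (i, true); rewrite mem_enum => /(_ isT _ _ Fx Fz).
exists z; last by move=> x; apply: F0max; exact: Fc.1.
split; first exact: FK.1.
move=> x y t Kx Ky t01 zE; have [|Fx Fy] := FK.2 x y t Kx Ky t01; first by rewrite -zE.
by split; exact: Fz1.
Qed.

Lemma closure_extreme K : compact K -> closure (extreme K) `<=` K /\
  compact (closure (extreme K)).
Proof.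
move=> cK.
have clK : closed K by apply: compact_closed => //; exact: norm_hausdorff.
have sub : closure (extreme K) `<=` K.
  by move=> z /(closure_subset (fun x => @proj1 _ _)) ; rewrite -(closure_id K).1.
by split=> //; apply: subclosed_compact cK sub; exact: closed_closure.
Qed.

(** The closure is taken for the compactness that [in_convex_hull_fin] asks for: extreme points need
    not form a closed set. *)
Lemma extreme_hull K z : compact K -> K z ->
  exists (m : nat) (t : 'I_m -> R) (y : 'I_m -> Cd),
    [/\ forall i, 0 <= t i, \sum_i t i = 1, forall i, closure (extreme K) (y i) &
        z = \sum_i rc (t i) *: y i].
Proof.
move=> cK Kz.
pose phi (y : Cd) (ib : 'I_d * bool) : R := if ib.2 then im (y 0 ib.1) else re (y 0 ib.1).
have cphi ib : continuous (phi^~ ib).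
  rewrite /phi; case: ib.2 => x.
    have := @continuous_comp _ _ _ (fun z : Cd => z 0 ib.1) (@im R) x.
    by apply; [exact: entry_continuous | exact: im_continuous].
  have := @continuous_comp _ _ _ (fun z : Cd => z 0 ib.1) (@re R) x.
  by apply; [exact: entry_continuous | exact: re_continuous].
have [a e e0|m [t [y [t0 t1 Yy zy]]]] :=
    in_convex_hull_fin (p := phi z) (closure_extreme cK).2 cphi.
  pose f y := \sum_ib a ib * phi y ib.
  have af : real_affine f.
    split; first by apply: sum_continuous => ib x; exact: (@cvgM R _ _ _ _ _ _ _ (cvg_cst _) (cphi ib x)).
    move=> t x y; rewrite /f !mulr_sumr -big_split; apply: eq_bigr => ib _ /=.
    rewrite /phi /mix; case: ib.2; rewrite !mxE ?imD ?reD ?im_rcM ?re_rcM; ring.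
  have [y ey ymax] := krein_milman cK (ex_intro _ z Kz) af.
  exists y; first exact: subset_closure.
  have := ymax _ Kz; rewrite /f => zy.
  by under eq_bigr do rewrite mulrBr; rewrite sumrB; lra.
exists m, t, y; split=> //; apply/rowP => i; rewrite summxE; apply: cplxP.
  rewrite raddf_sum; have := zy (i, false); rewrite /phi /= => ->.
  by apply: eq_bigr => j _; rewrite !mxE re_rcM.
rewrite raddf_sum; have := zy (i, true); rewrite /phi /= => ->.
by apply: eq_bigr => j _; rewrite !mxE im_rcM.
Qed.
End ExtremePoints.

(** * Adjoints and states *)

Section Riesz.
Variables (R : realType) (H : hilbertType R).
Local Notation C := (Cplx R).
Let P := inner_psd H.

(** The vector [u] minimizes [n2 x - 2 re (f x)], which makes it represent [re f]; the imaginary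
    part follows by testing at [i x]. *)
Lemma riesz (f : H -> C) (c : R) : scalar f -> 0 <= c ->
  (forall x, re (f x) ^+ 2 + im (f x) ^+ 2 <= c * n2 x) ->
  exists u, forall x, f x = inner x u.
Proof.
move=> lf c0 fc.
have f0 : f 0 = 0 by have := lf (-1) 0 0; rewrite scaler0 addr0 mulN1r addNr.
have fD x y : f (x + y) = f x + f y by have := lf 1 x y; rewrite scale1r mul1r.
have fZ a x : f (a *: x) = a * f x by have := lf a x 0; rewrite f0 !addr0.
have fB x a y : f (x - a *: y) = f x - a * f y by rewrite -scaleNr fD fZ mulNr.
pose g x : R := n2 x - 2 * re (f x).
have glb x : - c <= g x.
  have := fc x; have := n2_ge0 x; have := sqr_ge0 (im (f x)); rewrite /g.
  set n := n2 x; set r := re (f x) => i0 n0 h.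
  have : (2 * r) ^+ 2 <= (n + c) ^+ 2 by have := sqr_ge0 (n - c); rewrite !expr2 in h *; lra.
  have nc : 0 <= n + c by rewrite addr_ge0.
  move=> h2; rewrite leNgt; apply/negP => h3.
  have h4 : n + c < 2 * r by lra.
  by move: h2; rewrite !expr2; nra.
pose G := [set g x | x in [set: H]].
have Ginf : has_inf G by split; [exists (g 0), 0 | exists (- c) => _ [x _ <-]].
pose m := inf G.
have mle x : m <= g x by apply: ge_inf; [exact: Ginf.2 | exists x].
pose Z e : set H := [set x | g x < m + e].
(* Parallelogram identity: vectors close to the infimum are close to each other. *)
have mid x y : n2 (x - y) <= 2 * g x + 2 * g y - 4 * m.
  have := mle (rc 2^-1 *: (x + y)).
  have := nq_parallel P x y; rewrite -!/(n2 _) /g n2Zr fZ re_rcM fD reD expr2; lra.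
have [e e0|e e' e0 ee' x|dl d0|u uP] := @complete_n2 R H Z.
- have [_ [x _ <-] xm] := inf_adherent e0 Ginf; exists x; exact: xm.
- by rewrite /Z /= => h; apply: lt_le_trans h _; rewrite lerD2l.
- exists (dl / 4); first by rewrite divr_gt0.
  by move=> x y; rewrite /Z /= => xm ym; have := mid x y; lra.
have key h : re (f h) = re (inner h u).
  have [->|h0] := eqVneq h 0; first by rewrite f0 (form0l P).
  have nh : 0 < n2 h by rewrite lt_def n2_ge0 andbT; apply: contra_neq h0 => /n2_eq0.
  pose D := re (inner h u) - re (f h).
  apply/eqP; rewrite eq_sym -subr_eq0 -/D -sqrf_eq0; apply/eqP/le_anti.
  rewrite sqr_ge0 andbT leNgt; apply/negP => Dp.
  (* Then [k ^ 2] and [(D - k) ^ 2] are both at most [D ^ 2 / 8], while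
     [D ^ 2 <= 2 k ^ 2 + 2 (D - k) ^ 2]. *)
  pose e := D ^+ 2 / (8 * n2 h).
  have e0 : 0 < e by rewrite divr_gt0 // mulr_gt0.
  have [x xe xu] := uP e e e0 e0.
  pose k := re (inner h x) - re (f h).
  have kle : k ^+ 2 <= e * n2 h.
    have := mle (x - rc (k / n2 h) *: h); rewrite /Z /= in xe.
    rewrite {1}/g /n2 (nqB P) -!/(n2 _) n2Zr (formZr P) conj_rc re_rcM.
    rewrite (re_formC P h x) fB reB re_rcM => mg.
    have : (k / n2 h) ^+ 2 * n2 h = k ^+ 2 / n2 h by field; rewrite gt_eqF.
    have e1 : k / n2 h * re (inner h x) - k / n2 h * re (f h) = k ^+ 2 / n2 h.
      by rewrite -mulrBr -/k; field; rewrite gt_eqF.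
    rewrite /g in xe => e2; rewrite e2 in mg.
    have : k ^+ 2 / n2 h <= e by lra.
    by rewrite ler_pdivrMr.
  have Dk : D - k = re (inner h (u - x)) by rewrite /D /k (formBr P) reB; ring.
  have : (D - k) ^+ 2 <= n2 h * e.
    rewrite Dk; have := form_cauchy P h (u - x); rewrite -!/(n2 _).
    have := sqr_ge0 (im (inner h (u - x))); rewrite n2BC in xu.
    have : n2 h * n2 (u - x) <= n2 h * e by rewrite ler_wpM2l ?n2_ge0 // ltW // n2BC n2BC.
    lra.
  have en : e * n2 h = D ^+ 2 / 8 by rewrite /e; field; rewrite gt_eqF.
  have := sqr_ge0 (D - 2 * k); rewrite [n2 h * e]mulrC en in kle *.
  move: kle Dp; rewrite !expr2; nra.
exists u => x; apply: cplxP => //.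
have := key (ci *: x); rewrite fZ (formZl P) !reM re_ci im_ci; lra.
Qed.
End Riesz.

Section Operators.
Variable R : realType.
Local Notation C := (Cplx R).

Lemma adjoint_exists (H L : hilbertType R) (A : bop H L) : exists B, adjoint A B.
Proof.
have [c c0 Ac] := bop_bounded A.
have /choice[B AB] : forall y, exists u, forall x, inner (A x) y = inner x u.
  move=> y; apply: (riesz (c := c * n2 y)).
  - by move=> a x x'; rewrite bopD bopZ (formDl (inner_psd L)) (formZl (inner_psd L)).
  - by rewrite mulr_ge0 // n2_ge0.
  move=> x; apply: le_trans (form_cauchy (inner_psd L) _ _) _; rewrite -!/(n2 _).
  by rewrite mulrAC ler_wpM2r ?n2_ge0.
have lB : linear B.
  move=> a y y'; apply/eqP; rewrite -subr_eq0; apply/eqP/n2_eq0.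
  set w := _ - _; rewrite /n2 /nq {2}/w (formBr (inner_psd H)) (formDr (inner_psd H)).
  rewrite (formZr (inner_psd H)) -!AB (formDr (inner_psd L)) (formZr (inner_psd L)).
  by rewrite subrr re0.
have Bc y : n2 (B y) <= c * n2 y.
  have e : inner (B y) (B y) = inner (A (B y)) y by rewrite AB.
  have [z|z] := eqVneq (n2 (B y)) 0; first by rewrite z mulr_ge0 // n2_ge0.
  have zp : 0 < n2 (B y) by rewrite lt_def z n2_ge0.
  have := form_cauchy (inner_psd L) (A (B y)) y; rewrite -e n2E re_rc im_rc -!/(n2 _).
  rewrite expr0n addr0 expr2 => h.
  have : n2 (A (B y)) * n2 y <= c * n2 (B y) * n2 y by rewrite ler_wpM2r ?n2_ge0.
  by move=> h2; rewrite -(ler_pM2l zp) mulrCA mulrA; exact: le_trans h h2.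
have [B' B'B] := linear_bounded_bop lB Bc.
by exists B' => x y; rewrite B'B AB.
Qed.

Definition adj (H L : hilbertType R) (A : bop H L) : bop L H :=
  projT1 (cid (adjoint_exists A)).
Lemma adjP (H L : hilbertType R) (A : bop H L) x y : inner (A x) y = inner x (adj A y).
Proof. exact: (projT2 (cid (adjoint_exists A))). Qed.
Lemma adjP' (H L : hilbertType R) (A : bop H L) x y : inner (adj A x) y = inner x (A y).
Proof. by rewrite inner_conj -adjP -inner_conj. Qed.

Lemma inner_inj (H : hilbertType R) (x y : H) : (forall z, inner z x = inner z y) -> x = y.
Proof.
move=> xy; apply/eqP; rewrite -subr_eq0; apply/eqP/n2_eq0.
by rewrite /n2 /nq {1}[x - y]lock (formBr (inner_psd H)) xy subrr re0.
Qed.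

Lemma bcomp_subproof (H L M : hilbertType R) (A : bop L M) (B : bop H L) :
  A \o B \in bop_pred (H := H) (L := M).
Proof.
apply/asboolP; split=> [c x y|x]; first by rewrite /= bopD bopZ bopD bopZ.
have /asboolP[_ cA] := bop_funP A; have /asboolP[_ cB] := bop_funP B.
by apply: continuous_comp; [exact: cB | exact: cA].
Qed.
Definition bcomp (H L M : hilbertType R) (A : bop L M) (B : bop H L) : bop H M :=
  Bop (bcomp_subproof A B).

Lemma rank_one_exists (H : hilbertType R) (h k : H) :
  {A : bop H H | forall x, A x = inner x k *: h}.
Proof.
apply: (linear_bounded_bop (c := n2 k * n2 h)) => [c x y|x].
  by rewrite (formDl (inner_psd H)) (formZl (inner_psd H)) scalerDl scalerA.
rewrite n2Z mulrAC ler_wpM2r ?n2_ge0 //.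
by have := form_cauchy (inner_psd H) x k; rewrite -!/(n2 _) [n2 k * _]mulrC.
Qed.
Definition rank_one (H : hilbertType R) (h k : H) : bop H H :=
  projT1 (rank_one_exists h k).
Lemma rank_oneE (H : hilbertType R) (h k x : H) : rank_one h k x = inner x k *: h.
Proof. exact: (projT2 (rank_one_exists h k)). Qed.

Lemma adj_comp (H L M : hilbertType R) (A : bop L M) (B : bop H L) :
  adj (bcomp A B) = bcomp (adj B) (adj A).
Proof. by apply: bopE => x; apply: inner_inj => z; rewrite -adjP /= !adjP. Qed.
Lemma adjK (H L : hilbertType R) (A : bop H L) : adj (adj A) = A.
Proof. by apply: bopE => x; apply: inner_inj => z; rewrite -adjP adjP'. Qed.
Lemma adj_linear (H L : hilbertType R) c (A B : bop H L) :
  adj (c *: A + B) = c^* *: adj A + adj B.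
Proof.
apply: bopE => x; apply: inner_inj => z; rewrite -adjP !add_bopE !scale_bopE.
rewrite (formDr (inner_psd H)) (formZr (inner_psd H)) conjCK.
by rewrite (formDl (inner_psd L)) (formZl (inner_psd L)) !adjP.
Qed.
Lemma adjZ (H L : hilbertType R) c (A : bop H L) : adj (c *: A) = c^* *: adj A.
Proof.
apply: bopE => x; apply: inner_inj => z; rewrite -adjP !scale_bopE.
by rewrite (formZr (inner_psd H)) conjCK (formZl (inner_psd L)) adjP.
Qed.
Lemma adj_id (H : hilbertType R) : adj (bop_id H) = bop_id H.
Proof. by apply: bopE => x; apply: inner_inj => z; rewrite -adjP. Qed.
Lemma adj_rank_one (H : hilbertType R) (h k : H) : adj (rank_one h k) = rank_one k h.
Proof.
apply: bopE => x; apply: inner_inj => z; rewrite -adjP !rank_oneE.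
by rewrite (formZl (inner_psd H)) (formZr (inner_psd H)) -inner_conj mulrC.
Qed.
End Operators.

(** * States, GNS forms and UCP maps *)

Section States.
Variables (R : realType) (H : hilbertType R).
Local Notation C := (Cplx R).
Let P := inner_psd H.

Definition pos_op (A : bop H H) := forall x, 0 <= inner (A x) x.

Record state (phi : bop H H -> C) : Prop := State {
  state_linear : scalar phi ;
  state_ge0 : forall A, pos_op A -> 0 <= phi A ;
  state_id : phi (bop_id H) = 1 }.

Lemma functional0 (f : bop H H -> C) : scalar f -> f 0 = 0.
Proof. by move=> lf; have := lf (-1) 0 0; rewrite scaler0 addr0 mulN1r addNr. Qed.
Lemma functionalD (f : bop H H -> C) A B : scalar f -> f (A + B) = f A + f B.
Proof. by move=> lf; have := lf 1 A B; rewrite scale1r mul1r. Qed.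
Lemma functionalZ (f : bop H H -> C) c A : scalar f -> f (c *: A) = c * f A.
Proof. by move=> lf; have := lf c A 0; rewrite (functional0 lf) !addr0. Qed.
Lemma functional_sum (f : bop H H -> C) I (r : seq I) (F : I -> bop H H) : scalar f ->
  f (\sum_(i <- r) F i) = \sum_(i <- r) f (F i).
Proof.
by move=> lf; apply: big_morph => [A B|]; [exact: functionalD | exact: functional0].
Qed.

Lemma vector_state (v : H) : n2 v = 1 -> state (fun A => inner (A v) v).
Proof.
move=> v1; split=> [c A B|A Ap|]; first by rewrite (formDl P) (formZl P).
  exact: Ap.
by rewrite n2E v1 rc1.
Qed.

Lemma psd_mx_form n (B : 'M[C]_n) : psd_mx B ->
  psd_form (fun x y : 'cV[C]_n => cinner (B *m x) y).
Proof.
move=> Bp; apply: psd_formP => [z c x y|c x y z|x]; last exact: Bp.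
  rewrite /cinner mulr_sumr -big_split; apply: eq_bigr => k _.
  by rewrite mulmxDr -scalemxAr !mxE /= mulrDl mulrA.
rewrite /cinner mulr_sumr -big_split; apply: eq_bigr => k _ /=.
by rewrite !mxE rmorphD rmorphM /= mulrDr mulrCA.
Qed.

(** Complete positivity: on a positive block each state gives a positive scalar matrix, which
    [schur_product] pairs with the Gram matrix of vectors for the form [B l]. *)
Lemma ucp_of_states m n (phi : 'I_m -> bop H H -> C) (B : 'I_m -> 'M[C]_n) :
  (forall j, state (phi j)) -> (forall j, psd_mx (B j)) -> \sum_j B j = 1%:M ->
  exists psi : {linear bop H H -> 'M[C]_n},
    ucp psi /\ forall A, psi A = \sum_j phi j A *: B j.
Proof.
move=> sphi Bp B1; pose f A := \sum_j phi j A *: B j.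
have lf : linear f.
  move=> c A A'; rewrite /f scaler_sumr -big_split; apply: eq_bigr => j _ /=.
  by rewrite (state_linear (sphi j)) scalerDl scalerA.
pose psi : {linear bop H H -> 'M[C]_n} :=
  HB.pack f (GRing.isLinear.Build C (bop H H) 'M[C]_n _ f lf).
exists psi; split=> //; split.
  by rewrite /psi /= /f -B1; apply: eq_bigr => j _; rewrite (state_id (sphi j)) scale1r.
move=> k A Ap x; rewrite /psi /= /f.
have -> : \sum_i \sum_j cinner ((\sum_l phi l (A i j) *: B l) *m x j) (x i) =
    \sum_l \sum_j \sum_i phi l (A i j) * cinner (B l *m x j) (x i).
  rewrite [RHS]exchange_big [LHS]exchange_big; apply: eq_bigr => j _ /=.
  rewrite [RHS]exchange_big; apply: eq_bigr => i _ /=.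
  rewrite mulmx_suml /cinner; under [RHS]eq_bigr do rewrite mulr_sumr.
  rewrite exchange_big; apply: eq_bigr => a _ /=; rewrite summxE mulr_suml.
  by apply: eq_bigr => l _; rewrite -scalemxAl mxE mulrA.
apply: sumr_ge0 => l _.
apply: (@schur_product R (fun z => 0 <= z) k (fun j i => phi l (A i j)) _
  (fun x y => cinner (B l *m x) y)) => //; last exact: psd_mx_form.
  by move=> a b; exact: addr_ge0.
move=> y.
have -> : \sum_j \sum_i phi l (A i j) * (y j * (y i)^*) =
    phi l (\sum_j \sum_i (y j * (y i)^*) *: A i j).
  rewrite functional_sum; last exact: state_linear.
  apply: eq_bigr => j _; rewrite functional_sum; last exact: state_linear.
  by apply: eq_bigr => i _; rewrite (functionalZ _ _ (state_linear (sphi l))) mulrC.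
apply: (state_ge0 (sphi l)) => v; have := Ap (fun i => y i *: v).
rewrite sum_bopE (form_suml P) exchange_big /=; congr (_ <= _).
apply: eq_bigr => j _; rewrite sum_bopE (form_suml P); apply: eq_bigr => i _.
by rewrite scale_bopE bopZ !(formZl P) (formZr P) mulrA.
Qed.

Lemma range_of_states d m n (S : optuple d H) (phi : 'I_m -> bop H H -> C)
    (B : 'I_m -> 'M[C]_n.+1) (X : 'I_d -> 'M[C]_n.+1) :
  (forall j, state (phi j)) -> (forall j, psd_mx (B j)) -> \sum_j B j = 1%:M ->
  (forall i, X i = \sum_j phi j (S i) *: B j) ->
  matrix_range S (existT _ n X : mxtuple R d).
Proof.
move=> sphi Bp B1 XE; have [psi [upsi psiE]] := ucp_of_states sphi Bp B1.
by exists psi => //= i; rewrite psiE XE.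
Qed.

Lemma state_of_ucp (psi : {linear bop H H -> 'M[C]_1}) : ucp psi ->
  state (fun A => psi A 0 0).
Proof.
move=> [psi1 cp]; split=> [c A B|A Ap|]; first by rewrite linearP !mxE.
  have := cp 1%N (fun _ _ => A) _ (fun _ => 1%:M); rewrite !big_ord1 /cinner big_ord1 mulmx1.
  rewrite mxE eqxx rmorph1 mulr1; apply=> x; rewrite !big_ord1; exact: Ap.
by rewrite psi1 mxE eqxx.
Qed.

(** Compression of the GNS representation of [phi] to the span of the [y p], written without
    building the GNS space; the hypothesis is orthonormality there. *)
Lemma ucp_of_state n (phi : bop H H -> C) (y : 'I_n -> bop H H) : state phi ->
  (forall p q, phi (bcomp (adj (y p)) (y q)) = (p == q)%:R) ->
  exists psi : {linear bop H H -> 'M[C]_n}, ucp psi /\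
    forall A p q, psi A p q = phi (bcomp (adj (y p)) (bcomp A (y q))).
Proof.
move=> sphi y1; have lphi := state_linear sphi.
pose f A : 'M[C]_n := \matrix_(p, q) phi (bcomp (adj (y p)) (bcomp A (y q))).
have lf : linear f.
  move=> c A A'; apply/matrixP => p q; rewrite !mxE -lphi; congr phi.
  by apply: bopE => x /=; rewrite bopD bopZ.
pose psi : {linear bop H H -> 'M[C]_n} :=
  HB.pack f (GRing.isLinear.Build C (bop H H) 'M[C]_n _ f lf).
exists psi; split; last by move=> A p q; rewrite /psi /= mxE.
split.
  apply/matrixP => p q; rewrite /psi /= !mxE -y1; congr phi.
  exact: bopE.
move=> k A Ap x; rewrite /psi /= /f.
have -> : \sum_i \sum_j cinner ((\matrix_(p, q)
      phi (bcomp (adj (y p)) (bcomp (A i j) (y q)))) *m x j) (x i) =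
    phi (\sum_i \sum_j \sum_p \sum_q (x j q 0 * (x i p 0)^*) *:
      bcomp (adj (y p)) (bcomp (A i j) (y q))).
  rewrite functional_sum //; apply: eq_bigr => i _; rewrite functional_sum //.
  apply: eq_bigr => j _; rewrite functional_sum //; apply: eq_bigr => p _.
  rewrite functional_sum // mxE mulr_suml; apply: eq_bigr => q _.
  by rewrite mxE functionalZ // -mulrA mulrC.
apply: (state_ge0 sphi) => v.
have := Ap (fun j => \sum_q x j q 0 *: y q v); congr (_ <= _).
rewrite sum_bopE (form_suml P); apply: eq_bigr => i _.
rewrite sum_bopE (form_suml P); apply: eq_bigr => j _.
rewrite sum_bopE (form_suml P) (form_sumr P); apply: eq_bigr => p _.
rewrite sum_bopE (form_suml P) bop_sum (form_suml P); apply: eq_bigr => q _.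
by rewrite scale_bopE /= bopZ !(formZl P) (formZr P) adjP' mulrA.
Qed.

Definition state_form (phi : bop H H -> C) (a b : bop H H) : C := phi (bcomp (adj b) a).

Lemma state_form_psd (phi : bop H H -> C) : state phi -> psd_form (state_form phi).
Proof.
move=> sphi; have lphi := state_linear sphi.
apply: psd_formP => [b c a a'|c b b' a|a]; rewrite /state_form.
- by rewrite -lphi; congr phi; apply: bopE => x; rewrite /= bopD bopZ.
- by rewrite -lphi; congr phi; apply: bopE => x; rewrite adj_linear.
- by apply: (state_ge0 sphi) => x /=; rewrite adjP' n2E rc_ge0 n2_ge0.
Qed.

Lemma state_adj (phi : bop H H -> C) a : state phi -> phi (adj a) = (phi a)^*.
Proof.
move=> sphi; have := form_conj (state_form_psd sphi) a (bop_id H).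
rewrite /state_form adj_id => e.
rewrite -[adj a](_ : bcomp (adj a) (bop_id H) = _) ?e; last exact: bopE.
by congr ((phi _)^*); exact: bopE.
Qed.
End States.

(** * Eigenvectors of compact tuples *)

(** The upper left entries [t j] of the [B j] are convex weights expressing [lam] by the [z j].
    Extremality gives [z j = lam] where [t j] is nonzero; where it vanishes, positivity kills row
    and column 0 of [B j]. So row and column 0 of [X i] are those of [lam_i] times the identity. *)
Lemma Wmin_corner (R : realType) d (K : set 'rV[Cplx R]_d) (X : 'I_d -> 'M[Cplx R]_2) lam :
  compact K -> convex_set K -> Wmin K (existT _ 1%N X : mxtuple R d) -> extreme K lam ->
  (forall i, X i 0 0 = lam 0 i) -> forall i, X i 0 1 = 0 /\ X i 1 0 = 0.
Proof.
move=> cK cvK WX elam Xlam i.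
have [m [z [B [Kz Bp B1 XE]]]] := Wmin_decomposition cK WX.
rewrite /= in B Bp B1 XE.
have Be j k l : cinner (B j *m delta_mx l 0) (delta_mx k 0) = B j k l.
  by rewrite cinner_delta -colE mxE.
pose t j := re (B j 0 0).
have Bt j : B j 0 0 = rc (t j).
  by rewrite /t; apply: ge0_rc; rewrite -Be; exact: Bp.
have t0 j : 0 <= t j by rewrite -rc_ge0 -Bt -Be; exact: Bp.
have B1e k l : \sum_j B j k l = (k == l)%:R.
  by have /matrixP/(_ k l) := B1; rewrite summxE mxE.
have t1 : \sum_j t j = 1 by have /(congr1 re) := B1e 0 0; rewrite raddf_sum.
have lamE : lam = \sum_j rc (t j) *: z j.
  apply/rowP => i'; rewrite -Xlam XE !summxE; apply: eq_bigr => j _.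
  by rewrite !mxE -Bt mulrC.
have zlam := extreme_comb cvK elam t0 t1 Kz lamE.
have key k l : (k == 0) || (l == 0) -> X i k l = lam 0 i * (k == l)%:R.
  move=> kl; rewrite -B1e mulr_sumr XE summxE; apply: eq_bigr => j _; rewrite mxE.
  have [tj|/zlam -> //] := eqVneq (t j) 0.
  suff -> : B j k l = 0 by rewrite !mulr0.
  have Q := psd_mx_form (Bp j).
  have q0 : nq (fun x y => cinner (B j *m x) y) (delta_mx 0 0) = 0.
    by rewrite /nq Be -/(t j).
  case/orP: kl => /eqP ->; last by rewrite -Be (form_eq0 Q).
  by rewrite -Be (form_conj Q (delta_mx 0 0)) (form_eq0 Q) // rmorph0.
by split; rewrite key // mulr0.
Qed.

Section CompactTuples.
Variables (R : realType) (d : nat) (K : set 'rV[Cplx R]_d).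
Variables (H : hilbertType R) (S : optuple d H).
Local Notation C := (Cplx R).
Hypothesis cK : compact K.
Hypothesis cvK : convex_set K.
Hypothesis SK : matrix_range S = Wmin K.
Let P := inner_psd H.

(** The pair [1, b] is orthonormal in the GNS form, so it compresses [S] to a 2x2 tuple in [Wmin K]
    with corner [lam], whose off-diagonal entries vanish by [Wmin_corner]. *)
Lemma state_extreme_orthonormal (phi : bop H H -> C) lam b : state phi -> extreme K lam ->
  (forall i, phi (S i) = lam 0 i) -> phi b = 0 -> state_form phi b b = 1 ->
  forall i, phi (bcomp (adj b) (S i)) = 0 /\ phi (bcomp (S i) b) = 0.
Proof.
move=> sphi elam philam b0 b1 i.
pose y (p : 'I_2) : bop H H := if p == 0 then bop_id H else b.
have y0 p q : phi (bcomp (adj (y p)) (y q)) = (p == q)%:R.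
  case: (p =P 0) => [->|/eqP p0]; case: (q =P 0) => [->|/eqP q0]; rewrite /y ?eqxx.
  - by rewrite adj_id -(state_id sphi); congr phi; exact: bopE.
  - rewrite (negbTE q0) eq_sym (negbTE q0) adj_id -[RHS]b0; congr phi; exact: bopE.
  - rewrite (negbTE p0); transitivity ((phi b)^*); last by rewrite b0 rmorph0.
    by rewrite -(state_adj b sphi); congr phi; exact: bopE.
  - rewrite (negbTE p0) (negbTE q0); transitivity (1 : C); first exact: b1.
    by case: p p0 => [[|[|]]] // ? _; case: q q0 => [[|[|]]].
have [psi [upsi psiE]] := ucp_of_state sphi y0.
have WX : Wmin K (existT _ 1%N (fun i => psi (S i)) : mxtuple R d).
  by rewrite -SK; exists psi.
have [|h1 h2] := Wmin_corner cK cvK WX elam _ i.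
  move=> j; rewrite psiE /y /= -philam adj_id; congr phi; exact: bopE.
split.
  by rewrite -h2 psiE /y /=; congr phi; exact: bopE.
by rewrite -h1 psiE /y /= adj_id; congr phi; exact: bopE.
Qed.

Lemma bcomp_linl (A A' B : bop H H) c : bcomp (c *: A + A') B = c *: bcomp A B + bcomp A' B.
Proof. exact: bopE. Qed.
Lemma bcomp_linr (A B B' : bop H H) c : bcomp A (c *: B + B') = c *: bcomp A B + bcomp A B'.
Proof. by apply: bopE => x; rewrite /= bopD bopZ. Qed.

(* The scaling makes phi((b - phi(b))*(b - phi(b))) equal to 1 unless it is 0, in
   which case Cauchy-Schwarz applies. *)
Lemma state_extreme_mul (phi : bop H H -> C) lam : state phi -> extreme K lam ->
  (forall i, phi (S i) = lam 0 i) -> forall i a,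
  phi (bcomp a (S i)) = phi a * lam 0 i /\ phi (bcomp (S i) a) = lam 0 i * phi a.
Proof.
move=> sphi elam philam.
have lphi := state_linear sphi.
have Q := state_form_psd sphi.
have centered b : phi b = 0 -> forall i,
    phi (bcomp (adj b) (S i)) = 0 /\ phi (bcomp (S i) b) = 0.
  move=> b0 i; pose r := nq (state_form phi) b.
  have rE : state_form phi b b = rc r by exact: form_nq.
  have [r0|r0] := eqVneq r 0.
    have q0 := form_eq0 Q _ r0; split.
      by have := q0 (S i); rewrite (form_conj Q (S i)) => /(canRL conjCK); rewrite rmorph0.
    by have := q0 (adj (S i)); rewrite /state_form adjK.
  have rp : 0 < r by rewrite lt_def r0 nq_ge0.
  pose s := (Num.sqrt r)^-1; have s0 : rc s != 0.
    by rewrite gt_eqF // -rc0 rc_lt invr_gt0 sqrtr_gt0.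
  have [||h1 h2] := state_extreme_orthonormal (b := rc s *: b) sphi elam philam _ _ i.
  - by rewrite functionalZ // b0 mulr0.
  - rewrite (formZl Q) (formZr Q) conj_rc rE -!rcM -rc1; congr rc.
    have -> : s * (s * r) = s ^+ 2 * r by ring.
    by rewrite /s exprVn sqr_sqrtr ?mulVf // ltW.
  split.
    move: h1; have -> : bcomp (adj (rc s *: b)) (S i) = rc s *: bcomp (adj b) (S i).
      by rewrite adjZ conj_rc; exact: bopE.
    by rewrite functionalZ // => /eqP; rewrite mulf_eq0 (negbTE s0) => /eqP.
  move: h2; have -> : bcomp (S i) (rc s *: b) = rc s *: bcomp (S i) b.
    by apply: bopE => x; rewrite /= bopZ.
  by rewrite functionalZ // => /eqP; rewrite mulf_eq0 (negbTE s0) => /eqP.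
move=> i a.
have part a' : phi (bcomp (S i) a') = lam 0 i * phi a' /\
    phi (bcomp (adj a') (S i)) = (phi a')^* * lam 0 i.
  pose b := (- phi a') *: bop_id H + a'.
  have b0 : phi b = 0 by rewrite lphi (state_id sphi) mulr1 addNr.
  have [h1 h2] := centered b b0 i; split.
    move: h2; rewrite bcomp_linr lphi => /eqP; rewrite addrC addr_eq0 mulNr opprK => /eqP ->.
    by rewrite mulrC -philam; congr (phi _ * _); exact: bopE.
  move: h1; rewrite adj_linear adj_id bcomp_linl lphi rmorphN => /eqP.
  rewrite addrC addr_eq0 mulNr opprK => /eqP ->.
  by rewrite -philam; congr (_ * phi _); exact: bopE.
split; last exact: (part a).1.
by have := (part (adj a)).2; rewrite adjK (state_adj _ sphi) conjCK.
Qed.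

(** The last equation says that [v] is an eigenvector of the adjoint of [S i] for the conjugate
    eigenvalue, so the line through [v] reduces the tuple. *)
Definition eigvec (lam : 'rV[C]_d) (v : H) := n2 v = 1 /\
  forall i, S i v = lam 0 i *: v /\ forall x, inner (S i x) v = lam 0 i * inner x v.

(** Multiplicativity of the vector state, tested on rank-one operators built from [v] and [x], gives
    both eigenvector equations. *)
Lemma eigvec_of_diag lam v : extreme K lam -> n2 v = 1 ->
  (forall i, inner (S i v) v = lam 0 i) -> eigvec lam v.
Proof.
move=> elam v1 vlam; split=> // i.
have mulS := state_extreme_mul (vector_state v1) elam vlam i.
have vv : inner v v = 1 by rewrite n2E v1.
split.
  apply: inner_inj => x; rewrite inner_conj [RHS]inner_conj; congr (_^*).
  have [h _] := mulS (rank_one v x); move: h; rewrite /= !rank_oneE !(formZl P) vv !mulr1.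
  by rewrite mulrC.
move=> x; have [_ h] := mulS (rank_one x v); move: h.
by rewrite /= rank_oneE vv scale1r.
Qed.

Lemma normalize (u : H) : u != 0 -> exists2 s : R, 0 < s & n2 (rc s *: u) = 1.
Proof.
move=> u0; have up : 0 < n2 u by rewrite lt_def n2_ge0 andbT; apply: contra_neq u0 => /n2_eq0.
exists (Num.sqrt (n2 u))^-1; first by rewrite invr_gt0 sqrtr_gt0.
by rewrite n2Zr exprVn sqr_sqrtr ?mulVf ?gt_eqF // ltW.
Qed.

(** If [phi] does not vanish at [rank_one w w], then [h |-> phi (rank_one h w)] is a nonzero bounded
    functional, and its Riesz vector [u] inherits both eigenvector equations from the
    multiplicativity of [phi]. *)
Lemma eigvec_or_singular (phi : bop H H -> C) lam : state phi -> extreme K lam ->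
  (forall i, phi (S i) = lam 0 i) ->
  (exists v, eigvec lam v) \/ forall w, phi (rank_one w w) = 0.
Proof.
move=> sphi elam philam; have lphi := state_linear sphi.
have mulS := state_extreme_mul sphi elam philam.
have [|/existsNP[w /eqP w0]] := pselect (forall w, phi (rank_one w w) = 0); first by right.
left; pose f h := phi (rank_one h w).
have lf : scalar f.
  move=> c x y; rewrite /f -lphi; congr phi; apply: bopE => z.
  by rewrite add_bopE scale_bopE !rank_oneE scalerDr !scalerA mulrC.
have Q := state_form_psd sphi.
have p0 : 0 <= re (phi (rank_one w w)).
  apply/re_ge0/(state_ge0 sphi) => x; rewrite rank_oneE (formZl P).
  by rewrite (inner_conj x w) mul_conj rc_ge0 addr_ge0 ?sqr_ge0.
have fb x : re (f x) ^+ 2 + im (f x) ^+ 2 <= re (phi (rank_one w w)) * n2 x.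
  have := form_cauchy Q (rank_one x w) (bop_id H).
  have -> : state_form phi (rank_one x w) (bop_id H) = f x.
    by rewrite /state_form adj_id /f; congr phi; exact: bopE.
  have -> : nq (state_form phi) (bop_id H) = 1.
    rewrite /nq /state_form adj_id -re1 -(state_id sphi); congr (re (phi _)); exact: bopE.
  have -> : nq (state_form phi) (rank_one x w) = re (phi (rank_one w w)) * n2 x.
    rewrite /nq /state_form adj_rank_one mulrC -re_rcM -functionalZ //; congr (re (phi _)).
    apply: bopE => z; rewrite scale_bopE /= !rank_oneE (formZl P) n2E.
    by rewrite scalerA mulrC.
  by rewrite mulr1.
have [u fu] := riesz lf p0 fb.
have u0 : u != 0.
  by apply: contra_neq w0 => u0; have := fu w; rewrite /f u0 (form0r P).
have uS i h : inner (S i h) u = lam 0 i * inner h u.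
  rewrite -!fu /f -(mulS i (rank_one h w)).2; congr phi; apply: bopE => z.
  by rewrite /= !rank_oneE bopZ.
have Su i : S i u = lam 0 i *: u.
  apply: inner_inj => h; rewrite -adjP' (formZr P) -!fu /f.
  have -> : rank_one (adj (S i) h) w = adj (bcomp (rank_one w h) (S i)).
    by apply: bopE => z; rewrite adj_comp adj_rank_one /= !rank_oneE bopZ.
  rewrite -(adj_rank_one w h) !(state_adj _ sphi) (mulS i (rank_one w h)).1.
  by rewrite rmorphM mulrC.
have [s s0 s1] := normalize u0.
exists (rc s *: u); split=> // i; split.
  by rewrite bopZ Su !scalerA mulrC.
by move=> x; rewrite !(formZr P) uS mulrCA.
Qed.

Hypothesis cS : forall i, compact_op (S i).

(** Multiplicativity makes [phi] vanish on each [bcomp (adj (T i)) (T i)] with [T i = S i - lam_i],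
    so the [T i] have joint approximate null vectors [v]. Along them [S i0 v] clusters by
    compactness, and with it [v], which is nearly [S i0 v / lam_i0]. *)
Lemma eigvec_nonzero (phi : bop H H -> C) lam : state phi -> extreme K lam ->
  (forall i, phi (S i) = lam 0 i) -> lam != 0 -> exists v, eigvec lam v.
Proof.
move=> sphi elam philam lam0; have lphi := state_linear sphi.
have mulS := state_extreme_mul sphi elam philam.
have [i0 li0] : exists i0, lam 0 i0 != 0.
  apply: contrapT => nl; move/eqP: lam0; apply; apply/rowP => i; rewrite mxE.
  by apply/eqP; apply: contrapT => /negP li; apply: nl; exists i.
pose T i : bop H H := (- lam 0 i) *: bop_id H + S i.
have TE i x : T i x = S i x - lam 0 i *: x.
  by rewrite /T add_bopE scale_bopE /= scaleNr addrC.
have phiT i : phi (bcomp (adj (T i)) (T i)) = 0.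
  have phiTi : phi (T i) = 0 by rewrite lphi (state_id sphi) philam mulr1 addNr.
  rewrite {2}/T bcomp_linr lphi (mulS i (adj (T i))).1.
  have -> : bcomp (adj (T i)) (bop_id H) = adj (T i) by exact: bopE.
  by rewrite mulNr [phi _ * _]mulrC addNr.
pose Z e : set H := [set v | n2 v = 1 /\ \sum_i n2 (T i v) < e].
(* Otherwise the sum of the [bcomp (adj (T i)) (T i)] is at least [e], and applying [phi] gives
   [e <= 0]. *)
have Z0 e : 0 < e -> Z e !=set0.
  move=> e0; apply: contrapT => nZ.
  have low v : rc e * inner v v <= \sum_i inner (T i v) (T i v).
    have [->|v0] := eqVneq v 0.
      by rewrite (form0l P) mulr0 sumr_ge0 // => i _; rewrite n2E rc_ge0 n2_ge0.
    under eq_bigr do rewrite n2E; rewrite -raddf_sum /= n2E -rcM rc_le.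
    have [s s0 s1] := normalize v0.
    rewrite leNgt; apply/negP => lt; apply: nZ; exists (rc s *: v); split=> //.
    under eq_bigr do rewrite bopZ n2Zr; rewrite -mulr_sumr.
    have -> : e = s ^+ 2 * (e * n2 v) by rewrite mulrCA -n2Zr s1 mulr1.
    by rewrite ltr_pM2l // exprn_gt0.
  have := @state_ge0 _ _ _ sphi ((- rc e) *: bop_id H + \sum_i bcomp (adj (T i)) (T i)).
  have phiS : phi (\sum_i bcomp (adj (T i)) (T i)) = 0.
    by rewrite functional_sum //; apply: big1 => i _; exact: phiT.
  rewrite lphi (state_id sphi) phiS mulr1 addr0 oppr_ge0 -rc0 rc_le => /(_ _) h.
  have : e <= 0.
    apply: h => v; rewrite add_bopE scale_bopE sum_bopE (formDl P) (formZl P) (form_suml P) /=.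
    rewrite mulNr addrC subr_ge0; under eq_bigr do rewrite adjP'; exact: low.
  lra.
have Zmono e e' : 0 < e -> e <= e' -> Z e `<=` Z e'.
  by move=> e0 ee v [v1 ve]; split=> //; exact: lt_le_trans ve ee.
have Z1 e x : 0 < e -> Z e x -> n2 x <= 1 by move=> _ [-> _].
have [c cP] := compact_op_n2 (@cS i0) Z0 Zmono Z1.
pose u := (lam 0 i0)^-1 *: c.
pose k : R := re ((lam 0 i0)^-1) ^+ 2 + im ((lam 0 i0)^-1) ^+ 2.
have k0 : 0 <= k by rewrite addr_ge0 ?sqr_ge0.
have near e : 0 < e -> exists2 v, Z e v & n2 (v - u) < e.
  (* The triangle inequality costs [4 e'] and the division by [lam_i0] the factor [k]. *)
  move=> e0; pose e' := e / (4 * (k + 1)).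
  have e'0 : 0 < e' by rewrite divr_gt0 // mulr_gt0 //; lra.
  have ee' : e' * (4 * (k + 1)) = e by rewrite /e' divfK // gt_eqF // mulr_gt0 //; lra.
  have [v Zv vc] := cP e' e' e'0 e'0; exists v.
    by apply: Zmono Zv => //; rewrite -ee'; nra.
  have -> : v - u = (lam 0 i0)^-1 *: (lam 0 i0 *: v - c).
    by rewrite scalerBr scalerA mulVf // scale1r.
  rewrite n2Z -/k.
  have h1 : n2 (lam 0 i0 *: v - S i0 v) < e'.
    rewrite n2BC -TE; apply: le_lt_trans Zv.2.
    by rewrite (bigD1 i0) //= lerDl sumr_ge0 // => i _; exact: n2_ge0.
  have h2 := n2_triangle (lam 0 i0 *: v) (S i0 v) c.
  have : k * n2 (lam 0 i0 *: v - c) <= k * (4 * e') by rewrite ler_wpM2l //; lra.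
  rewrite -ee'; nra.
have u0 : u != 0.
  apply/eqP => u0; have [v [v1 _]] := near 2^-1 ltac:(by rewrite invr_gt0).
  rewrite u0 subr0 v1; lra.
have Su i : S i u = lam 0 i *: u.
  apply/eqP; rewrite -subr_eq0 -TE; apply/eqP/n2_eq0/le_anti; rewrite n2_ge0 andbT.
  have [b b0 Tb] := bop_bounded (T i).
  rewrite leNgt; apply/negP => Tu.
  have [|v [v1 ve] vu] := near (n2 (T i u) / (4 * (b + 1))).
    by rewrite divr_gt0 // mulr_gt0 //; lra.
  set e := _ / _ in ve vu.
  have ee : e * (4 * (b + 1)) = n2 (T i u) by rewrite /e divfK // gt_eqF // mulr_gt0 //; lra.
  have h1 : n2 (T i v) < e.
    apply: le_lt_trans ve.
    by rewrite (bigD1 i) //= lerDl sumr_ge0 // => j _; exact: n2_ge0.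
  have := n2D_le (T i v) (T i (u - v)); rewrite -bopD subrKC.
  have := Tb (u - v); rewrite n2BC in vu.
  have : b * n2 (u - v) <= b * e by rewrite ler_wpM2l // ltW.
  rewrite -ee; have := n2_ge0 (T i v); nra.
have [s s0 s1] := normalize u0.
exists (rc s *: u); apply: eigvec_of_diag => // i.
by rewrite bopZ Su scalerA mulrC -scalerA (formZl P) n2E s1 rc1 mulr1.
Qed.
End CompactTuples.

(** * States with prescribed values and inclusion of the minimal set in a matrix range *)

Section PointStates.
Variables (R : realType) (d : nat) (K : set 'rV[Cplx R]_d).
Local Notation C := (Cplx R).

(** The dilation is the scalar tuple [z] on [H], whose spectrum lies in [{z}]; the isometry sends 1
    to [e]. *)
Lemma Wmin_point (H : hilbertType R) (e : H) (z : 'rV[C]_d) : n2 e = 1 -> K z ->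
  Wmin K (existT _ 0%N (fun i => (z 0 i)%:M) : mxtuple R d).
Proof.
move=> e1 Kz; have P := inner_psd H.
exists H, (fun i => z 0 i *: bop_id H); split.
- split=> [i|i j x]; last by rewrite !scale_bopE /= !scalerA mulrC.
  exists ((z 0 i)^* *: bop_id H) => x.
    by move=> y; rewrite !scale_bopE (formZl P) (formZr P) conjCK.
  by rewrite !scale_bopE /= !scalerA mulrC.
- move=> l /= nl; suff -> : l = z by [].
  apply/rowP => i0; apply: contrapT => /eqP li; apply: nl.
  have zl : z 0 i0 - l 0 i0 != 0 by rewrite subr_eq0 eq_sym.
  have inv x : (z 0 i0 - l 0 i0)^-1 *: (z 0 i0 *: x - l 0 i0 *: x) = x :> H.
    by rewrite -scalerBl scalerA mulVf // scale1r.
  pose B i : bop H H := if i == i0 then (z 0 i0 - l 0 i0)^-1 *: bop_id H else 0.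
  split; exists B => x; rewrite (bigD1 i0) //= big1 ?addr0 => [|i /negbTE ii].
  + by rewrite /B eqxx !scale_bopE /= inv.
  + by rewrite /B ii zero_bopE.
  + rewrite /B eqxx -[RHS]inv.
    change (z 0 i0 *: ((z 0 i0 - l 0 i0)^-1 *: x) - l 0 i0 *: ((z 0 i0 - l 0 i0)^-1 *: x) =
      (z 0 i0 - l 0 i0)^-1 *: (z 0 i0 *: x - l 0 i0 *: x)).
    by rewrite scalerBr !scalerA ![_ * _^-1]mulrC.
  + rewrite /B ii; change (z 0 i *: (0 : H) - l 0 i *: (0 : H) = 0).
    by rewrite !scaler0 subrr.
pose V (x : 'cV[C]_1) : H := x 0 0 *: e.
have lV : linear V by move=> c x y; rewrite /V !mxE scalerDl scalerA.
pose V' : {linear 'cV[C]_1 -> H} :=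
  HB.pack V (GRing.isLinear.Build C 'cV[C]_1 H _ V lV).
exists V', (fun y => (inner y e)%:M); split=> [x y|x y|i x] /=.
- rewrite /V (formZl P) (formZr P) n2E e1 rc1 mulr1 /cinner big_ord1 //.
- by rewrite /V (formZl P) /cinner big_ord1 mxE eqxx mulr1n -inner_conj.
- change ((z 0 i)%:M *m x = (inner (z 0 i *: (x 0 0 *: e)) e)%:M).
  rewrite !(formZl P) n2E e1 rc1 mulr1; apply/colP => k.
  by rewrite ord1 mul_scalar_mx !mxE eqxx mulr1n.
Qed.

Lemma state_of_point (H : hilbertType R) (S : optuple d H) (e : H) (z : 'rV[C]_d) :
  Wmin K `<=` matrix_range S -> n2 e = 1 -> K z ->
  exists2 phi : bop H H -> C, state phi & forall i, phi (S i) = z 0 i.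
Proof.
move=> WS e1 Kz; have [psi upsi /= psiS] := WS _ (Wmin_point e1 Kz).
exists (fun A => psi A 0 0); first exact: state_of_ucp.
by move=> i; rewrite -psiS mxE eqxx mulr1n.
Qed.

Lemma state_comb (H : hilbertType R) m (t : 'I_m -> R) (phi : 'I_m -> bop H H -> C) :
  (forall j, 0 <= t j) -> \sum_j t j = 1 -> (forall j, state (phi j)) ->
  state (fun A => \sum_j rc (t j) * phi j A).
Proof.
move=> t0 t1 sphi; split=> [c A B|A Ap|].
- rewrite mulr_sumr -big_split; apply: eq_bigr => j _ /=.
  by rewrite (state_linear (sphi j)) mulrDr mulrCA.
- by apply: sumr_ge0 => j _; rewrite mulr_ge0 ?rc_ge0 // (state_ge0 (sphi j)).
- under eq_bigr do rewrite (state_id (sphi _)) mulr1.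
  by rewrite -raddf_sum t1.
Qed.

(** The criterion by which a compression is shown to lose nothing: convex combinations carry the
    states from [closure (extreme K)] to all of [K], and then the decomposition of a point of
    [Wmin K] becomes a UCP map by [range_of_states]. *)
Lemma Wmin_sub_range (L : hilbertType R) (X : optuple d L) : compact K ->
  (forall y, closure (extreme K) y ->
     exists2 phi : bop L L -> C, state phi & forall i, phi (X i) = y 0 i) ->
  Wmin K `<=` matrix_range X.
Proof.
move=> cK extX.
have KX z : K z -> exists phi : bop L L -> C, state phi /\ forall i, phi (X i) = z 0 i.
  move=> Kz; have [m [t [y [t0 t1 Yy zE]]]] := extreme_hull cK Kz.
  have /choice[phi phiP] : forall j, exists phi : bop L L -> C,
      state phi /\ forall i, phi (X i) = y j 0 i.
    by move=> j; have [phi sphi phiX] := extX _ (Yy j); exists phi.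
  exists (fun A => \sum_j rc (t j) * phi j A); split.
    by apply: state_comb => // j; exact: (phiP j).1.
  move=> i; rewrite zE summxE; apply: eq_bigr => j _.
  by rewrite (phiP j).2 mxE.
move=> [n Y] WY; have [m [z [B [Kz Bp B1 YE]]]] := Wmin_decomposition cK WY.
have /choice[phi phiP] : forall j, exists phi : bop L L -> C,
    state phi /\ forall i, phi (X i) = z j 0 i.
  by move=> j; exact: KX.
apply: (range_of_states (phi := phi) _ Bp B1) => [j|i]; first exact: (phiP j).1.
by rewrite -[Y i]/(tagged (existT _ n Y : mxtuple R d) i) YE; apply: eq_bigr => j _;
  rewrite (phiP j).2.
Qed.

Lemma nbhs_row (y : 'rV[C]_d) (e : R) : 0 < e ->
  nbhs y [set x : 'rV[C]_d | forall i, re `|y 0 i - x 0 i| < e].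
Proof.
move=> e0; exists (fun i j => [set c | re `|y i j - c| < e]).
  by move=> i j; apply/nbhs_cplx; exists e.
by move=> x xP i; exact: xP.
Qed.
End PointStates.

(** * Isolation of nonzero eigenvalues of compact tuples *)

Section Isolation.
Variables (R : realType) (d : nat) (H : hilbertType R) (S : optuple d H).
Local Notation C := (Cplx R).
Local Notation Cd := 'rV[C]_d.
Let P := inner_psd H.

Lemma row_neq (x y : Cd) : x != y -> exists i, x 0 i != y 0 i.
Proof.
move=> xy; apply: contrapT => nl; move/eqP: xy; apply; apply/rowP => i.
by apply/eqP; apply: contrapT => /negP li; apply: nl; exists i.
Qed.

Lemma eigvec_orth lam mu (v w : H) : eigvec S lam v -> eigvec S mu w -> lam != mu ->
  inner v w = 0.
Proof.
move=> [_ vS] [_ wS] /row_neq[i lm].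
have := (wS i).2 v; rewrite (vS i).1 (formZl P) => /eqP.
by rewrite -subr_eq0 -mulrBl mulf_eq0 subr_eq0 (negbTE lm) => /eqP.
Qed.

Lemma norm_gt0_re (c : C) : c != 0 -> 0 < re `|c|.
Proof. by move=> c0; rewrite -rc_lt rc0 re_norm normr_gt0. Qed.

(* Unit eigenvectors for distinct eigenvalues near y <> 0 would have images that
   stay a fixed distance apart, against compactness. *)
Lemma eigvec_isolated (E : set Cd) (v : Cd -> H) (y : Cd) :
  (forall i, compact_op (S i)) -> (forall lam, E lam -> eigvec S lam (v lam)) ->
  y != 0 -> exists2 e : R, 0 < e &
    forall lam, E lam -> (forall i, re `|y 0 i - lam 0 i| < e) -> lam = y.
Proof.
move=> cS vE /row_neq[i0]; rewrite mxE => y0.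
apply: contrapT => nE.
have far e : 0 < e -> exists lam,
    [/\ E lam, forall i, re `|y 0 i - lam 0 i| < e & lam != y].
  move=> e0; apply: contrapT => nl; apply: nE; exists e => // lam Elam lamy.
  by apply/eqP; apply: contrapT => /negP ly; apply: nl; exists lam.
pose Z e : set H := [set x | exists lam,
  [/\ E lam, forall i, re `|y 0 i - lam 0 i| < e, lam != y & x = v lam]].
have Z0 e : 0 < e -> Z e !=set0.
  by move=> /far[lam [El ly ln]]; exists (v lam), lam.
have Zmono e e' : 0 < e -> e <= e' -> Z e `<=` Z e'.
  move=> e0 ee x [lam [El ly ln ->]]; exists lam; split=> // i.
  exact: lt_le_trans (ly i) ee.
have Z1 e x : 0 < e -> Z e x -> n2 x <= 1.
  by move=> _ [lam [El _ _ ->]]; rewrite (vE _ El).1.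
have [c cP] := compact_op_n2 (cS i0) Z0 Zmono Z1.
pose a := re `|y 0 i0|; have a0 : 0 < a by exact: norm_gt0_re.
(* Two images within [dl] of the cluster point are at squared distance below [4 dl = a ^ 2 / 4], but
   orthogonality puts them at least [a ^ 2 / 2] apart. *)
pose dl := a ^+ 2 / 16.
have dl0 : 0 < dl by rewrite divr_gt0 // exprn_gt0.
have big (lam : Cd) : (forall i, re `|y 0 i - lam 0 i| < a / 2) ->
    a ^+ 2 / 4 <= re (lam 0 i0) ^+ 2 + im (lam 0 i0) ^+ 2.
  move=> /(_ i0) ly.
  have tri : a <= re `|y 0 i0 - lam 0 i0| + re `|lam 0 i0|.
    by rewrite -reD le_re //; have := ler_normD (y 0 i0 - lam 0 i0) (lam 0 i0); rewrite subrK.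
  have e : re `|lam 0 i0| ^+ 2 = re (lam 0 i0) ^+ 2 + im (lam 0 i0) ^+ 2.
    by rewrite -[LHS]re_rc rcX re_norm sqr_norm re_rc.
  rewrite -e; have : a / 2 <= re `|lam 0 i0| by lra.
  by move=> h; have : (a / 2) ^+ 2 <= re `|lam 0 i0| ^+ 2;
    [rewrite ler_pXn2r ?nnegrE ?re_ge0 ?divr_ge0 // ltW | rewrite !expr2; lra].
have a2 : 0 < a / 2 by rewrite divr_gt0.
have [_ [l1 [E1 l1y l1n ->]] c1] := cP dl _ dl0 a2.
have [j lj] := row_neq l1n.
(* Coming closer to [y] than [l1] does in coordinate [j] guarantees a second eigenvalue different
   from [l1]. *)
pose e := Num.min (a / 2) (re `|y 0 j - l1 0 j|).
have e0 : 0 < e by rewrite lt_min a2 norm_gt0_re // subr_eq0 eq_sym.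
have [_ [l2 [E2 l2y l2n ->]] c2] := cP dl _ dl0 e0.
have l12 : l1 != l2.
  apply/eqP => l12; have := l2y j; rewrite -l12 lt_min ltxx andbF //.
have l2y' i : re `|y 0 i - l2 0 i| < a / 2.
  by apply: lt_le_trans (l2y i) _; rewrite ge_min lexx.
have := n2_triangle (S i0 (v l1)) c (S i0 (v l2)); rewrite (n2BC c).
have -> : n2 (S i0 (v l1) - S i0 (v l2)) =
    (re (l1 0 i0) ^+ 2 + im (l1 0 i0) ^+ 2) + (re (l2 0 i0) ^+ 2 + im (l2 0 i0) ^+ 2).
  rewrite ((vE _ E1).2 i0).1 ((vE _ E2).2 i0).1 /n2 (nqB P) -!/(n2 _) !n2Z.
  rewrite (vE _ E1).1 (vE _ E2).1 (formZl P) (formZr P) (eigvec_orth (vE _ E1) (vE _ E2) l12).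
  by rewrite !mulr0 !mulr1 subr0.
have := big l1 l1y; have := big l2 l2y'; rewrite /dl in c1 c2 *.
have := exprn_gt0 2 a0; lra.
Qed.
End Isolation.

(** * States at limits of eigenvalues *)

Section LimitState.
Variables (R : realType) (d : nat) (L : hilbertType R) (X : optuple d L).
Local Notation C := (Cplx R).
Local Notation Cd := 'rV[C]_d.
Let P := inner_psd L.

(** The vector states of the [w lam] are followed along an ultrafilter that contains [E] and
    converges to [y]; their values stay in a compact box, so they all converge, and the limit is a
    state. *)
Lemma limit_state (E : set Cd) (w : Cd -> L) (y : Cd) : closure E y ->
  (forall lam, E lam -> n2 (w lam) = 1) ->
  (forall lam, E lam -> forall i, inner (X i (w lam)) (w lam) = lam 0 i) ->
  exists2 phi : bop L L -> C, state phi & forall i, phi (X i) = y 0 i.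
Proof.
move=> Ey w1 wX.
have FF : ProperFilter (within E (nbhs y)).
  split; last exact: within_filter.
  by move=> /Ey[x [Ex]]; exact.
have [U [UU FU]] := ultraFilterLemma FF.
have UE : U E by apply: FU; apply: (@filterS _ (nbhs y) _ setT) => //; exact: filterT.
pose g (A : bop L L) lam : C := inner (A (w lam)) (w lam).
have gcvg A : exists p : C, g A @ U --> p.
  have [c c0 Ac] := bop_bounded A.
  have gbox lam : E lam -> cbox (c + 1) (g A lam).
    move=> El; have := form_cauchy P (A (w lam)) (w lam); rewrite -!/(n2 _) w1 // mulr1.
    have := Ac (w lam); rewrite w1 // mulr1 -/(g A lam) => h1 h2.
    have c1 : 0 <= c + 1 by rewrite addr_ge0.
    have cc : c <= (c + 1) ^+ 2 by rewrite expr2; nra.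
    have r0 := sqr_ge0 (re (g A lam)); have i0 := sqr_ge0 (im (g A lam)).
    by split; rewrite -(ler_pXn2r (n := 2)) ?nnegrE // real_normK ?num_real //; lra.
  have [|p [_ clp]] := @cbox_compact R (c + 1) (g A @ U) _.
    by rewrite /fmap /nbhs /=; apply: filterS UE => lam El; exact: (gbox lam El).
  exists p => B Bp; have [//|nB] := in_ultra_setVsetC (g A @^-1` B) UU.
  by have [x [nBx Bx]] := clp (~` B) B nB Bp; have := nBx Bx.
have hC : hausdorff_space C by exact: norm_hausdorff.
have /choice[phi phiP] : forall A, exists p : C, g A @ U --> p by [].
have phiE A (p : C) : g A @ U --> p -> phi A = p.
  by move=> Ap; apply: (cvg_unique hC (phiP A) Ap).
have phiC A (p : C) : (forall lam, E lam -> g A lam = p) -> phi A = p.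
  move=> gp; apply: phiE => B Bp; suff : U (g A @^-1` B) by [].
  apply: filterS UE => lam El; rewrite /preimage /= gp //; exact: nbhs_singleton.
exists phi; last first.
  move=> i; apply: phiE => B Bp.
  have : nbhs y [set x : Cd | B (x 0 i)] by exact: (entry_continuous (i := 0) (j := i) Bp).
  move=> nB; have : U [set x : Cd | B (x 0 i)].
    by apply: FU; apply: filterS nB => x.
  move=> UB; suff : U (g (X i) @^-1` B) by [].
  by apply: filterS (filterI UE UB) => lam [El]; rewrite /= /g /preimage /= wX.
split.
- move=> c A B; apply: phiE.
  have -> : g (c *: A + B) = fun lam => c * g A lam + g B lam.
    by apply: funext => lam; rewrite /g (formDl P) (formZl P).
  exact: (@cvgD C C^o _ _ _ _ _ _ _ (@cvgM C _ _ _ _ _ _ _ (cvg_cst c) (phiP A)) (phiP B)).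
- move=> A Ap; rewrite ge0E; apply/andP; split.
    apply/eqP; have h := cvg_comp (g A) (@im R) (phiP A) (@im_continuous R (phi A)).
    apply: (cvg_unique (@norm_hausdorff _ R^o) h).
    have -> : @im R \o g A = fun=> 0.
      by apply: funext => lam; have := Ap (w lam); rewrite ge0E => /andP[/eqP].
    exact: cvg_cst.
  have h := cvg_comp (g A) (@re R) (phiP A) (@re_continuous R (phi A)).
  apply: (closed_cvg _ (@closed_ge R 0) _ _ h).
  by apply: nearW => lam; exact/re_ge0/Ap.
- by apply: phiC => lam El; rewrite /g n2E w1.
Qed.
End LimitState.

(** * The minimal tuple is diagonal *)

Section Subspaces.
Variables (R : realType) (H : hilbertType R).
Local Notation C := (Cplx R).
Implicit Types G : csubspace H.

Lemma bop_continuous (L : hilbertType R) (A : bop H L) : continuous A.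
Proof. by have /asboolP[] := bop_funP A. Qed.

Lemma preim_csubspace_closed (A : bop H H) G : closed (A @^-1` (G : set H)).
Proof.
by apply: preimage_closed; [move=> x _; exact: bop_continuous | exact: cs_closed].
Qed.
Definition preim_csubspace (A : bop H H) G : csubspace H.
Proof.
apply: (@CSubspace R H (A @^-1` (G : set H))).
- by rewrite /preimage /= bop0; exact: cs_zero.
- by move=> c x y; rewrite /preimage /= bopD bopZ; exact: cs_linear.
- exact: preim_csubspace_closed.
Defined.

Definition ker_csubspace (A : bop H H) : csubspace H.
Proof.
apply: (@CSubspace R H [set x | A x = 0]).
- by rewrite /= bop0.
- by move=> c x y /= Ax Ay; rewrite bopD bopZ Ax Ay scaler0 addr0.
- apply: (@preimage_closed _ _ A [set y | y = 0]); first by move=> x _; exact: bop_continuous.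
  by rewrite (_ : [set y | y = 0] = [set 0]) //; exact/accessible_closed_set1/hausdorff_accessible/norm_hausdorff.
Defined.

(** Being an intersection, it comes with an induction principle: a property of the span is proved by
    exhibiting one closed subspace that contains [B]. *)
Definition span_csubspace (B : set H) : csubspace H.
Proof.
apply: (@CSubspace R H [set x | forall G, B `<=` (G : set H) -> (G : set H) x]).
- by move=> G _; exact: cs_zero.
- by move=> c x y Bx By G BG; apply: cs_linear; [exact: Bx | exact: By].
- move=> x cx G BG; apply: (@cs_closed _ _ G); apply: closure_subset cx => y By.
  exact: By.
Defined.

Lemma inner_cspoint G (x y : cspoint G) : inner x y = inner (csval x) (csval y).
Proof. by []. Qed.
Lemma n2_cspoint G (x : cspoint G) : n2 x = n2 (csval x).
Proof. by []. Qed.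
Lemma cspoint_in G (x : cspoint G) : (G : set H) (csval x).
Proof. by have := csvalP x; rewrite inE. Qed.

Lemma inclusion_exists G : {I : bop (cspoint G) H | forall x, I x = csval x}.
Proof.
by apply: (linear_bounded_bop (c := 1)) => // x; rewrite mul1r.
Qed.

Lemma corestrict_exists G (L : hilbertType R) (Q : bop L H) :
  (forall x, (G : set H) (Q x)) -> exists P : bop L (cspoint G), forall x, csval (P x) = Q x.
Proof.
move=> QG; have QG' x : Q x \in cspred G by rewrite !inE; exact: QG.
have [c c0 Qc] := bop_bounded Q.
pose f x := CSPoint (QG' x).
have lf : linear f by move=> a x y; apply: val_inj; rewrite /= bopD bopZ.
have [P PE] := @linear_bounded_bop R L (cspoint G) f c lf Qc.
by exists P => x; rewrite PE.
Qed.

Lemma compression_vector_state d (S : optuple d H) G (X : optuple d (cspoint G)) lam v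
    (Gv : v \in cspred G) :
  compression S X -> eigvec S lam v -> forall i,
  inner (X i (CSPoint Gv)) (CSPoint Gv) = lam 0 i.
Proof.
move=> SX [v1 vS] i; have := SX i (CSPoint Gv) (CSPoint Gv).
rewrite /= (formBl (inner_psd H)) => /eqP; rewrite subr_eq0 inner_cspoint /= => /eqP <-.
by rewrite (vS i).2 n2E v1 rc1 mulr1.
Qed.
End Subspaces.

Section Spanning.
Variables (R : realType) (d : nat) (K : set 'rV[Cplx R]_d).
Variables (H : hilbertType R) (S : optuple d H) (e : H).
Local Notation C := (Cplx R).
Local Notation Cd := 'rV[C]_d.
Hypothesis cK : compact K.
Hypothesis cvK : convex_set K.
Hypothesis SK : matrix_range S = Wmin K.
Hypothesis cS : forall i, compact_op (S i).
Hypothesis fS : fully_compressed S.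
Hypothesis e1 : n2 e = 1.
Let P := inner_psd H.

Definition extreme_nz : set Cd := [set lam | extreme K lam /\ lam != 0].

(* The joint spectrum of the minimal tuple: 0 is dropped exactly when it is
   already produced by the other eigenvalues accumulating at 0. *)
Definition spec_index : set Cd :=
  [set lam | extreme K lam /\ (lam != 0 \/ ~ closure extreme_nz 0)].

Lemma extreme_state lam : extreme K lam ->
  exists2 phi : bop H H -> C, state phi & forall i, phi (S i) = lam 0 i.
Proof. by move=> [Kl _]; apply: (state_of_point _ e1 Kl); rewrite SK. Qed.

Lemma extreme_nz_eigvec lam : extreme_nz lam -> exists v, eigvec S lam v.
Proof.
move=> [el ln]; have [phi sphi phil] := extreme_state el.
exact: (eigvec_nonzero cK cvK SK cS sphi el phil ln).
Qed.

Lemma extreme_nz_basis : exists v : Cd -> H, forall lam, extreme_nz lam -> eigvec S lam (v lam).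
Proof.
have /choice[v vP] : forall lam, exists v, extreme_nz lam -> eigvec S lam v.
  move=> lam; have [el|nl] := pselect (extreme_nz lam); last by exists 0.
  by have [v vl] := extreme_nz_eigvec el; exists v.
by exists v.
Qed.

Lemma extreme_nz_isolated (y : Cd) : y != 0 -> exists2 e : R, 0 < e &
  forall lam, extreme_nz lam -> (forall i, re `|y 0 i - lam 0 i| < e) -> lam = y.
Proof.
by have [v vE] := extreme_nz_basis; exact: eigvec_isolated cS vE.
Qed.

(** By isolation, an extreme point close enough to the nonzero limit [y] is [y] itself. *)
Lemma closure_extreme_nz (y : Cd) : closure (extreme K) y -> y != 0 -> extreme K y.
Proof.
move=> cy y0; have [r r0 ry] := extreme_nz_isolated y0.
have [i0] := row_neq y0; rewrite mxE => yi0.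
(* The second bound excludes [lam = 0]. *)
pose r' := Num.min r (re `|y 0 i0|).
have r'0 : 0 < r' by rewrite lt_min r0 norm_gt0_re.
have [lam [el /= ly]] := cy _ (nbhs_row y r'0).
have ln : lam != 0.
  apply/eqP => l0; have := ly i0; rewrite l0 mxE subr0 lt_min ltxx andbF //.
rewrite -(ry lam) // => i; apply: lt_le_trans (ly i) _.
by rewrite ge_min lexx.
Qed.

(** Every point, 0 included by the hypothesis, has an open neighbourhood with at most one nonzero
    extreme point; compactness of [K] leaves finitely many. *)
Lemma extreme_nz_finite : ~ closure extreme_nz 0 ->
  exists s : seq Cd, forall lam, extreme_nz lam -> lam \in s.
Proof.
move=> n0.
have nb y : exists B : set Cd, open B /\ B y /\ forall lam, extreme_nz lam -> B lam -> lam = y.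
  have [->|y0] := eqVneq y 0.
    move: n0 => /existsNP[B /not_implyP[B0 nB]]; exists (interior B); split.
      exact: open_interior.
    split=> // lam El /interior_subset Bl; exfalso; apply: nB.
    by exists lam.
  have [r r0 ry] := extreme_nz_isolated y0.
  have nr := nbhs_row y r0; exists (interior [set x : Cd | forall i, re `|y 0 i - x 0 i| < r]).
  split; first exact: open_interior.
  by split=> // lam El /interior_subset; exact: ry.
have /choice[B BP] := nb.
have := cK; rewrite compact_cover => /(_ _ setT B) [y _|y Ky|D _ KD].
- exact: (BP y).1.
- by exists y => //; exact: (BP y).2.1.
exists (finmap.enum_fset D) => lam El; have [y /= yD Bl] := KD _ El.1.1.
by rewrite ((BP y).2.2 _ El Bl).
Qed.

(** Suppose the state at 0 vanishes on rank-one projections. Some unit [w] is orthogonal to the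
    eigenvectors of the finitely many nonzero extreme points. Compressing to the complement of [w]
    keeps their vector states, and [phi] still yields the value 0 there, so the matrix range does
    not shrink, against full compression. *)
Lemma kernel_eigvec : ~ closure extreme_nz 0 -> extreme K 0 -> exists v, eigvec S 0 v.
Proof.
move=> n0 e0; have [phi sphi phi0] := extreme_state e0.
have [//|sing] := eigvec_or_singular cK cvK SK sphi e0 phi0; exfalso.
have lphi := state_linear sphi.
have mulS := state_extreme_mul cK cvK SK sphi e0 phi0.
have [v vE] := extreme_nz_basis.
have [s0 s0P] := extreme_nz_finite n0.
pose s := [seq lam <- undup s0 | `[< extreme_nz lam >]].
have sE lam : lam \in s -> extreme_nz lam by rewrite mem_filter => /andP[/asboolP].
have sP lam : extreme_nz lam -> lam \in s.
  by move=> El; rewrite mem_filter mem_undup s0P // andbT; exact/asboolP.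
have us : uniq s by rewrite filter_uniq // undup_uniq.
(* Projection onto the span of these eigenvectors; [phi q = 0] against [phi 1 = 1] shows that it is
   not the identity. *)
pose q : bop H H := \sum_(lam <- s) rank_one (v lam) (v lam).
have phiq : phi q = 0.
  rewrite /q functional_sum // big1_seq // => lam _; exact: sing.
have [x xq] : exists x, bop_id H x - q x != 0.
  apply: contrapT => nx; suff qid : q = bop_id H.
    by have := state_id sphi; rewrite -qid phiq => /eqP; rewrite eq_sym oner_eq0.
  apply: bopE => x; apply/eqP; rewrite eq_sym -subr_eq0; apply: contrapT => /negP h.
  by apply: nx; exists x.
have [t t0 t1] := normalize xq.
pose w := rc t *: (bop_id H x - q x).
have wv lam : extreme_nz lam -> inner (v lam) w = 0.
  move=> El; rewrite /w (formZr P) (formBr P) /q sum_bopE (form_sumr P).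
  rewrite (bigD1_seq lam) //=; last exact: sP.
  rewrite rank_oneE (formZr P) -inner_conj n2E (vE _ El).1 rc1 mulr1.
  rewrite big1_seq ?addr0 ?subrr ?mulr0 // => mu /andP[ml /sE Em].
  rewrite rank_oneE (formZr P) (eigvec_orth (vE _ El) (vE _ Em)) ?mulr0 //.
  by rewrite eq_sym.
pose p := rank_one w w.
pose G := ker_csubspace p.
have inG y : inner y w = 0 -> (G : set H) y.
  by rewrite /G /= /p rank_oneE => ->; rewrite scale0r.
have Gin y : (G : set H) y -> inner y w = 0.
  move=> /= ; rewrite /p rank_oneE => h.
  have : inner (inner y w *: w) w = 0 by rewrite h (form0l P).
  by rewrite (formZl P) n2E t1 rc1 mulr1.
pose pc : bop H H := (-1) *: p + bop_id H.
have pcE y : pc y = y - inner y w *: w.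
  by rewrite /pc add_bopE scale_bopE /= /p rank_oneE scaleN1r addrC.
have pcG y : (G : set H) (pc y).
  by apply: inG; rewrite pcE (formBl P) (formZl P) n2E t1 rc1 mulr1 subrr.
have [Pi PiE] := corestrict_exists pcG.
have [I IE] := inclusion_exists G.
pose X i : bop (cspoint G) (cspoint G) := bcomp Pi (bcomp (S i) I).
have SX : compression S X.
  move=> i y z; rewrite /X /= PiE pcE IE opprB addrC subrK (formZl P).
  by rewrite (inner_conj (csval z)) (Gin _ (cspoint_in z)) rmorph0 mulr0.
have Gp : (G : set H) `<` setT.
  split=> // h; have := Gin w (h w Logic.I).
  by rewrite n2E t1 => /(congr1 re); rewrite re_rc re0 => /eqP; rewrite oner_eq0.
have [_ nsub] := fS Gp SX.
apply: nsub.
rewrite SK.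
apply: (Wmin_sub_range cK) => y cy.
have [->|y0] := eqVneq y 0; last first.
  have Ey : extreme_nz y by split; [exact: closure_extreme_nz cy y0 | exact: y0].
  have Gv : v y \in cspred G by rewrite !inE; apply: inG; exact: wv.
  exists (fun A => inner (A (CSPoint Gv)) (CSPoint Gv)).
    by apply: vector_state; rewrite n2_cspoint /= (vE _ Ey).1.
  exact: compression_vector_state SX (vE _ Ey).
(* [phi] transported along the projection onto [G]; it stays unital because [phi p = 0]. *)
exists (fun A => phi (bcomp I (bcomp A Pi))).
  split=> [c A B|A Ap|].
  - rewrite -lphi; congr phi; apply: bopE => z.
    change (I (c *: A (Pi z) + B (Pi z)) = c *: I (A (Pi z)) + I (B (Pi z))).
    by rewrite bopD bopZ.
  - apply: (state_ge0 sphi) => z /=; rewrite IE.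
    have := Ap (Pi z); rewrite inner_cspoint PiE pcE (formBr P) (formZr P).
    rewrite (inner_conj _ (csval (A (Pi z)))) -inner_conj (Gin _ (cspoint_in (A (Pi z)))).
    by rewrite mulr0 subr0.
  - have -> : bcomp I (bcomp (bop_id (cspoint G)) Pi) = pc.
      by apply: bopE => z /=; rewrite IE PiE.
    by rewrite /pc lphi (state_id sphi) sing mulr0 add0r.
move=> i; rewrite mxE.
have -> : bcomp I (bcomp (X i) Pi) = bcomp pc (bcomp (S i) pc).
  by apply: bopE => z /=; rewrite IE PiE /= IE PiE.
(* In the expansion of [(1 - p) S_i (1 - p)], the terms with one [p] vanish under [phi] by
   multiplicativity with value 0, and [p S_i p] is a multiple of [p]. *)
rewrite /pc bcomp_linl lphi.
have -> : bcomp p (bcomp (S i) ((-1) *: p + bop_id H)) =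
    (-1) *: bcomp p (bcomp (S i) p) + bcomp p (S i).
  apply: bopE => z.
  change (p (S i ((-1) *: p z + z)) = (-1) *: p (S i (p z)) + p (S i z)).
  by rewrite !(bopD, bopZ).
have -> : bcomp (bop_id H) (bcomp (S i) ((-1) *: p + bop_id H)) =
    (-1) *: bcomp (S i) p + S i.
  apply: bopE => z; change (S i ((-1) *: p z + z) = (-1) *: S i (p z) + S i z).
  by rewrite bopD bopZ.
have -> : bcomp p (bcomp (S i) p) = inner (S i w) w *: p.
  apply: bopE => z; change (p (S i (p z)) = inner (S i w) w *: p z).
  by rewrite /p !rank_oneE bopZ (formZl P) scalerA mulrC.
have a1 : phi (bcomp p (S i)) = 0 by rewrite (mulS i p).1 mxE mulr0.
have a2 : phi (bcomp (S i) p) = 0 by rewrite (mulS i p).2 mxE mul0r.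
have a3 c : phi (c *: p) = 0 by rewrite (functionalZ c p lphi) sing mulr0.
by rewrite 2!lphi a1 a2 a3 phi0 mxE !mulr0 !addr0 mulr0.
Qed.

Lemma spec_basis : exists v : Cd -> H, forall lam, spec_index lam -> eigvec S lam (v lam).
Proof.
have /choice[v vP] : forall lam, exists v, spec_index lam -> eigvec S lam v.
  move=> lam; have [[el l0]|nl] := pselect (spec_index lam); last by exists 0.
  have [lz|lz] := eqVneq lam 0.
    have [v vl] : exists v, eigvec S 0 v.
      by apply: kernel_eigvec; [case: l0 => //; rewrite lz eqxx | rewrite -lz].
    by exists v; rewrite lz.
  by have [v vl] := extreme_nz_eigvec (conj el lz); exists v.
by exists v.
Qed.

(** The closed span [G0] of the eigenvectors is invariant, so the restriction of [S] to it is a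
    compression. It keeps a state at every limit of extreme points, hence all of [Wmin K], and full
    compression leaves only [G0 = H]. *)
Lemma spec_basis_total (v : Cd -> H) (G : csubspace H) :
  (forall lam, spec_index lam -> eigvec S lam (v lam)) ->
  (forall lam, spec_index lam -> (G : set H) (v lam)) -> (G : set H) = setT.
Proof.
move=> vE Gv; pose G0 := span_csubspace [set v lam | lam in spec_index].
have G0v lam : spec_index lam -> (G0 : set H) (v lam).
  by move=> El G' h; apply: h; exists lam.
suff G0T : (G0 : set H) = setT.
  apply/seteqP; split=> // x _; have : (G0 : set H) x by rewrite G0T.
  by apply=> _ [lam El <-]; exact: Gv.
apply: contrapT => nT.
have Gp : (G0 : set H) `<` setT.
  by split=> // h; apply: nT; apply/seteqP; split.
have [I IE] := inclusion_exists G0.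
have SG0 i x : (G0 : set H) x -> (G0 : set H) (S i x).
  move=> /(_ (preim_csubspace (S i) G0)); apply=> _ [lam El <-].
  rewrite /= /preimage /= ((vE _ El).2 i).1.
  have := @cs_linear _ _ G0 (lam 0 i) (v lam) 0 (G0v _ El) (cs_zero G0).
  by rewrite addr0.
have /choice[X XE] : forall i, exists X : bop (cspoint G0) (cspoint G0),
    forall x, csval (X x) = S i (csval x).
  move=> i; have [x|X XE] := @corestrict_exists _ _ G0 _ (bcomp (S i) I).
    by rewrite /= IE; apply: SG0; exact: cspoint_in.
  by exists X => x; rewrite XE /= IE.
have SX : compression S X by move=> i x y; rewrite XE subrr (form0l P).
have [_ nsub] := fS Gp SX.
apply: nsub.
rewrite SK.
apply: (Wmin_sub_range cK) => y cy.
have vecstate lam : spec_index lam ->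
    exists2 phi : bop (cspoint G0) (cspoint G0) -> C, state phi & forall i, phi (X i) = lam 0 i.
  move=> El; have Gvl : v lam \in cspred G0 by rewrite !inE; exact: G0v.
  exists (fun A => inner (A (CSPoint Gvl)) (CSPoint Gvl)).
    by apply: vector_state; rewrite n2_cspoint /= (vE _ El).1.
  exact: compression_vector_state SX (vE _ El).
have [y0|y0] := eqVneq y 0; last first.
  by apply: vecstate; split; [exact: closure_extreme_nz | left].
(* If 0 is a limit of extreme points but not of nonzero ones, it is itself extreme and lies in
   [spec_index]. *)
have [c0|c0] := pselect (closure extreme_nz 0); last first.
  apply: vecstate; split; last by right.
  apply: contrapT => ne; apply: c0; rewrite -y0.
  apply: closure_subset cy => lam el; split=> //.
  by apply/eqP => l0; apply: ne; rewrite y0 -l0.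
have w0 lam : exists w : cspoint G0, extreme_nz lam -> csval w = v lam.
  have [El|nl] := pselect (extreme_nz lam); last by exists 0.
  have Gvl : v lam \in cspred G0 by rewrite !inE; apply: G0v; split; [exact: El.1|left; exact: El.2].
  by exists (CSPoint Gvl).
have /choice[w wE] := w0.
have Ei lam : extreme_nz lam -> spec_index lam by move=> [el ln]; split=> //; left.
(* Here the eigenvalues accumulate at 0, and the limit of their vector states takes the value 0
   without an eigenvector. *)
rewrite y0; apply: (@limit_state _ _ _ X extreme_nz w) => // lam El.
  by rewrite n2_cspoint wE // (vE _ (Ei _ El)).1.
move=> i; rewrite inner_cspoint XE wE // ((vE _ (Ei _ El)).2 i).1 (formZl P) n2E.
by rewrite (vE _ (Ei _ El)).1 rc1 mulr1.
Qed.
End Spanning.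

(** * Unitary equivalence *)

Section ClosedRelations.
Variable R : realType.
Local Notation C := (Cplx R).

(** Closed subspaces of the orthogonal sum of [H1] and [H2], phrased as relations so that the sum
    need not be constructed. *)
Record closed_linear (H1 H2 : hilbertType R) (Q : H1 -> H2 -> Prop) : Prop := ClosedLinear {
  crel0 : Q 0 0 ;
  crel_linear : forall (c : C) x y x' y', Q x y -> Q x' y' -> Q (c *: x + x') (c *: y + y') ;
  crel_closed : forall x y,
    (forall r : R, 0 < r -> exists x' y', [/\ Q x' y', n2 (x - x') < r & n2 (y - y') < r]) ->
    Q x y }.

(** Serves to extend an identity of inner products from the basis pairs to all of [pairing]. *)
Lemma closed_linear_inner (H1 H2 : hilbertType R) (a : H1) (b : H2) :
  closed_linear (fun x y => inner x a = inner y b).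
Proof.
have P1 := inner_psd H1; have P2 := inner_psd H2.
split=> [|c x y x' y' e e'|x y near].
- by rewrite (form0l P1) (form0l P2).
- by rewrite (formDl P1) (formDl P2) (formZl P1) (formZl P2) e e'.
pose D := inner x a - inner y b.
pose k := 2 * (n2 a + n2 b).
have k0 : 0 <= k by rewrite mulr_ge0 ?addr_ge0 ?n2_ge0.
have Dle r : 0 < r -> re D ^+ 2 + im D ^+ 2 <= k * r.
  move=> /near[x' [y' [e xx yy]]].
  have DE : D = inner (x - x') a - inner (y - y') b.
    rewrite (formBl P1) (formBl P2) e /D; ring.
  have := form_cauchy P1 (x - x') a; have := form_cauchy P2 (y - y') b.
  rewrite -!/(n2 _) DE reB imB; set p := inner _ a; set q := inner _ b => hq hp.
  have : n2 (x - x') * n2 a <= r * n2 a by rewrite ler_wpM2r ?n2_ge0 // ltW.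
  have : n2 (y - y') * n2 b <= r * n2 b by rewrite ler_wpM2r ?n2_ge0 // ltW.
  have := sqr_ge0 (re p + re q); have := sqr_ge0 (im p + im q); rewrite /k !expr2 in hp hq *; lra.
have D0 : re D ^+ 2 + im D ^+ 2 <= 0.
  rewrite leNgt; apply/negP => Dp.
  have r0 : 0 < (re D ^+ 2 + im D ^+ 2) / (2 * (k + 1)) by rewrite divr_gt0 // mulr_gt0 //; lra.
  have := Dle _ r0; set r := _ / _ in r0 *.
  have -> : re D ^+ 2 + im D ^+ 2 = r * (2 * (k + 1)).
    by rewrite /r divfK // gt_eqF // mulr_gt0 //; lra.
  nra.
apply/eqP; rewrite -subr_eq0 -/D; apply/eqP; apply: cplxP; apply/eqP;
  rewrite -sqrf_eq0 eq_le sqr_ge0 andbT; have := sqr_ge0 (re D); have := sqr_ge0 (im D); lra.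
Qed.

Section Pairing.
Variables (H1 H2 : hilbertType R) (I : Type) (E : set I) (v : I -> H1) (u : I -> H2).

(** Closed span of the pairs [(v l, u l)], the graph of the future unitary, with its induction
    principle built in. *)
Definition pairing x y := forall Q : H1 -> H2 -> Prop, closed_linear Q ->
  (forall l, E l -> Q (v l) (u l)) -> Q x y.

Lemma pairing_closed_linear : closed_linear pairing.
Proof.
split=> [Q cQ _|c x y x' y' xy xy' Q cQ Qv|x y near Q cQ Qv].
- exact: crel0 cQ.
- by apply: (crel_linear cQ); [exact: xy | exact: xy'].
- apply: (crel_closed cQ) => r /near[x' [y' [xy' xx yy]]].
  by exists x', y'; split=> //; exact: xy'.
Qed.

Lemma pairing_basis l : E l -> pairing (v l) (u l).
Proof. by move=> El Q _; exact. Qed.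

Hypothesis gram : forall l m, E l -> E m -> inner (v l) (v m) = inner (u l) (u m).

(** Two inductions over [pairing]: first with a basis vector in the second slot, then with a general
    pair. *)
Lemma pairing_inner x y x' y' : pairing x y -> pairing x' y' -> inner x x' = inner y y'.
Proof.
move=> xy xy'; have basis l : E l -> inner x (v l) = inner y (u l).
  move=> El; apply: xy (closed_linear_inner (v l) (u l)) _ => m Em.
  exact: gram.
rewrite inner_conj [RHS]inner_conj; congr (_^*).
apply: xy' (closed_linear_inner x y) _ => l El.
by rewrite inner_conj [RHS]inner_conj basis.
Qed.

Lemma pairing_n2 x y : pairing x y -> n2 x = n2 y.
Proof. by move=> xy; rewrite /n2 /nq (pairing_inner xy xy). Qed.

Lemma pairingB x y x' y' : pairing x y -> pairing x' y' -> pairing (x - x') (y - y').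
Proof.
move=> xy xy'; rewrite [x - x']addrC [y - y']addrC -(scaleN1r x') -(scaleN1r y').
exact: (crel_linear pairing_closed_linear).
Qed.

(** The domain of the relation contains the [v l], and it is closed because the relation is
    isometric and [H2] is complete. *)
Lemma pairing_total : (forall G : csubspace H1, (forall l, E l -> (G : set H1) (v l)) ->
    (G : set H1) = setT) -> forall x, exists y, pairing x y.
Proof.
move=> tot; have cP := pairing_closed_linear.
have clD : closed [set x | exists y, pairing x y].
  move=> x cx; pose Z r : set H2 := [set y | exists x', pairing x' y /\ n2 (x - x') < r].
  have [r r0|r r' r0 rr y [x' [xy xx]]|d d0|l lP] := @complete_n2 R H2 Z.
  - have [x' [[y xy] xx]] := cx [set x' | n2 (x - x') < r] ltac:(by apply/nbhs_n2; exists r).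
    by exists y, x'.
  - by exists x'; split=> //; exact: lt_le_trans xx rr.
  - exists (d / 4); first by rewrite divr_gt0.
    move=> y y' [a [ay xa]] [b [b_y xb]].
    rewrite -(pairing_n2 (pairingB ay b_y)).
    by have := n2_triangle a x b; rewrite (n2BC a x); lra.
  exists l; apply: (crel_closed cP) => r r0.
  have [y [x' [xy xx]] yl] := lP r r r0 r0.
  by exists x', y; split=> //; rewrite n2BC.
have linD (c : C) x x' : [set x | exists y, pairing x y] x ->
    [set x | exists y, pairing x y] x' -> [set x | exists y, pairing x y] (c *: x + x').
  move=> [y xy] [y' xy']; exists (c *: y + y'); exact: (crel_linear cP).
have zD : [set x | exists y, pairing x y] 0 by exists 0; exact: crel0 cP.
have := tot (CSubspace zD linD clD) (fun l El => ex_intro _ (u l) (pairing_basis El)).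
by move=> /= DT x; have : [set: H1] x by []; rewrite -DT.
Qed.
End Pairing.

Lemma pairing_sym (H1 H2 : hilbertType R) I (E : set I) (v : I -> H1) (u : I -> H2) x y :
  pairing E u v y x -> pairing E v u x y.
Proof.
have cP := pairing_closed_linear E v u.
move=> yx; apply: (yx (fun y x => pairing E v u x y)).
  split; first exact: crel0 cP.
    by move=> c ? ? ? ? h h'; exact: (crel_linear cP).
  move=> y' x' near; apply: (crel_closed cP) => r /near[a [b [ab ya xb]]].
  by exists b, a.
by move=> l El; exact: pairing_basis.
Qed.

Lemma pairing_unitary d (H1 H2 : hilbertType R) (S : optuple d H1) (T : optuple d H2)
    (E : set 'rV[C]_d) (v : 'rV[C]_d -> H1) (u : 'rV[C]_d -> H2) :
  (forall lam, E lam -> eigvec S lam (v lam)) ->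
  (forall lam, E lam -> eigvec T lam (u lam)) ->
  (forall G : csubspace H1, (forall l, E l -> (G : set H1) (v l)) -> (G : set H1) = setT) ->
  (forall G : csubspace H2, (forall l, E l -> (G : set H2) (u l)) -> (G : set H2) = setT) ->
  unitarily_equivalent S T.
Proof.
move=> vE uE vT uT.
have gram l m : E l -> E m -> inner (v l) (v m) = inner (u l) (u m).
  move=> El Em; have [->|lm] := eqVneq l m.
    by rewrite !n2E (vE _ Em).1 (uE _ Em).1.
  by rewrite (eigvec_orth (vE _ El) (vE _ Em) lm) (eigvec_orth (uE _ El) (uE _ Em) lm).
have gram' l m : E l -> E m -> inner (u l) (u m) = inner (v l) (v m).
  by move=> El Em; rewrite gram.
have cP := pairing_closed_linear E v u.
have /choice[U UP] := pairing_total gram vT.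
have /choice[V VP'] := pairing_total gram' uT.
have VP y : pairing E v u (V y) y by apply: pairing_sym.
have funr x y y' : pairing E v u x y -> pairing E v u x y' -> y = y'.
  move=> h h'; apply/eqP; rewrite -subr_eq0; apply/eqP/n2_eq0.
  by rewrite -(pairing_n2 gram (pairingB h h')) subrr n2_0.
have funl x x' y : pairing E v u x y -> pairing E v u x' y -> x = x'.
  move=> h h'; apply/eqP; rewrite -subr_eq0; apply/eqP/n2_eq0.
  by rewrite (pairing_n2 gram (pairingB h h')) subrr n2_0.
have lU : linear U by move=> c x x'; apply: (funr (c *: x + x')) => //; exact: (crel_linear cP).
have lV : linear V.
  by move=> c y y'; apply: (funl _ _ (c *: y + y')) => //; exact: (crel_linear cP).
have Ub x : n2 (U x) <= 1 * n2 x by rewrite mul1r (pairing_n2 gram (UP x)).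
have Vb y : n2 (V y) <= 1 * n2 y by rewrite mul1r (pairing_n2 gram (VP y)).
have [U' U'E] := linear_bounded_bop lU Ub.
have [V' V'E] := linear_bounded_bop lV Vb.
(* The pairs whose images under [S i] and [T i] are again paired form a closed linear relation, and
   it contains the basis pairs because both tuples act on them by the same scalars. *)
have inter i x y : pairing E v u x y -> pairing E v u (S i x) (T i y).
  move=> xy; apply: (xy (fun x y => pairing E v u (S i x) (T i y))).
    split; first by rewrite !bop0; exact: crel0 cP.
      by move=> c a b a' b' h h'; rewrite !bopD !bopZ; exact: (crel_linear cP).
    move=> a b near; apply: (crel_closed cP) => r r0.
    have [c1 c10 Sc] := bop_bounded (S i); have [c2 c20 Tc] := bop_bounded (T i).
    have s0 : 0 < c1 + c2 + 1 by lra.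
    have [|a' [b' [ab aa bb]]] := near (r / (c1 + c2 + 1)); first by rewrite divr_gt0.
    exists (S i a'), (T i b'); split=> //.
      rewrite -bopB; apply: le_lt_trans (Sc _) _.
      rewrite ltr_pdivlMr // in aa; apply: le_lt_trans aa.
      by rewrite mulrC ler_wpM2l ?n2_ge0 //; lra.
    rewrite -bopB; apply: le_lt_trans (Tc _) _.
    rewrite ltr_pdivlMr // in bb; apply: le_lt_trans bb.
    by rewrite mulrC ler_wpM2l ?n2_ge0 //; lra.
  move=> l El; rewrite ((vE _ El).2 i).1 ((uE _ El).2 i).1.
  rewrite -[l 0 i *: v l]addr0 -[l 0 i *: u l]addr0.
  by apply: (crel_linear cP); [exact: pairing_basis | exact: crel0 cP].
exists U', V'; split.
- by move=> x y; rewrite U'E V'E -(pairing_inner gram (UP x) (VP y)).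
- by move=> x; rewrite U'E V'E; apply: (funl _ _ (U x)) => //.
- by move=> y; rewrite U'E V'E; apply: (funr (V y)).
- move=> i x; rewrite V'E U'E; apply: (funl _ _ (T i (U x))) => //.
  exact: inter.
Qed.
End ClosedRelations.

Lemma trivial_or_unit (R : realType) (H : hilbertType R) :
  (forall x : H, x = 0) \/ exists e : H, n2 e = 1.
Proof.
have [|/existsNP[x /eqP x0]] := pselect (forall x : H, x = 0); first by left.
by right; have [s _ s1] := normalize x0; exists (rc s *: x).
Qed.

(** Matrices have size at least 1, so no linear map is unital when the identity operator is 0. *)
Lemma matrix_range_trivial (R : realType) d (H : hilbertType R) (S : optuple d H) :
  (forall x : H, x = 0) -> matrix_range S = set0.
Proof.
move=> H0; apply/seteqP; split=> // -[n X] [psi [psi1 _] _].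
have : bop_id H = 0 by apply: bopE => x; rewrite zero_bopE /=; exact: H0.
move=> id0; rewrite id0 linear0 in psi1.
have /matrixP/(_ 0 0) := psi1; rewrite !mxE eqxx => /esym/eqP.
by rewrite oner_eq0.
Qed.

Lemma matrix_range_nonempty (R : realType) d (H : hilbertType R) (S : optuple d H) (e : H) :
  n2 e = 1 -> matrix_range S !=set0.
Proof.
move=> e1; exists (existT _ 0%N (fun i => \sum_(j < 1) inner (S i e) e *: 1%:M)).
apply: (@range_of_states _ _ _ 1 0 S (fun _ A => inner (A e) e) (fun=> 1%:M)) => //.
- by move=> _; exact: vector_state.
- move=> _ x; rewrite mul1mx; apply: sumr_ge0 => k _.
  by rewrite mul_conj rc_ge0 addr_ge0 ?sqr_ge0.
- by rewrite big_ord1.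
Qed.

Theorem proposition3p21 (R : realType) (d : nat) (K : set 'rV[Cplx R]_d)
    (H1 H2 : hilbertType R) (S : optuple d H1) (T : optuple d H2) :
  compact K -> convex_set K ->
  (forall i, compact_op (S i)) -> (forall i, compact_op (T i)) ->
  fully_compressed S -> fully_compressed T ->
  matrix_range S = Wmin K -> matrix_range T = Wmin K ->
  unitarily_equivalent S T.
Proof.
move=> cK cvK cS cT fS fT SK TK.
(* A zero space has empty matrix range and a nonzero one does not, so either both spaces are zero or
   both contain a unit vector. *)
have [z1|[e1 e11]] := trivial_or_unit H1; have [z2|[e2 e21]] := trivial_or_unit H2.
- exists 0, 0; split=> [x y|x|y|i x]; last by rewrite [LHS]z1 [RHS]z1.
  + by rewrite !zero_bopE (form0l (inner_psd H2)) (form0r (inner_psd H1)).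
  + by rewrite [LHS]z1 [RHS]z1.
  + by rewrite [LHS]z2 [RHS]z2.
- have [X] := matrix_range_nonempty T e21.
  by rewrite TK -SK (matrix_range_trivial S z1).
- have [X] := matrix_range_nonempty S e11.
  by rewrite SK -TK (matrix_range_trivial T z2).
have [v vE] := spec_basis cK cvK SK cS fS e11.
have [u uE] := spec_basis cK cvK TK cT fT e21.
apply: (pairing_unitary vE uE) => G.
  exact: (spec_basis_total cK cvK SK cS fS e11 vE).
exact: (spec_basis_total cK cvK TK cT fT e21 uE).
Qed.
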